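(* Let $X,X_1,\ldots,X_n$ be i.i.d. random vectors in $\mathbb{R}^d$ distributed according to the probability measure $\mu(dx)=\phi(x)dx$, where $\phi$ is even, has positive and integrable Fourier transform, and for each $t\in\mathbb{R}^d$ the function $r\mapsto\hat\phi(\sqrt r\,t)$ is log-convex on $[0,+\infty)$. Let $\mathcal{E}\subset\mathbb{R}^d$ be any ellipsoid centered at the origin, let $(\mathbb{R}^d,\|\cdot\|_K)$ be a normed space, let $a\in\Delta^{n-1}$, and write $S_a=\sqrt{a_1}X_1+\cdots+\sqrt{a_n}X_n$. (i) Let $l\in(0,d)$ and assume that $\mathbb{E}|X|^N<\infty$ for each $N>0$, that $(\mathbb{R}^d,\|\cdot\|_K)$ embeds in $L_{-l}$, and that $\mathbb{E}\|X\|_K^{-l}<\infty$. Let $Z$ be a centered Gaussian random vector with $\mathrm{Cov}(Z)=\mathrm{Cov}(X)$. Then $$\frac{\|X\|_{K,-l}}{\|X\|_{\mathcal{E},2}}\|S_a\|_{\mathcal{E},2}\le\|S_a\|_{K,-l}\le\frac{\|Z\|_{K,-l}}{\|X\|_{\mathcal{E},2}}\|S_a\|_{\mathcal{E},2}.$$ (ii) Without the integrability assumptions of (i), assuming only $\mathbb{E}|X|^2<\infty$ and letting $Z$ be a centered Gaussian random vector with $\mathrm{Cov}(Z)=\mathrm{Cov}(X)$: if $(\mathbb{R}^d,\|\cdot\|_K)$ embeds isometrically in $L_p$ for some $p\in(0,2)$, then $$\frac{\|X\|_{K,p}}{\|X\|_{\mathcal{E},2}}\|S_a\|_{\mathcal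{E},2}\le\|S_a\|_{K,p}\le\frac{\|Z\|_{K,p}}{\|X\|_{\mathcal{E},2}}\|S_a\|_{\mathcal{E},2}.$$
   Context: Fourier transform convention: $\hat f(x)=\int_{\mathbb{R}^d}f(y)e^{-2\pi i\langle x,y\rangle}dy$; ''positive'' means $\ge0$. $|\cdot|$ is the Euclidean norm. For a star body $K$ with Minkowski functional $\|x\|_K=\inf\{\lambda>0:x\in\lambda K\}$, a random vector $W$ and $p\ne0$, $\|W\|_{K,p}=(\mathbb{E}\|W\|_K^p)^{1/p}$; in particular $\|W\|_{\mathcal{E},2}=(\mathbb{E}\|W\|_{\mathcal{E}}^2)^{1/2}$. $\Delta^{n-1}=\{a\in[0,1]^n:a_1+\cdots+a_n=1\}$. For $l\in(0,d)$, $(\mathbb{R}^d,\|\cdot\|)$ embeds in $L_{-l}$ if there is a finite Borel measure $\sigma_l$ on $S^{d-1}$ such that for every even Schwartz function $\psi$, $\int_{\mathbb{R}^d}\|x\|^{-l}\psi(x)dx=\int_0^\infty\int_{S^{d-1}}t^{l-1}\hat\psi(t\theta)\,d\sigma_l(\theta)\,dt$. For $p>0$, $(\mathbb{R}^d,\|\cdot\|)$ embeds isometrically in $L_p$ if there is a linear map $S:\mathbb{R}^d\to L_p([0,1])$ with $\|Sx\|_{L_p}=\|x\|$ for all $x$. A function $f:[0,\infty)\to[0,\infty)$ is log-convex if $f(\lambda x+(1-\lambda)y)\le f(x)^\lambda f(y)^{1-\lambda}$ for all $x,y$, $\lambda\in(0,1)$. *)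

(* Defs.v *)
(* R^d is represented by 'rV[R]_d, for R : realType. *)
From HB Require Import structures.
From mathcomp Require Import all_boot all_order all_algebra.
From mathcomp Require Import all_classical all_reals all_analysis.
From mathcomp Require Export complex.

Set Implicit Arguments.
Unset Strict Implicit.
Unset Printing Implicit Defensive.

Import Order.TTheory GRing.Theory Num.Def Num.Theory.
Import numFieldNormedType.Exports.

Local Open Scope classical_set_scope.
Local Open Scope ring_scope.

(* The Borel sigma-algebra of R^d, generated (as the library does for tuples)
   by the coordinate maps. *)
Section rV_measurable.
Variables (R : realType) (d : nat).

Let coord (i : 'I_d) (x : 'rV[R]_d) : R := x 0 i.

Let rV_set0 : g_sigma_preimage coord set0.
Proof. exact: sigma_algebra0. Qed.

Let rV_setC A : g_sigma_preimage coord A -> g_sigma_preimage coord (~` A).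
Proof. exact: sigma_algebraC. Qed.

Let rV_bigcup (F : (set 'rV[R]_d)^nat) :
  (forall i, g_sigma_preimage coord (F i)) ->
  g_sigma_preimage coord (\bigcup_i F i).
Proof. exact: sigma_algebra_bigcup. Qed.

HB.instance Definition _ := @isMeasurable.Build default_measure_display
  'rV[R]_d (g_sigma_preimage coord) rV_set0 rV_setC rV_bigcup.

End rV_measurable.

Section rV_measurable_theory.
Context (R : realType).

Lemma measurable_rV_coord d (i : 'I_d) :
  measurable_fun [set: 'rV[R]_d] (fun x : 'rV[R]_d => x 0 i).
Proof.
move=> _ Y mY; rewrite setTI; apply: sub_sigma_algebra => /=.
rewrite -bigcup_seq/=; exists i => /=; first by rewrite mem_index_enum.
by exists Y => //; rewrite setTI.
Qed.

Lemma measurable_fun_rVP dT (T : measurableType dT) d (f : T -> 'rV[R]_d) :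
  measurable_fun setT f <->
  forall i, measurable_fun setT (fun t => f t 0 i : R).
Proof.
split=> [mf i|mf].
  by apply: (@measurableT_comp _ _ _ _ _ _ (fun x : 'rV[R]_d => x 0 i)) => //;
     exact: measurable_rV_coord.
suff H : forall Y, measurable Y -> measurable (f @^-1` Y).
  by move=> _ Y mY; rewrite setTI; exact: H.
apply: smallest_sub => /=.
  split => [|A mA|F mF].
  - by rewrite preimage_set0.
  - by rewrite setTD -preimage_setC; exact: measurableC.
  - by rewrite preimage_bigcup; exact: bigcup_measurable.
rewrite -bigcup_seq/=; apply: bigcup_sub => i _ _ [B mB <-].
have := mf i measurableT B mB; rewrite !setTI; exact.
Qed.

End rV_measurable_theory.

Section lebesgue_rV.
Context (R : realType).

Definition cons_rV n (z : R * 'rV[R]_n) : 'rV[R]_n.+1 := row_mx z.1%:M z.2.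

Definition uncons_rV n (v : 'rV[R]_n.+1) : R * 'rV[R]_n :=
  (v 0 0, @rsubmx R 1 1 n v).

Lemma cons_rV0 n (z : R * 'rV[R]_n) : cons_rV z 0 0 = z.1.
Proof.
rewrite /cons_rV (_ : 0 = lshift n (0 : 'I_1)); last exact/val_inj.
by rewrite (@row_mxEl R 1 1 n) mxE eqxx mulr1n.
Qed.

Lemma cons_rVS n (z : R * 'rV[R]_n) i : cons_rV z 0 (lift ord0 i) = z.2 0 i.
Proof.
rewrite /cons_rV (_ : lift _ _ = rshift 1 i); last exact/val_inj.
by rewrite (@row_mxEr R 1 1 n).
Qed.

Lemma cons_rVK n : cancel (@cons_rV n) (@uncons_rV n).
Proof.
by move=> [x v]; rewrite /uncons_rV cons_rV0; congr pair; exact: row_mxKr.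
Qed.

Lemma uncons_rVK n : cancel (@uncons_rV n) (@cons_rV n).
Proof.
move=> v; rewrite /uncons_rV /cons_rV/= -[RHS](@hsubmxK R 1 1 n v).
congr (@row_mx R 1 1 n _ _); apply/rowP => i; rewrite !ord1 !mxE eqxx mulr1n.
by congr (v _ _); exact/val_inj.
Qed.

Lemma measurable_cons_rV n : measurable_fun setT (@cons_rV n).
Proof.
apply/measurable_fun_rVP => i; case: (@split_ordP 1 n i) => j ->.
  rewrite (_ : (fun _ => _) = fst); first exact: measurable_fst.
  by apply/funext => z; rewrite /cons_rV (@row_mxEl R 1 1 n) ord1 mxE eqxx mulr1n.
rewrite (_ : (fun _ => _) = (fun x : 'rV[R]_n => x 0 j) \o snd).
  apply: measurableT_comp; [exact: measurable_rV_coord|exact: measurable_snd].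
by apply/funext => z; rewrite /cons_rV (@row_mxEr R 1 1 n).
Qed.

Lemma measurable_uncons_rV n : measurable_fun setT (@uncons_rV n).
Proof.
apply/measurable_fun_pairP; split; first exact: measurable_rV_coord.
apply/measurable_fun_rVP => i.
rewrite (_ : (fun _ => _) = (fun x : 'rV[R]_n.+1 => x 0 (rshift 1 i))).
  exact: measurable_rV_coord.
by apply/funext => v; rewrite /= mxE.
Qed.

Section step.
Variables (n : nat) (m : {sigma_finite_measure set 'rV[R]_n -> \bar R}).

Definition lebesgue_rVS : set 'rV[R]_n.+1 -> \bar R :=
  pushforward (lebesgue_measure \x m)%E (@cons_rV n).

Let lebesgue_rVS0 : lebesgue_rVS set0 = 0%E.
Proof. by rewrite /lebesgue_rVS /pushforward preimage_set0 measure0. Qed.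

Let lebesgue_rVS_ge0 A : (0 <= lebesgue_rVS A)%E.
Proof.
by apply: measure_ge0; exact: measurable_cons_rV.
Qed.

Let lebesgue_rVS_sigma_additive : semi_sigma_additive lebesgue_rVS.
Proof.
move=> F mF tF mUF.
by apply: measure_semi_sigma_additive => //; exact: measurable_cons_rV.
Qed.

HB.instance Definition _ := isMeasure.Build _ _ _ lebesgue_rVS
  lebesgue_rVS0 lebesgue_rVS_ge0 lebesgue_rVS_sigma_additive.

Let lebesgue_rVS_sigma_finite : sigma_finite setT lebesgue_rVS.
Proof.
have /sigma_finiteP[F [TF ndF Foo]] := sigma_finiteT (@lebesgue_measure R).
have /sigma_finiteP[G [TG ndG Goo]] := sigma_finiteT m.
exists (fun k => @uncons_rV n @^-1` (F k `*` G k)).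
  apply/seteqP; split=> // v _.
  have [p _ Fp] : (\bigcup_k F k) (v 0 0) by rewrite -TF.
  have [q _ Gq] : (\bigcup_k G k) (@rsubmx R 1 1 n v) by rewrite -TG.
  exists (maxn p q) => //; split => /=.
  - by move: (v 0 0) Fp; exact/subsetPset/ndF/leq_maxl.
  - by move: (rsubmx _) Gq; exact/subsetPset/ndG/leq_maxr.
move=> k; have [mF Fk] := Foo k; have [mG Gk] := Goo k; split.
  rewrite -[X in measurable X]setTI; apply: measurable_uncons_rV => //.
  exact: measurableX.
rewrite /lebesgue_rVS /pushforward -comp_preimage.
rewrite (_ : _ \o _ = id) ?preimage_id; last first.
  by apply/funext => z /=; rewrite cons_rVK.
by rewrite product_measure1E// lte_mul_pinfty// ge0_fin_numE.
Qed.

HB.instance Definition _ := Measure_isSigmaFinite.Build _ _ _ lebesgue_rVS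
  lebesgue_rVS_sigma_finite.

End step.

(* Lebesgue measure on R^d: iterated product of lebesgue_measure *)
Fixpoint lebesgue_rV (d : nat) :
    {sigma_finite_measure set 'rV[R]_d -> \bar R} :=
  if d is d'.+1 then lebesgue_rVS (lebesgue_rV d')
  else dirac (0 : 'rV[R]_0).

Lemma lebesgue_rV_rectangle d (A : 'I_d -> set R) :
  (forall i, measurable (A i)) ->
  lebesgue_rV d [set x | forall i, A i (x 0 i)] =
  (\prod_(i < d) lebesgue_measure (A i))%E.
Proof.
elim: d A => [|d IH] A mA.
  rewrite big_ord0 /= diracE mem_set//= => -[]//.
rewrite big_ord_recl -(IH (fun i => A (lift ord0 i)))//.
have mB : measurable [set x : 'rV[R]_d | forall i, A (lift ord0 i) (x 0 i)].
  rewrite (_ : mkset _ = \bigcap_(i in [set: 'I_d])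
      ((fun x : 'rV[R]_d => x 0 i) @^-1` A (lift ord0 i))); last first.
    by apply/seteqP; split=> [x Ax i _|x Ax i]; [exact: Ax|exact: (Ax i)].
  apply: fin_bigcap_measurable => // i _.
  by rewrite -[X in measurable X]setTI; exact: measurable_rV_coord.
rewrite -product_measure1E//; last exact: mA.
rewrite /= /lebesgue_rVS /pushforward; congr (product_measure1 _ _ _).
apply/seteqP; split=> -[x v]/=.
  move=> H; split=> [|i]; first by have := H ord0; rewrite cons_rV0.
  by have := H (lift ord0 i); rewrite cons_rVS.
move=> [Ax Av] i; case: (unliftP ord0 i) => [j|] ->.
  by rewrite cons_rVS; exact: Av.
by rewrite cons_rV0.
Qed.

End lebesgue_rV.
Arguments lebesgue_rV {R} d.

Section defs.
Context (R : realType).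
Local Open Scope complex_scope.

Section euclidean.
Variable d : nat.
Implicit Types (x y : 'rV[R]_d) (K : set 'rV[R]_d).

Definition dotv x y : R := \sum_(i < d) x 0 i * y 0 i.

(* the library's norm on 'rV[R]_d is the sup norm *)
Definition enorm x : R := Num.sqrt (dotv x x).

Definition sphere : set 'rV[R]_d := [set x | enorm x = 1].

Definition gauge K x : R :=
  inf [set lam : R | 0 < lam /\ exists2 y, K y & x = lam *: y].

Definition is_norm (N : 'rV[R]_d -> R) : Prop :=
  [/\ forall x, N x = 0 -> x = 0,
      forall (c : R) x, N (c *: x) = `|c| * N x &
      forall x y, N (x + y) <= N x + N y].

Definition ellipsoid (E : set 'rV[R]_d) : Prop :=
  exists2 A : 'M[R]_d, A \in unitmx &
    E = (fun x => x *m A) @` [set x | enorm x <= 1].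

Definition simplex (a : 'I_d -> R) : Prop :=
  (forall i, 0 <= a i <= 1) /\ \sum_(i < d) a i = 1.

End euclidean.

Section fourier.

Definition cintegral dT (T : measurableType dT) (mu : {measure set T -> \bar R})
    (D : set T) (f : T -> R[i]) : R[i] :=
  (\int[mu]_(x in D) complex.Re (f x)) +i* (\int[mu]_(x in D) complex.Im (f x)).

Definition expi (t : R) : R[i] := cos t +i* sin t.

Definition fourier d (f : 'rV[R]_d -> R[i]) (x : 'rV[R]_d) : R[i] :=
  cintegral (lebesgue_rV d) setT
    (fun y => f y * expi (- (2 * pi * dotv x y))).

Definition cintegrable d (f : 'rV[R]_d -> R[i]) : Prop :=
  (lebesgue_rV d).-integrable setT (fun x => (complex.Re (f x))%:E) /\
  (lebesgue_rV d).-integrable setT (fun x => (complex.Im (f x))%:E).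

Definition partials d (s : seq 'I_d) (f : 'rV[R]_d -> R) : 'rV[R]_d -> R :=
  foldr (fun i g => 'D_(delta_mx 0 i) g) f s.

Definition schwartz_real d (f : 'rV[R]_d -> R) : Prop :=
  forall s : seq 'I_d,
    (forall x, differentiable (partials s f) x) /\
    forall k : nat, exists C : R, forall x, enorm x ^+ k * `|partials s f x| <= C.

Definition schwartz d (f : 'rV[R]_d -> R[i]) : Prop :=
  schwartz_real (fun x => complex.Re (f x)) /\
  schwartz_real (fun x => complex.Im (f x)).

Definition even_fun d (U : Type) (f : 'rV[R]_d -> U) : Prop :=
  forall x, f (- x) = f x.

Definition log_convex (f : R -> R) : Prop :=
  forall x y lam : R, 0 <= x -> 0 <= y -> 0 < lam < 1 ->
    f (lam * x + (1 - lam) * y) <= f x `^ lam * f y `^ (1 - lam).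

End fourier.

Section embeddings.
Variable d : nat.

(* A finite Borel measure on S^{d-1} is a finite Borel measure on R^d,
   of which only the restriction to the sphere is used. *)
Definition embeds_negL (l : R) (N : 'rV[R]_d -> R) : Prop :=
  exists sigma : {finite_measure set 'rV[R]_d -> \bar R},
    forall psi : 'rV[R]_d -> R[i], schwartz psi -> even_fun psi ->
      cintegral (lebesgue_rV d) setT (fun x => (N x `^ (- l))%:C * psi x) =
      cintegral lebesgue_measure `]0, +oo[%classic (fun t : R =>
        cintegral sigma (@sphere d) (fun theta =>
          (t `^ (l - 1))%:C * fourier psi (t *: theta))).

(* S takes values in representatives of classes of L_p([0,1]), hence
   linearity holds almost everywhere; the library's L_p types need 1 <= p. *)
Definition embeds_Lp (p : R) (N : 'rV[R]_d -> R) : Prop :=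
  exists S : 'rV[R]_d -> {mfun R >-> R},
    (forall (c : R) x y,
       {ae lebesgue_measure, forall t : R, 0 <= t <= 1 ->
         S (c *: x + y) t = c * S x t + S y t}) /\
    (forall x,
       ((\int[lebesgue_measure]_(t in `[0%R, 1%R]) (`|S x t| `^ p)%:E)
          `^ p^-1 = (N x)%:E)%E).

End embeddings.

(* poweR sends 0 and +oo to themselves also for a negative exponent *)
Definition epow (x : \bar R) (p : R) : \bar R :=
  if p < 0 then ((x `^ (- p))^-1)%E else (x `^ p)%E.

Section random_vectors.
Context dT (T : measurableType dT) (P : probability T R) (d : nat).

Definition moment (K : set 'rV[R]_d) (p : R) (W : T -> 'rV[R]_d) : \bar R :=
  (\int[P]_w epow (gauge K (W w))%:E p)%E.

Definition knorm (K : set 'rV[R]_d) (p : R) (W : T -> 'rV[R]_d) : \bar R :=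
  epow (moment K p W) p^-1.

Definition has_density (X : {RV P >-> 'rV[R]_d}) (phi : 'rV[R]_d -> R) : Prop :=
  forall A, measurable A ->
    distribution P X A = (\int[lebesgue_rV d]_(x in A) (phi x)%:E)%E.

Definition mutually_independent (I : finType) (X : I -> {RV P >-> 'rV[R]_d}) :
    Prop :=
  forall (J : {set I}) (A : I -> set 'rV[R]_d), (forall i, measurable (A i)) ->
    P (\bigcap_(i in [set` J]) X i @^-1` A i) =
    (\prod_(i in J) P (X i @^-1` A i))%E.

(* normal_prob _ 0 is a junk value in the library, so the degenerate case
   is stated separately *)
Definition centered_gaussian (Z : {RV P >-> 'rV[R]_d}) : Prop :=
  forall t : 'rV[R]_d,
    (forall B : set R, measurable B ->
       P ((fun w => dotv t (Z w)) @^-1` B) = \d_(0 : R) B) \/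
    exists2 s : R, 0 < s & forall B : set R, measurable B ->
       P ((fun w => dotv t (Z w)) @^-1` B) = normal_prob 0 s B.

Definition cov (X : T -> 'rV[R]_d) (i j : 'I_d) : \bar R :=
  covariance P (fun w => X w 0 i) (fun w => X w 0 j).

End random_vectors.

End defs.

(* Main.v *)
From HB Require Import structures.
Require Import Defs.
From mathcomp Require Import all_boot all_order all_algebra.
From mathcomp Require Import all_classical all_reals all_analysis.
From mathcomp Require Import measurable_realfun ring lra.
Set Implicit Arguments.
Unset Strict Implicit.
Unset Printing Implicit Defensive.
Import Order.TTheory GRing.Theory Num.Theory.
Import numFieldNormedType.Exports.
Local Open Scope classical_set_scope.
Local Open Scope ring_scope.

(** All the inequalities come from one pointwise comparison of real parts of
characteristic functions,
<<
  charf Z y <= charf S y <= charf X y        for all y.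
>>
Put h r = charf X (sqrt r *: y). It is log-convex, nonnegative and h 0 = 1, and
charf S y is the product of the h (a i). Log-convexity gives h (a i) <= h 1 ^ a i,
hence the upper bound (log_convex_prod_le). It also gives h r >= h (r / n) ^ n,
and since h s >= 1 - s E <y, X>^2 / 2, letting n grow yields
h r >= exp (- r E <y, X>^2 / 2), hence the lower bound (log_convex_prod_ge), the
right-hand side being the characteristic function of Z (charf_S_le,
charf_gaussian_le_S). The imaginary parts vanish because the Fourier transform
of phi is real, so X and the summands are centered.

The second difference quotients of charf S at the origin show that
E <y, S>^2 = E <y, X>^2 for all y (second_moment_S). Hence S and X have the same
second moment with respect to every ellipsoid, the normalizing factors cancel,
and the moments of the norm N of K have to be compared.

For an embedding in L_p with 0 < p < 2, N x ^ p is an average of powers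
|<x, Y>|^p, and |u|^p is a positive multiple of the integral of
(1 - cos (u s)) s^(-1-p) over s > 0. By Tonelli, E N^p is a decreasing
function of the characteristic function (le_norm_moment_charf).

For an embedding in L_(-l), the Fourier identity is tested on the even
Gaussian functions psi_w(x) = (g_e(x - w) + g_e(x + w)) / 2, where g_e is the
centered Gaussian density of standard deviation e. It expresses
u_e(w) = int N^(-l) psi_w as an integral of cos (2 pi t <theta, w>) against a
finite positive measure in (t, theta). So E u_e is an increasing function of the
characteristic function (le_integral_smooth_potential). To let e tend to 0, the
elementary bounds
<<
  (N w + c delta)^(-l) - o(1) <= u_e(w)
                       <= N w^(-l) ((1 - eta)^(-l) + C_eta e / (e + N w))
>>
are used. The first holds because N is Lipschitz and the kernel concentrates
near w; the second because the integral of N^(-l) over the ball N <= s is at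
most C s^(d-l), and the kernel is small on that ball when s = (1 - eta) N w.
Dominated convergence (e to 0), then eta to 0, then monotone convergence
(delta to 0) give le_negative_moment. *)

(** * Fourier transform of the normal density *)

(** dominated convergence for real functions bounded everywhere *)
Lemma cvg_integral_dominated d (T : measurableType d) (R : realType)
    (mu : {measure set T -> \bar R}) (f_ : nat -> T -> R) (f g : T -> R) :
  (forall n, measurable_fun setT (f_ n)) ->
  (forall x, f_ n x @[n --> \oo] --> f x) ->
  mu.-integrable setT (EFin \o g) ->
  (forall n x, `|f_ n x| <= g x) ->
  (\int[mu]_x (f_ n x)%:E)%E @[n --> \oo] --> (\int[mu]_x (f x)%:E)%E.
Proof.
move=> mf_ cvf_ ig f_le.
have mf : measurable_fun setT f by apply: (measurable_fun_cvg mf_) => x _; exact: cvf_.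
have cvE x : (f_ n x)%:E @[n --> \oo] --> (f x)%:E.
  by apply/fine_cvgP; split; [exact: nearW|exact: cvf_].
have [] // := @dominated_convergence _ _ _ mu setT measurableT
  (fun n x => (f_ n x)%:E) (EFin \o f) (EFin \o g).
- by move=> n; apply/measurable_EFinP.
- exact/measurable_EFinP.
- by apply: aeW => x _; exact: cvE.
- by apply: aeW => x n _ /=; rewrite lee_fin.
Unshelve. all: by end_near. Qed.

Section gauss.
Context {R : realType}.
Notation mu := (@lebesgue_measure R).

Lemma measurable_fun_cos d (T : measurableType d) (D : set T) (f : T -> R) :
  measurable_fun D f -> measurable_fun D (fun x => cos (f x)).
Proof.
apply: measurableT_comp.
by apply: continuous_measurable_fun => x; exact: continuous_cos.
Qed.

Lemma measurable_fun_sin d (T : measurableType d) (D : set T) (f : T -> R) :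
  measurable_fun D f -> measurable_fun D (fun x => sin (f x)).
Proof.
apply: measurableT_comp.
by apply: continuous_measurable_fun => x; exact: continuous_sin.
Qed.

Lemma is_derive_comp_affine (f : R -> R) (x a b df : R) :
  is_derive (a * x + b) (1:R) f df ->
  is_derive x (1:R) (fun x => f (a * x + b)) (df * a).
Proof.
move=> H; apply: (@is_derive1_comp R f (fun x => a * x + b)) => //.
apply: (@is_derive_eq _ _ _ (a \*: id + cst b)).
by rewrite scaler1 addr0.
Qed.

Lemma cvg_natSy : (n.+1%:R : R) @[n --> \oo] --> +oo.
Proof. by have := @cvgr_idn R; rewrite -(@cvg_shiftS R^o (fun n => n%:R)). Qed.

(** over the whole line, the integral of the derivative of a function vanishing
at both ends is zero *)
Lemma Rintegral_derive0 (g g' : R -> R) :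
  (forall x, is_derive x (1:R) g (g' x)) -> continuous g' ->
  mu.-integrable setT (EFin \o g') ->
  g x @[x --> +oo] --> (0:R) -> g x @[x --> -oo] --> (0:R) ->
  (\int[mu]_x (g' x))%R = 0.
Proof.
move=> dg cg' ig' gy gNy.
pose f_ (n : nat) x := (g' x * \1_(`[- (n.+1%:R), n.+1%:R]) x).
have mg' : measurable_fun setT g'.
  by have /measurable_int/measurable_EFinP := ig'.
have cvgf : (\int[mu]_x (f_ n x)%:E)%E @[n --> \oo] --> (\int[mu]_x (g' x)%:E)%E.
  apply: (cvg_integral_dominated _ _ (integrable_norm ig')).
  - by move=> n; apply: measurable_funM.
  - move=> x; apply: cvg_near_cst.
    near=> n; rewrite /f_ /= indicE mem_set ?mulr1//=.
    rewrite in_itv/= -ler_norml.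
    apply: (@le_trans _ _ n%:R); last by rewrite ler_nat.
    by near: n; exact: nbhs_infty_ger.
  - move=> n x; rewrite /f_/= normrM ler_piMr//.
    by rewrite indicE; case: (_ \in _); rewrite ?normr1 ?normr0.
have f_E n : (\int[mu]_x (f_ n x)%:E)%E = (g n.+1%:R - g (- n.+1%:R))%:E.
  rewrite /f_.
  under eq_integral do rewrite EFinM.
  have -> : (\int[mu]_x ((g' x)%:E * (\1_(`[- n.+1%:R, n.+1%:R]) x)%:E))%E =
    (\int[mu]_(x in `[(- n.+1%:R)%R, n.+1%:R]) (g' x)%:E)%E.
    rewrite [RHS]integral_mkcond; apply: eq_integral => x _.
    by rewrite epatch_indic.
  rewrite (@continuous_FTC2 _ g' g)//.
  - by rewrite -subr_gt0 opprK addr_gt0.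
  - exact: continuous_subspaceT.
  - split.
    + by move=> x _; exact: ex_derive.
    + apply: cvg_at_right_filter; apply: differentiable_continuous.
      by apply/derivable1_diffP; exact: ex_derive.
    + apply: cvg_at_left_filter; apply: differentiable_continuous.
      by apply/derivable1_diffP; exact: ex_derive.
  - by move=> x _; rewrite derive1E derive_val.
have lim0 : (\int[mu]_x (f_ n x)%:E)%E @[n --> \oo] --> 0%E.
  rewrite (_ : (fun n => _) = (fun n => (g n.+1%:R - g (- n.+1%:R))%:E)); last first.
    by apply/funext.
  apply/fine_cvgP; split; first exact: nearW.
  rewrite /comp /= -[X in _ --> X](subr0 0); apply: cvgB.
    have := @cvg_comp _ _ _ (fun n : nat => n.+1%:R : R) g \oo +oo (nbhs 0) _ gy.
    apply.
    exact: cvg_natSy.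
  have := @cvg_comp _ _ _ (fun n : nat => - n.+1%:R : R) g \oo -oo (nbhs 0) _ gNy.
  apply.
  apply/(@cvgNrNy _ _ _ _ (fun n : nat => n.+1%:R)).
  exact: cvg_natSy.
have /cvg_unique := cvgf; move/(_ (@ereal_hausdorff R) _ lim0).
by rewrite /Rintegral /= => ->.
Unshelve. all: by end_near.
Qed.

Lemma is_derive_normal_pdf (m s x : R) : s != 0 ->
  is_derive x (1:R) (normal_pdf m s) (- (s ^+ 2)^-1 * (x - m) * normal_pdf m s x).
Proof.
move=> s0; rewrite normal_pdfE//.
have H1 : is_derive x (1:R) (fun x : R => - (x - m) ^+ 2 / (s ^+ 2 *+ 2)) (- (x - m) / s ^+ 2).
  rewrite (_ : (fun x => _) = (- (s ^+ 2 *+ 2)^-1) \*: ((@id R - cst m) ^+ 2)); last first.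
    by apply/funext => y /=; rewrite /GRing.scale/= !fctE; field.
  by apply: is_derive_eq; rewrite /GRing.scale/= !fctE; field.
have H2 := @is_derive1_comp R expR _ _ _ _ (is_derive_expR _) H1.
have := is_deriveZ (normal_peak s) H2.
move=> H3; apply: is_derive_eq.
by rewrite /GRing.scale/= /normal_fun; field.
Qed.

(** an integrable bound used to differentiate the Fourier integral *)
Lemma normal_pdf_moment_bound (m s : R) : s != 0 -> exists C, forall x,
  `|(x - m) * normal_pdf m s x| <= C * normal_pdf m (2 * s) x.
Proof.
move=> s0; exists (normal_peak s / normal_peak (2 * s) * `|s|) => x.
have s20 : 2 * s != 0 by rewrite mulf_neq0.
rewrite !normal_pdfE// mulrACA -[leLHS]mul1r.
have p0 : normal_peak (2 * s) != 0 by rewrite gt_eqF ?normal_peak_gt0.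
have -> : normal_peak s / normal_peak (2 * s) * normal_peak (2 * s) *
   (`|s| * normal_fun m (2 * s) x) =
   normal_peak s * (`|s| * normal_fun m (2 * s) x) by field.
rewrite mul1r normrM normrM (ger0_norm (normal_peak_ge0 _)) mulrCA.
rewrite ler_wpM2l ?normal_peak_ge0// (ger0_norm (normal_fun_ge0 _ _ _)).
set u := (x - m) / s.
have -> : `|x - m| = `|s| * `|u| by rewrite -normrM; congr Num.norm; rewrite /u; field.
rewrite -mulrA ler_wpM2l//.
have -> : normal_fun m s x = expR (- (3 / 8 * u ^+ 2)) * normal_fun m (2 * s) x.
  by rewrite /normal_fun -expRD; congr expR; rewrite /u; field.
rewrite mulrA ler_piMl ?normal_fun_ge0// expRN.
rewrite ler_pdivrMr ?expR_gt0// mul1r.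
apply: le_trans (expR_ge1Dx _).
have := sqr_ge0 (`|u| / 2 - 1); have := sqr_ge0 u.
rewrite -(real_normK (num_real u)); nra.
Qed.

Lemma cvg_normal_pdf (m s : R) : s != 0 ->
  normal_pdf m s x @[x --> +oo] --> (0:R) /\ normal_pdf m s x @[x --> -oo] --> (0:R).
Proof.
move=> s0; have [C0 HC0] := normal_pdf_moment_bound m s0.
pose C := `|C0| * normal_peak (2 * s).
have s20 : 2 * s != 0 by rewrite mulf_neq0.
have HC x : `|x - m| * normal_pdf m s x <= C.
  rewrite -(ger0_norm (normal_pdf_ge0 m s x)) -normrM (le_trans (HC0 x))//.
  apply: (le_trans (ler_norm _)); rewrite normrM /C.
  by rewrite (ger0_norm (normal_pdf_ge0 _ _ _)) ler_wpM2l// normal_pdf_ub.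
have Cge0 : 0 <= C by rewrite mulr_ge0// normal_peak_ge0.
have H e : 0 < e -> forall x, C / e + 1 < `|x - m| -> `|0 - normal_pdf m s x| <= e.
  move=> e0 x xm; rewrite sub0r normrN (ger0_norm (normal_pdf_ge0 _ _ _)).
  have xm0 : 0 < `|x - m| by apply: le_lt_trans xm; rewrite addr_ge0// divr_ge0// ltW.
  rewrite -(ler_pM2l xm0) (le_trans (HC x))//.
  rewrite -ler_pdivrMr// (le_trans _ (ltW xm))// lerDl//.
split; apply/cvgrPdist_le => e e0; near=> x; apply: (H e e0).
  rewrite (lt_le_trans _ (ler_norm _))// ltrBrDl.
  by near: x; apply: nbhs_pinfty_gt; exact: num_real.
rewrite distrC (lt_le_trans _ (ler_norm _))//.
suff : x < m - (C / e + 1) by lra.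
by near: x; apply: nbhs_ninfty_lt; exact: num_real.
Unshelve. all: by end_near. Qed.

(** Real form of the Fourier transform of the normal density: as a function of t, the
integral h satisfies h' = - s^2 t h, by differentiation under the integral sign
and integration by parts. *)
Lemma Rintegral_normal_cos (m s t c : R) : s != 0 ->
  (\int[mu]_x (normal_pdf m s x * cos (t * x + c)))%R =
  cos (t * m + c) * expR (- (s * t) ^+ 2 / 2).
Proof.
move=> s0; pose c' := c + t * m.
pose h (r : R) := (\int[mu]_x (normal_pdf m s x * cos (r * (x - m) + c')))%R.
pose k (r : R) := (\int[mu]_x (normal_pdf m s x * (x - m) * sin (r * (x - m) + c')))%R.
have mp : measurable_fun setT (normal_pdf m s) by exact: measurable_normal_pdf.
have ip : mu.-integrable setT (EFin \o normal_pdf m s) by exact: integrable_normal_pdf.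
have [C HC] := normal_pdf_moment_bound m s0.
pose G x := C * normal_pdf m (2 * s) x.
have iG : mu.-integrable setT (EFin \o G).
  exact: (integrableZl measurableT C (integrable_normal_pdf m (2 * s))).
have mang r : measurable_fun setT (fun x : R => r * (x - m) + c').
  apply: measurable_funD => //; apply: measurable_funM => //.
  exact: measurable_funB.
have ic r : mu.-integrable setT (EFin \o (fun x => normal_pdf m s x * cos (r * (x - m) + c'))).
  apply: le_integrable ip => //.
    apply/measurable_EFinP; apply: measurable_funM => //.
    by have X := measurable_fun_cos (mang r); exact: X.
  by move=> x _ /=; rewrite lee_fin normrM ler_piMr// cos_max.
have isn r : mu.-integrable setT (EFin \o (fun x => normal_pdf m s x * (x - m) * sin (r * (x - m) + c'))).
  apply: le_integrable iG => //.
    apply/measurable_EFinP; apply: measurable_funM => //; last first.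
      by have X := measurable_fun_sin (mang r); exact: X.
    by apply: measurable_funM => //; exact: measurable_funB.
  move=> x _ /=; rewrite lee_fin [leRHS]ger0_norm ?(le_trans _ (HC x))//.
  by rewrite normrM (mulrC (normal_pdf _ _ _)) ler_piMr// sin_max.
(* differentiating under the integral sign *)
have hk r : is_derive r (1:R) h (- k r).
  pose f r x := normal_pdf m s x * cos (r * (x - m) + c').
  have df r' x : is_derive r' (1:R) (f ^~ x) (- (normal_pdf m s x * (x - m) * sin (r' * (x - m) + c'))).
    have H1 : is_derive r' (1:R) (fun r => cos ((x - m) * r + c')) (- sin ((x - m) * r' + c') * (x - m)).
      exact: is_derive_comp_affine.
    have := is_deriveZ (normal_pdf m s x) H1.
    rewrite (mulrC _ r') /GRing.scale/= => H2.
    rewrite (_ : f^~ x = (fun x0 => normal_pdf m s x * cos ((x - m) * x0 + c'))); last first.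
      by apply/funext => y; rewrite /f mulrC (mulrC y) mulrC.
    by apply: is_derive_eq; rewrite mulNr mulrN; congr -%R; rewrite -mulrA (mulrC (sin _)).
  have der1 r' x : partial1of2 f r' x = - (normal_pdf m s x * (x - m) * sin (r' * (x - m) + c')).
    by rewrite partial1of2E; exact: derive_val.
  have Ir : `](r - 1), (r + 1)[%classic r by rewrite /= in_itv/=; apply/andP; split; lra.
  have G0 x : 0 <= G x by apply: le_trans (HC x).
  have Gub r' x : `](r - 1), (r + 1)[%classic r' -> setT x -> `|partial1of2 f r' x| <= G x.
    move=> _ _; rewrite der1 normrN (le_trans _ (HC x))//.
    by rewrite normrM (mulrC (normal_pdf _ _ _)) ler_piMr// sin_max.
  have dh := @derivable_under_integral R _ _ mu f setT measurableT r (r - 1) (r + 1) Ir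
    (fun r _ => ic r) (fun r x _ _ => @ex_derive _ _ _ _ _ _ _ (df r x)) G G0 iG Gub.
  apply: DeriveDef; first exact: dh.
  have := @differentiation_under_integral R _ _ mu f setT measurableT r (r - 1) (r + 1) Ir
    (fun r _ => ic r) (fun r x _ _ => @ex_derive _ _ _ _ _ _ _ (df r x)) G G0 iG Gub.
  rewrite derive1E => ->.
  under eq_Rintegral do rewrite der1 -mulN1r.
  by rewrite RintegralZl// mulN1r.
(* integrating by parts *)
have kh r : k r = s ^+ 2 * r * h r.
  pose g x := normal_pdf m s x * sin (r * (x - m) + c').
  pose g' x := - (s ^+ 2)^-1 * (normal_pdf m s x * (x - m) * sin (r * (x - m) + c')) +
     r * (normal_pdf m s x * cos (r * (x - m) + c')).
  have dp x : is_derive x (1:R) (normal_pdf m s) (- (s ^+ 2)^-1 * (x - m) * normal_pdf m s x).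
    exact: is_derive_normal_pdf.
  have dg x : is_derive x (1:R) g (g' x).
    have H1 : is_derive x (1:R) (fun x => sin (r * x + (c' - r * m))) (cos (r * x + (c' - r * m)) * r).
      exact: is_derive_comp_affine.
    have E y : r * y + (c' - r * m) = r * (y - m) + c' by ring.
    rewrite E in H1.
    have := is_deriveM (dp x) H1.
    rewrite (_ : normal_pdf m s * _ = g); last first.
      by apply/funext => y; rewrite /g -E.
    by move=> H; apply: is_derive_eq; rewrite /g' E /GRing.scale/=; ring.
  have cg' : continuous g'.
    have c1 : continuous (normal_pdf m s) by exact: continuous_normal_pdf.
    have c2 : continuous (fun x : R => r * (x - m) + c').
      move=> x; apply: cvgD; last exact: cvg_cst.
      apply: cvgM; first exact: cvg_cst.
      by apply: cvgB; [exact: cvg_id|exact: cvg_cst].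
    have c3 : continuous (fun x : R => x - m).
      by move=> x; apply: cvgB; [exact: cvg_id|exact: cvg_cst].
    move=> x; apply: cvgD; apply: cvgM; try exact: cvg_cst.
      apply: cvgM; first by apply: cvgM; [exact: c1|exact: c3].
      exact: (cvg_comp _ _ (c2 x) (@continuous_sin _ _)).
    apply: cvgM; first exact: c1.
    exact: (cvg_comp _ _ (c2 x) (@continuous_cos _ _)).
  have ig' : mu.-integrable setT (EFin \o g').
    have := integrableD measurableT (integrableZl measurableT (- (s ^+ 2)^-1) (isn r))
      (integrableZl measurableT r (ic r)).
    by apply: eq_integrable.
  have [py pNy] := cvg_normal_pdf m s0.
  have gle x : - normal_pdf m s x <= g x <= normal_pdf m s x.
    rewrite -ler_norml normrM (ger0_norm (normal_pdf_ge0 _ _ _)).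
    by rewrite ler_piMr ?normal_pdf_ge0// sin_max.
  have gy : g x @[x --> +oo] --> (0:R).
    have np := cvgN py; rewrite oppr0 in np; specialize (np _).
    by apply: (squeeze_cvgr _ np py); apply: nearW => x; exact: gle.
  have gNy : g x @[x --> -oo] --> (0:R).
    have np := cvgN pNy; rewrite oppr0 in np; specialize (np _).
    by apply: (squeeze_cvgr _ np pNy); apply: nearW => x; exact: gle.
  have := @Rintegral_derive0 g g' dg cg' ig' gy gNy.
  rewrite RintegralD//; last 2 first.
    exact: (integrableZl measurableT (- (s ^+ 2)^-1) (isn r)).
    exact: (integrableZl measurableT r (ic r)).
  rewrite (RintegralZl _ measurableT (isn r)) (RintegralZl _ measurableT (ic r)).
  rewrite -/(k r) -/(h r) => /eqP; rewrite mulNr addrC subr_eq0 => /eqP E.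
  by rewrite -mulrA E; field.
have const r : is_derive r (1:R) (fun r => h r * expR ((s * r) ^+ 2 / 2)) 0.
  have He : is_derive r (1:R) (fun r => expR ((s * r) ^+ 2 / 2)) (expR ((s * r) ^+ 2 / 2) * (s ^+ 2 * r)).
    have H1 : is_derive r (1:R) (fun r : R => (s * r) ^+ 2 / 2) (s ^+ 2 * r).
      rewrite (_ : (fun r => _) = (s ^+ 2 / 2) \*: ((@id R) ^+ 2)); last first.
        by apply/funext => y /=; rewrite /GRing.scale/= fctE; field.
      by apply: is_derive_eq; rewrite /GRing.scale/=; field.
    exact: (@is_derive1_comp R expR).
  have := is_deriveM (hk r) He.
  move=> H; apply: is_derive_eq; rewrite /GRing.scale/= kh; ring.
have h0 : h 0 = cos c'.
  rewrite /h; under eq_Rintegral do rewrite mul0r add0r.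
  rewrite RintegralZr//.
  by rewrite /Rintegral integral_normal_pdf mul1r.
have E : h t * expR ((s * t) ^+ 2 / 2) = h 0 * expR ((s * 0) ^+ 2 / 2).
  exact: (is_derive_0_is_cst _ _ const).
transitivity (h t).
  by apply: eq_Rintegral => x _; congr (_ * cos _); rewrite /c'; ring.
rewrite mulr0 expr0n/= mul0r expR0 mulr1 h0 in E.
rewrite addrC -/c' -E -mulrA -expRD.
by rewrite mulNr subrr expR0 mulr1.
Qed.

End gauss.

(** * Integrals of powers *)

Section power_integrals.
Context {R : realType}.
Notation mu := (@lebesgue_measure R).

Lemma integral_powR_itv (q a b : R) : q != 0 -> 0 < a -> a < b ->
  (\int[mu]_(x in `[a, b]) (x `^ (q - 1))%:E)%E = ((b `^ q - a `^ q) / q)%:E.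
Proof.
move=> q0 a0 ab.
pose F x : R := q^-1 * x `^ q.
have dF (x : R) : 0 < x -> is_derive x (1:R) F (x `^ (q - 1)).
  move=> x0; have := is_deriveZ q^-1 (is_derive1_powR q x0).
  by move=> H; apply: is_derive_eq; rewrite /GRing.scale/= mulrA mulVf// mul1r.
have cF (x : R) : 0 < x -> {for x, continuous F}.
  move=> x0; apply: differentiable_continuous.
  by apply/derivable1_diffP; apply: ex_derive; exact: dF.
rewrite (@continuous_FTC2 _ _ F)//.
- by rewrite -EFinB /F -mulrBr mulrC.
- apply: derivable_within_continuous => x; rewrite in_itv/= => /andP[ax _].
  by apply: ex_derive; apply: is_derive1_powR; exact: lt_le_trans ax.
- split.
  + move=> x; rewrite in_itv/= => /andP[ax _].
    by apply: ex_derive; apply: dF; exact: lt_trans ax.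
  + by apply: cvg_at_right_filter; exact: cF.
  + by apply: cvg_at_left_filter; apply: cF; exact: lt_trans ab.
- move=> x; rewrite in_itv/= => /andP[ax _].
  by rewrite derive1E; apply: derive_val; apply: dF; exact: lt_trans ax.
Qed.

(** bounds on an increasing sequence of sets pass to the union *)
Lemma ge0_integral_bigcup_le d (T : measurableType d)
    (m : {measure set T -> \bar R}) (F : (set T)^nat) (f : T -> \bar R) M :
  {homo F : n m / (n <= m)%N >-> (n <= m)%O} ->
  (forall i, measurable (F i)) ->
  measurable_fun (\bigcup_i F i) f ->
  (forall x, (0%R <= f x)%E) ->
  (forall i, (\int[m]_(x in F i) f x <= M)%E) ->
  (\int[m]_(x in \bigcup_i F i) f x <= M)%E.
Proof.
move=> nF mF mf f0 fM.
have mfi i : measurable_fun (F i) f.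
  by apply: measurable_funS mf; [exact: bigcup_measurable|exact: bigcup_sup].
have H := @ge0_nondecreasing_set_cvg_integral _ _ _ F f m nF mF mfi (fun i x _ => f0 x).
have H' : (\int[m]_(x in F i) f x)%E @[i --> \oo] --> (\int[m]_(x in \bigcup_i F i) f x)%E by exact: H.
rewrite -(cvg_lim _ H')//; apply: lime_le; last exact: nearW.
by apply/cvg_ex; eexists; exact: H'.
Qed.

(** exhaustion of ]0, r] by compact intervals on which the primitive is smooth *)
Lemma integral_powR_0le (q r : R) : 0 < q -> 0 < r ->
  (\int[mu]_(x in `]0%R, r]) (x `^ (q - 1))%:E <= (r `^ q / q)%:E)%E.
Proof.
move=> q0 r0.
have -> : `]0%R, r]%classic = \bigcup_i `[r / i.+2%:R, r]%classic.
  apply/seteqP; split => x /=.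
    rewrite in_itv/= => /andP[x0 xr].
    pose n := (Num.truncn (r / x)).
    exists n => //=; rewrite in_itv/= xr andbT.
    rewrite ler_pdivrMr// mulrC -ler_pdivrMr// ltW// /n.
    have := truncnS_gt (r / x); move=> /lt_le_trans; apply.
    by rewrite ler_nat.
  move=> [i _] /=; rewrite !in_itv/= => /andP[rx ->]; rewrite andbT.
  by apply: lt_le_trans rx; rewrite divr_gt0.
apply: ge0_integral_bigcup_le => //.
- move=> n m nm; apply/subsetPset => x /=; rewrite !in_itv/= => /andP[rx ->].
  rewrite andbT (le_trans _ rx)// ler_pM2l// lef_pV2 ?posrE//.
  by rewrite ler_nat.
- by apply/measurable_EFinP; apply: measurable_funTS; exact: measurable_powR.
- by move=> x; rewrite lee_fin powR_ge0.
move=> n; rewrite integral_powR_itv ?gt_eqF ?divr_gt0//; last first.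
  by rewrite ltr_pdivrMr// ltr_pMr// ltr1n.
by rewrite lee_fin ler_pM2r ?invr_gt0// gerBl powR_ge0.
Qed.

Lemma integral_powR_1y (q : R) : 0 < q ->
  (\int[mu]_(x in `[1%R, +oo[) (x `^ (- q - 1))%:E <= q^-1%:E)%E.
Proof.
move=> q0.
have -> : `[1%R, +oo[%classic = \bigcup_i `[1%R, i.+2%:R : R]%classic.
  apply/seteqP; split => x /=.
    rewrite in_itv/= andbT => x1.
    exists (Num.truncn x) => //=; rewrite in_itv/= x1/=.
    have := truncnS_gt x; move=> /ltW /le_trans; apply.
    by rewrite ler_nat.
  by move=> [i _] /=; rewrite !in_itv/= => /andP[->].
apply: ge0_integral_bigcup_le => //.
- move=> n m nm; apply/subsetPset => x /=; rewrite !in_itv/= => /andP[-> /=].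
  by move=> /le_trans; apply; rewrite ler_nat.
- by apply/measurable_EFinP; apply: measurable_funTS; exact: measurable_powR.
- by move=> x; rewrite lee_fin powR_ge0.
move=> n; rewrite integral_powR_itv ?oppr_eq0 ?gt_eqF// ?ltr1n//.
rewrite powR1 invrN mulrN -mulNr opprB lee_fin ler_piMl ?invr_ge0 ?ltW//.
Qed.

End power_integrals.

(** * Absolute powers as integrals of cosines *)

Section trigo_bounds.
Context {R : realType}.

Lemma norm_sin_le (x : R) : `|sin x| <= `|x|.
Proof.
wlog x0 : x / 0 <= x => [H|].
  have [|/ltW x0] := leP 0 x; first exact: H.
  by rewrite -normrN -sinN -(normrN x) H// oppr_ge0.
move: x0; rewrite le_eqVlt => /predU1P[<-|x0]; first by rewrite sin0.
have [|y _] := @MVT R (@sin R) (@cos R) 0 x x0 (fun x _ => is_derive_sin x).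
  by apply: continuous_subspaceT => ?; exact: continuous_sin.
rewrite sin0 !subr0 => ->.
by rewrite normrM ler_piMl// cos_max.
Qed.

Lemma one_sub_cos (x : R) : 1 - cos x = 2 * sin (x / 2) ^+ 2.
Proof.
have {1}-> : x = (x / 2) *+ 2 by rewrite -mulr_natr divfK.
by rewrite cos_mulr2n cos2sin2; ring.
Qed.

Lemma one_sub_cos_ge0 (x : R) : 0 <= 1 - cos x.
Proof. by rewrite subr_ge0 cos_le1. Qed.

Lemma one_sub_cos_le2 (x : R) : 1 - cos x <= 2.
Proof. by have := cos_geN1 x; lra. Qed.

Lemma one_sub_cos_le (x : R) : 1 - cos x <= x ^+ 2 / 2.
Proof.
rewrite one_sub_cos -[sin _ ^+ 2]real_normK ?num_real//.
have /(lerXn2r 2) := norm_sin_le (x / 2).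
rewrite !nnegrE !normr_ge0 => /(_ isT isT).
by rewrite [leRHS]real_normK ?num_real//; lra.
Qed.

Lemma cvg_sin_div (y : R) : sin (n.+1%:R^-1 * y) * n.+1%:R @[n --> \oo] --> y.
Proof.
have H : is_derive (0:R) (1:R) (fun s => sin (y * s + 0)) (cos (y * 0 + 0) * y).
  exact: is_derive_comp_affine.
have [D E] := H.
have := D; rewrite /derivable => /cvg_ex[l Hl].
have lE : l = y.
  move: E; rewrite /derive (cvg_lim _ Hl)// => ->.
  by rewrite mulr0 add0r cos0 mul1r.
rewrite {}lE in Hl.
have := iffLR (cvgr_dnbhsP _ _ _) Hl harmonic
  (conj (fun n => lt0r_neq0 (harmonic_gt0 n)) cvg_harmonic).
apply: cvg_trans; apply: near_eq_cvg; apply: nearW => n /=.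
rewrite mulr0 !addr0 sin0 subr0 /GRing.scale/= mulr1 invrK mulrC.
by rewrite (mulrC y).
Qed.

Lemma cvg_one_sub_cos (y : R) :
  2 * (1 - cos (n.+1%:R^-1 * y)) * n.+1%:R ^+ 2 @[n --> \oo] --> y ^+ 2.
Proof.
have H := @cvg_sin_div (y / 2).
have H2 := cvgM (cvgM H H) (@cvg_cst _ (4 : R^o) _ \oo _).
have E : y / 2 * (y / 2) * 4 = y ^+ 2 by field.
rewrite E in H2.
apply: cvg_trans (H2 _ _ _); apply: near_eq_cvg; apply: nearW => n /=.
by rewrite one_sub_cos -(mulrA _ y); set S := sin _; ring.
Qed.

End trigo_bounds.

Lemma ge0_integral_subsetU d (T : measurableType d) (R : realType)
    (m : {measure set T -> \bar R}) (A B C : set T) (f : T -> \bar R) :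
  measurable A -> measurable B -> measurable C -> measurable_fun setT f ->
  (forall x, 0 <= f x)%E -> C `<=` A `|` B ->
  (\int[m]_(x in C) f x <= \int[m]_(x in A) f x + \int[m]_(x in B) f x)%E.
Proof.
move=> mA mB mC mf f0 CAB.
have mBA : measurable (B `\` A) by exact: measurableD.
apply: (@le_trans _ _ (\int[m]_(x in A `|` (B `\` A)) f x)%E).
  apply: ge0_subset_integral => //; first exact: measurableU.
    exact: measurable_funTS.
  move=> x /CAB [Ax|Bx]; first by left.
  by case: (pselect (A x)) => Ax; [left|right].
rewrite ge0_integral_setU//; last 2 first.
  exact: measurable_funTS.
  by rewrite disj_set2E setDE setICA setICr setI0.
rewrite leeD2l//; apply: ge0_subset_integral => //.
exact: measurable_funTS.
Qed.

Section levy.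
Context {R : realType}.
Notation mu := (@lebesgue_measure R).

Lemma ge0_integral_scale (k : R) (f : R -> \bar R) : 0 < k ->
  measurable_fun setT f -> (forall x, 0 <= f x)%E ->
  (\int[mu]_(x in `]0%R, +oo[) f x =
   k%:E * \int[mu]_(x in `]0%R, +oo[) f (k * x)%R)%E.
Proof.
move=> k0 mf f0.
pose h : R -> measurableTypeR R := fun x => k * x.
have mh : measurable_fun setT h by apply: measurable_funM.
have -> : (\int[mu]_(x in `]0%R, +oo[) f (k * x)%R)%E =
  (\int[pushforward mu h]_(x in `]0%R, +oo[) f x)%E.
  rewrite ge0_integral_pushforward//; last exact: measurable_funTS.
  congr (integral _ _ _); apply/seteqP; split=> x /=; rewrite !in_itv/= !andbT.
    by move=> x0; rewrite mulr_gt0.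
  by rewrite /h pmulr_rgt0.
pose kn : {nonneg R} := NngNum (ltW k0).
rewrite -(@ge0_integral_mscale _ _ _ (pushforward mu h) _ _ kn)//; last exact: measurable_funTS.
apply: eq_measure_integral => A mA _.
apply: (@lebesgue_measure_unique R (mscale kn (pushforward mu h))) => //.
move=> X [[a b]] _ <-.
change (mu `]a, b] = (k%:E * mu (h @^-1` `]a, b]))%E).
have -> : h @^-1` `]a, b] = `](a / k), (b / k)]%classic.
  apply/seteqP; split=> x /=; rewrite !in_itv/= /h ltr_pdivrMr// ler_pdivlMr//.
    by rewrite mulrC.
  by rewrite mulrC.
rewrite !lebesgue_measure_itv/= !lte_fin ltr_pM2r ?invr_gt0//.
case: ifPn => ab; last by rewrite mule0.
by rewrite -!EFinB -EFinM; congr EFin; field; rewrite gt_eqF.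
Qed.

(** Up to a constant, the power |u|^p is the integral over (0,oo) of 1 - cos(us)
against the measure with density s^(-1-p): this is scaling, and for u = 1 the
integral is finite because the integrand is of order s^(1-p) at 0 and s^(-1-p)
at infinity. *)
Lemma powR_integral_cos (p : R) : 0 < p < 2 -> exists2 C : R, 0 < C &
  forall u : R, (\int[mu]_(x in `]0%R, +oo[)
      ((1 - cos (u * x)) * x `^ (- p - 1))%:E = (C * `|u| `^ p)%:E)%E.
Proof.
move=> /andP[p0 p2].
pose f (x : R) := (1 - cos x) * x `^ (- p - 1).
have f0 x : 0 <= f x by rewrite mulr_ge0 ?powR_ge0 ?one_sub_cos_ge0.
have mf : measurable_fun setT f.
  apply: measurable_funM; last exact: measurable_powR.
  by apply: measurable_funB => //; exact: measurable_fun_cos.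
pose I := (\int[mu]_(x in `]0%R, +oo[) (f x)%:E)%E.
have Ioo : (I < +oo)%E.
  have -> : I = (\int[mu]_(x in `]0%R, +oo[) (f x)%:E)%E by [].
  have U : (`]0%R, +oo[%classic : set R) `<=` `]0%R, 1%R] `|` `[1%R, +oo[.
    move=> x /=; rewrite !in_itv/= !andbT => x0.
    by case: (leP x 1) => [?|/ltW ?]; [left; rewrite x0|right].
  have mfE : measurable_fun setT (EFin \o f) by exact/measurable_EFinP.
  have K := @ge0_integral_subsetU _ _ R mu `]0%R, 1%R] `[1%R, +oo[ `]0%R, +oo[ (EFin \o f)
    (measurable_itv _) (measurable_itv _) (measurable_itv _) mfE (fun x => f0 x) U.
  apply: (le_lt_trans K); rewrite {K}.
  apply: lte_add_pinfty.
    apply: (@le_lt_trans _ _ (\int[mu]_(x in `]0%R, 1%R]) ((x `^ ((2 - p) - 1))%:E))%E).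
      apply: ge0_le_integral => //.
      - by move=> x _; rewrite lee_fin.
      - exact: measurable_funTS.
      - by apply/measurable_EFinP; apply: measurable_funTS; exact: measurable_powR.
      - move=> x /=; rewrite in_itv/= => /andP[x0 x1]; rewrite lee_fin /f.
        have -> : 2 - p - 1 = 2%:R + (- p - 1) by ring.
        rewrite [leRHS]powRD ?(gt_eqF x0) ?implybT//.
        rewrite powR_mulrn; last exact: ltW.
        rewrite ler_wpM2r ?powR_ge0//.
        by rewrite (le_trans (one_sub_cos_le x))// ler_pdivrMr// ler_peMr ?sqr_ge0// ler1n.
    apply: le_lt_trans (integral_powR_0le _ _) _ => //; first lra.
    by rewrite ltry.
  apply: (@le_lt_trans _ _ (\int[mu]_(x in `[1%R, +oo[) (2%:E * (x `^ (- p - 1))%:E))%E).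
    apply: ge0_le_integral => //.
    - by move=> x _; rewrite lee_fin.
    - exact: measurable_funTS.
    - by apply/measurable_EFinP; apply: measurable_funTS; apply: measurable_funM => //; exact: measurable_powR.
    - by move=> x _; rewrite lee_fin ler_wpM2r ?powR_ge0// one_sub_cos_le2.
  rewrite ge0_integralZl_EFin//.
  - by apply: lte_mul_pinfty => //; apply: le_lt_trans (integral_powR_1y p0) _; rewrite ltry.
  - by move=> x _; rewrite lee_fin powR_ge0.
  - by apply/measurable_EFinP; apply: measurable_funTS; exact: measurable_powR.
(* on [pi/2, pi] the integrand is at least pi^(-p-1) *)
have I0 : (0 < I)%E.
  have pi0 := pi_gt0 R.
  apply: (@lt_le_trans _ _ (\int[mu]_(x in `[(pi / 2)%R, pi]) (pi `^ (- p - 1))%:E)%E).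
    rewrite integral_cst//= lebesgue_measure_itv/= lte_fin.
    rewrite ifT; last by rewrite ltr_pdivrMr// ltr_pMr// ltr1n.
    rewrite -EFinB -EFinM lte_fin mulr_gt0 ?powR_gt0//.
    by rewrite subr_gt0 ltr_pdivrMr// ltr_pMr// ltr1n.
  apply: (@le_trans _ _ (\int[mu]_(x in `[(pi / 2)%R, pi]) (f x)%:E)%E).
    apply: ge0_le_integral => //.
    - by move=> x _; rewrite lee_fin powR_ge0.
    - by apply/measurable_EFinP; exact: measurable_funTS.
    - move=> x /=; rewrite in_itv/= => /andP[x1 x2]; rewrite lee_fin /f.
      have x0 : 0 < x by apply: lt_le_trans x1; rewrite divr_gt0.
      have s0 : 0 <= sin (x - pi / 2) by apply: sin_ge0_pi; lra.
      have c0 : 1 <= 1 - cos x.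
        by rewrite -[x in cos x](subrK (pi / 2)) cosDpihalf; lra.
      rewrite (le_trans _ (ler_peMl (powR_ge0 _ _) c0))//.
      have -> : - p - 1 = - (p + 1) by ring.
      rewrite !powRN lef_pV2 ?posrE ?powR_gt0//.
      apply: (ge0_ler_powR _ _ _ x2); rewrite ?nnegrE; [lra|exact: ltW|exact: ltW].
  apply: ge0_subset_integral => //.
    by apply/measurable_EFinP; exact: measurable_funTS.
    by move=> x _; rewrite lee_fin.
  move=> x /=; rewrite !in_itv/= andbT => /andP[x1 _].
  by apply: lt_le_trans x1; rewrite divr_gt0.
have If : I \is a fin_num by rewrite ge0_fin_numE// ltW.
exists (fine I); first by rewrite fine_gt0// I0.
move=> u; have [->|u0] := eqVneq u 0.
  rewrite normr0 powR0 ?gt_eqF// mulr0.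
  by rewrite integral0_eq// => x _; rewrite mul0r cos0 subrr mul0r.
have u1 : 0 < `|u| by rewrite normr_gt0.
have := @ge0_integral_scale `|u| (EFin \o f) u1.
rewrite -/I EFinM fineK// => ->//; last exact/measurable_EFinP.
rewrite -[LHS]mule1.
have -> : (\int[mu]_(x in `]0%R, +oo[) ((EFin \o f) (`|u| * x)%R))%E =
  ((`|u| `^ (- p - 1))%:E * \int[mu]_(x in `]0%R, +oo[) ((1 - cos (u * x)) * x `^ (- p - 1))%:E)%E.
  rewrite -ge0_integralZl_EFin ?powR_ge0//.
  - apply: eq_integral => x; rewrite inE/= in_itv/= andbT => x0.
    rewrite /f powRM ?ltW// -EFinM; congr EFin.
    rewrite -(cos_norm (u * x)) normrM (gtr0_norm x0); ring.
  - by move=> x _; rewrite lee_fin mulr_ge0 ?powR_ge0 ?one_sub_cos_ge0.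
  - apply/measurable_EFinP; apply: measurable_funTS.
    apply: measurable_funM; last exact: measurable_powR.
    apply: measurable_funB => //; apply: measurable_fun_cos.
    exact: measurable_funM.
rewrite mule1 [RHS]muleC !muleA -!EFinM.
have -> : `|u| `^ p * `|u| * `|u| `^ (- p - 1) = 1.
  rewrite -[X in _ * X * _]powRr1 ?ltW// -!powRD ?(gt_eqF u1) ?implybT//.
  by rewrite (_ : _ + _ = 0) ?powRr0//; ring.
by rewrite mul1e.
Qed.

End levy.

(** * Integration against a density *)

Section density.
Context d (T : measurableType d) (R : realType).
Variables (mu nu : {measure set T -> \bar R}) (g : T -> R).
Hypotheses (mg : measurable_fun setT g) (g0 : forall x, 0 <= g x).
Hypothesis nuE : forall A, measurable A ->
  nu A = (\int[mu]_(x in A) (g x)%:E)%E.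
Local Open Scope ereal_scope.
Import HBNNSimple.

Let integral_density_nnsfun (h : {nnsfun T >-> R}) :
  \int[nu]_x (h x)%:E = \int[mu]_x ((h x)%:E * (g x)%:E).
Proof.
have mgE : measurable_fun setT (EFin \o g) by exact/measurable_EFinP.
under eq_integral do rewrite fimfunE -fsumEFin//.
rewrite ge0_integral_fsum//; last 2 first.
  - by move=> r; exact/measurable_EFinP/measurable_funM.
  - by move=> r x _; rewrite nnfun_muleindic_ge0.
transitivity (\int[mu]_x (\sum_(y \in range h)
    (y * \1_(h @^-1` [set y]) x)%:E * (g x)%:E)); last first.
  apply: eq_integral => x _; rewrite -ge0_mule_fsuml => [|y]; last exact: nnfun_muleindic_ge0.
  by rewrite fsumEFin// -(fimfunE _ x).
rewrite ge0_integral_fsum//; last 2 first.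
  - move=> y; apply: emeasurable_funM => //.
    by apply/measurable_EFinP; exact: measurable_funM.
  - by move=> y x _; rewrite mule_ge0 ?nnfun_muleindic_ge0// lee_fin.
apply: eq_fsbigr => r rh.
rewrite integralZl_indic_nnsfun// integral_indic// setIT.
under [RHS]eq_integral do rewrite EFinM -muleA.
rewrite ge0_integralZl_EFin//.
- rewrite nuE//; congr (_ * _).
  under [RHS]eq_integral do rewrite muleC.
  by rewrite integral_mkcond; apply: eq_integral => x _; rewrite epatch_indic.
- by move=> x _; rewrite mule_ge0// lee_fin.
- by apply: emeasurable_funM => //; exact/measurable_EFinP.
- by move: rh; rewrite inE => -[t _ <-].
Qed.

Lemma ge0_integral_density (f : T -> \bar R) :
  measurable_fun setT f -> (forall x, 0 <= f x) ->
  \int[nu]_x f x = \int[mu]_x (f x * (g x)%:E).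
Proof.
move=> mf f0; pose h := nnsfun_approx measurableT mf.
have mgE : measurable_fun setT (EFin \o g) by exact/measurable_EFinP.
have cvh x : (h n x)%:E @[n --> \oo] --> f x.
  by apply: cvg_nnsfun_approx => // *; exact: f0.
transitivity (lim (\int[nu]_x (h n x)%:E @[n --> \oo])).
  under eq_integral => x _ do rewrite -(cvg_lim _ (cvh x))//.
  apply: monotone_convergence => //.
  - by move=> n; exact/measurable_EFinP.
  - by move=> n x _; rewrite lee_fin.
  - by move=> x _ a b ab; rewrite lee_fin; exact/lefP/nd_nnsfun_approx.
transitivity (lim (\int[mu]_x ((h n x)%:E * (g x)%:E) @[n --> \oo])).
  by under eq_fun do rewrite integral_density_nnsfun.
have cvhg x : (h n x)%:E * (g x)%:E @[n --> \oo] --> f x * (g x)%:E.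
  by apply: cvgeZr => //; exact: cvh.
under [RHS]eq_integral => x _ do rewrite -(cvg_lim _ (cvhg x))//.
apply/esym/monotone_convergence => //.
- by move=> n; apply: emeasurable_funM => //; exact/measurable_EFinP.
- by move=> n x _; rewrite mule_ge0// lee_fin.
- move=> x _ a b ab; rewrite lee_wpmul2r ?lee_fin//.
  exact/lefP/nd_nnsfun_approx.
Qed.

Lemma integral_density (f : T -> R) : measurable_fun setT f ->
  \int[nu]_x (f x)%:E = \int[mu]_x ((f x * g x)%R)%:E.
Proof.
move=> mf; rewrite integralE [RHS]integralE.
have mfE : measurable_fun setT (EFin \o f) by exact/measurable_EFinP.
rewrite !ge0_integral_density//; last 2 first.
- exact: measurable_funeneg.
- exact: measurable_funepos.
congr (_ - _); apply: eq_integral => x _.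
  by rewrite !funeposE EFinM maxe_pMl ?mul0e ?lee_fin.
by rewrite !funenegE EFinM -mulNe maxe_pMl ?mul0e ?lee_fin.
Qed.

End density.

(** * Joint laws and partial sums of independent vectors *)

(** The law of a measurable map under a finite measure. The proof of
measurability is an argument so that the law is recognized as a finite
measure. *)
Section law.
Context d1 d2 (T1 : measurableType d1) (T2 : measurableType d2) (R : realType).

Definition law (Q : set T1 -> \bar R) (V : T1 -> T2)
  & measurable_fun setT V := pushforward Q V.

Variables (Q : {finite_measure set T1 -> \bar R}) (V : T1 -> T2).
Hypothesis mV : measurable_fun setT V.

Let law0 : law Q mV set0 = 0%E.
Proof. by rewrite /law /pushforward preimage_set0 measure0. Qed.

Let law_ge0 A : (0 <= law Q mV A)%E.
Proof. by rewrite /law; exact: measure_ge0. Qed.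

Let law_sigma_additive : semi_sigma_additive (law Q mV).
Proof.
by rewrite /law; exact: (@measure_semi_sigma_additive _ _ _ (pushforward Q V)).
Qed.

HB.instance Definition _ := isMeasure.Build _ _ _ (law Q mV)
  law0 law_ge0 law_sigma_additive.

Let law_fin : fin_num_fun (law Q mV).
Proof.
move=> A mA; rewrite /law /pushforward fin_num_measure//.
by rewrite -[X in measurable X]setTI; exact: mV.
Qed.

HB.instance Definition _ := Measure_isFinite.Build _ _ _ (law Q mV) law_fin.

Lemma ge0_integral_law (f : T2 -> \bar R) : measurable_fun setT f ->
  (forall y, 0 <= f y)%E ->
  (\int[law Q mV]_y f y = \int[Q]_x f (V x))%E.
Proof. by move=> mf f0; rewrite /law ge0_integral_pushforward. Qed.

End law.

Section pair_law.
Context d d1 d2 (T : measurableType d) (T1 : measurableType d1)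
  (T2 : measurableType d2) (R : realType).
Variables (Q : {finite_measure set T -> \bar R})
  (m2 : {finite_measure set T2 -> \bar R}) (V : T -> T1) (U : T -> T2).
Hypotheses (mV : measurable_fun setT V) (mU : measurable_fun setT U).
Hypothesis VU : forall A B, measurable A -> measurable B ->
  Q (V @^-1` A `&` U @^-1` B) = (Q (V @^-1` A) * m2 B)%E.
Local Open Scope ereal_scope.

Let mVU : measurable_fun setT (fun w => (V w, U w)).
Proof. exact: measurable_fun_pair. Qed.

(** A product formula on rectangles determines the joint law. The measure Q need
not be a probability: it will also be the restriction of one to an event. *)
Lemma pair_lawE C : measurable C ->
  Q ((fun w => (V w, U w)) @^-1` C) = (law Q mV \x m2) C.
Proof.
move=> mC; rewrite (@product_measure_unique _ _ _ _ _ _ _ (law Q mVU)) => [//|A B mA mB|//].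
exact: VU.
Qed.

Lemma ge0_integral_pair (f : T1 * T2 -> \bar R) : measurable_fun setT f ->
  (forall z, 0 <= f z) ->
  \int[Q]_w f (V w, U w) = \int[Q]_w \int[m2]_y f (V w, y).
Proof.
move=> mf f0.
rewrite -(@ge0_integral_law _ _ _ _ _ Q _ mVU)//.
rewrite (@eq_measure_integral _ _ _ _ (law Q mV \x m2)); last first.
  by move=> A mA _; exact: pair_lawE.
rewrite fubini_tonelli1//.
rewrite ge0_integral_law//; first exact: measurable_fun_fubini_tonelli_F.
by move=> x; exact: integral_ge0.
Qed.

End pair_law.

Section partial_sums.
Context dT (T : measurableType dT) (R : realType) (P : probability T R).
Context (d : nat) (I : finType) (Y : I -> {RV P >-> 'rV[R]_d}) (c : I -> R).
Hypothesis indep : mutually_independent Y.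

(** the linear combination of the Y i, i in s, with coefficients c i *)
Definition psum (s : seq I) (w : T) : 'rV[R]_d :=
  \sum_(i <- s) c i *: Y i w.

Lemma measurable_psum s : measurable_fun setT (psum s).
Proof.
apply/measurable_fun_rVP => j.
rewrite (_ : (fun _ => _) = (fun w => \sum_(i <- s) c i * Y i w 0 j)).
  apply: measurable_sum => i; apply: measurable_funM => //.
  by have /measurable_fun_rVP := @measurable_funPT _ _ _ _ (Y i); exact.
apply/funext => w; rewrite /psum summxE; apply: eq_bigr => i _.
by rewrite mxE.
Qed.

Let event (J : {set I}) (B : I -> set 'rV[R]_d) : set T :=
  \bigcap_(i in [set` J]) Y i @^-1` B i.

Let measurable_event J B : (forall i, measurable (B i)) -> measurable (event J B).
Proof.
move=> mB; apply: fin_bigcap_measurable => // i _.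
by rewrite -[X in measurable X]setTI; exact: measurable_funPT.
Qed.

(** Partial sums are independent of the events generated by the other vectors.
The joint law of a partial sum and the next vector is a product measure, both
under P and under its restriction to such an event. *)
Lemma psum_indep s : uniq s -> forall (J : {set I}) A B,
  measurable A -> (forall i, measurable (B i)) ->
  (forall i, i \in s -> i \notin J) ->
  P (psum s @^-1` A `&` event J B) = (P (psum s @^-1` A) * P (event J B))%E.
Proof.
elim: s => [|i s IH] /= => [_|/andP[is' us]] J A B mA mB sJ.
  have [A0|A0] := pselect (A 0).
    have -> : psum [::] @^-1` A = setT.
      by apply/seteqP; split => // w _; rewrite /psum /= big_nil.
    by rewrite setTI probability_setT mul1e.
  have -> : psum [::] @^-1` A = set0.
    by apply/seteqP; split => // w; rewrite /psum /= big_nil.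
  by rewrite set0I measure0 mul0e.
have Hadd (J' : {set I}) A' B' : i \notin J' -> (forall j, j \in s -> j \notin J') ->
   measurable A' -> measurable B' ->
   P (psum s @^-1` A' `&` Y i @^-1` B' `&` event J' B) =
   (P (psum s @^-1` A') * (P (Y i @^-1` B') * P (event J' B)))%E.
  move=> iJ sJ' mA' mB'.
  (* Y i is added to the vectors of the event *)
  pose B2 j := if j == i then B' else B j.
  have mB2 j : measurable (B2 j) by rewrite /B2; case: ifP.
  have eE : event (i |: J') B2 = Y i @^-1` B' `&` event J' B.
    apply/seteqP; split=> w /=.
      move=> H; split; first by have := H i; rewrite /= !inE eqxx /B2 eqxx; exact.
      move=> j /= jJ; have := H j; rewrite /= !inE jJ orbT /B2.
      have -> : (j == i) = false by apply/negbTE/eqP => ji; rewrite ji (negbTE iJ) in jJ.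
      exact.
    move=> [wi wJ] j /=; rewrite !inE /B2; case: eqP => [-> //|_ /= jJ]; exact: wJ.
  have e1 : P (event (i |: J') B2) = (P (Y i @^-1` B') * P (event J' B))%E.
    rewrite /event !indep// big_setU1//=.
    congr (_ * _)%E; first by rewrite /B2 eqxx.
    apply: eq_bigr => j jJ; rewrite /B2.
    by have -> : (j == i) = false by apply/negbTE/eqP => ji; rewrite ji (negbTE iJ) in jJ.
  rewrite -e1 -setIA -eE IH// => j js; rewrite !inE negb_or sJ'// andbT.
  by apply/eqP => ji; rewrite -ji js in is'.
have e0 : event finset.set0 B = setT.
  by apply/seteqP; split=> // w _ j /=; rewrite inE.
have H0 A' B' : measurable A' -> measurable B' ->
   P (psum s @^-1` A' `&` Y i @^-1` B') = (P (psum s @^-1` A') * P (Y i @^-1` B'))%E.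
  move=> mA' mB'; have := @Hadd finset.set0 A' B'.
  by rewrite !inE e0 setIT probability_setT mule1; apply => // j; rewrite inE.
have mC := measurable_event J mB.
have PC : (P (event J B) < +oo)%E by rewrite ltey_eq fin_num_measure.
(* the restriction of P to the event *)
pose Q := mfrestr mC PC.
have iJ : i \notin J by apply: sJ; rewrite inE eqxx.
have sJ' j : j \in s -> j \notin J by move=> js; apply: sJ; rewrite inE js orbT.
have ms := measurable_psum s.
have mpre A' : measurable A' -> measurable (psum s @^-1` A').
  by move=> mA'; rewrite -[X in measurable X]setTI; exact: ms.
have QE A' : Q A' = P (A' `&` event J B) by [].
have mY := @measurable_funPT _ _ _ _ (Y i).
pose mY' : {finite_measure set 'rV[R]_d -> \bar R} := distribution P (Y i).
have HQ A' B' : measurable A' -> measurable B' ->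
    Q (psum s @^-1` A' `&` Y i @^-1` B') = (Q (psum s @^-1` A') * mY' B')%E.
  move=> mA' mB'; rewrite !QE Hadd//.
  rewrite IH// /mY' /= /distribution /pushforward -muleA; congr (_ * _)%E.
  by rewrite muleC.
pose D : set ('rV[R]_d * 'rV[R]_d) := (fun z => c i *: z.2 + z.1) @^-1` A.
have mD : measurable D.
  rewrite /D -[X in measurable X]setTI.
  suff : measurable_fun setT (fun z : 'rV[R]_d * 'rV[R]_d => c i *: z.2 + z.1) by exact.
  apply/measurable_fun_rVP => j.
  rewrite (_ : (fun _ => _) = (fun z : 'rV[R]_d * 'rV[R]_d => c i * z.2 0 j + z.1 0 j)); last first.
    by apply/funext => z; rewrite !mxE.
  apply: measurable_funD; first apply: measurable_funM => //.
    by apply: (measurableT_comp (@measurable_rV_coord R d j)); exact: measurable_snd.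
  by apply: (measurableT_comp (@measurable_rV_coord R d j)); exact: measurable_fst.
have DE : psum (i :: s) @^-1` A = (fun w => (psum s w, Y i w)) @^-1` D.
  by apply/seteqP; split=> w; rewrite /D /psum /= big_cons.
have E1 : P (psum (i :: s) @^-1` A `&` event J B) = (law Q ms \x mY')%E D.
  by rewrite DE; exact: (pair_lawE ms mY HQ mD).
have E2 : P (psum (i :: s) @^-1` A) = (law P ms \x mY')%E D.
  by rewrite DE; exact: (@pair_lawE _ _ _ _ _ _ _ P mY' _ _ ms mY H0 _ mD).
rewrite E1 E2.
have P0 : (0 <= fine (P (event J B)))%R by rewrite fine_ge0.
pose k : {nonneg R} := NngNum P0.
rewrite /product_measure1.
rewrite (@eq_measure_integral _ _ _ _ (mscale k (law P ms))).
  rewrite ge0_integral_mscale//=; last first.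
    exact: measurable_fun_xsection.
  by rewrite muleC fineK// fin_num_measure.
move=> A' mA' _.
change (P (psum s @^-1` A' `&` event J B) = (fine (P (event J B)))%:E * P (psum s @^-1` A'))%E.
by rewrite IH// fineK ?fin_num_measure// muleC.
Qed.

(** a new summand is independent of a partial sum *)
Lemma psum_indep_cons i s : uniq (i :: s) -> forall A B,
  measurable A -> measurable B ->
  P (psum s @^-1` A `&` Y i @^-1` B) = (P (psum s @^-1` A) * P (Y i @^-1` B))%E.
Proof.
move=> /= /andP[is' us] A B mA mB.
have eE : event (finset.set1 i) (fun=> B) = Y i @^-1` B.
  apply/seteqP; split=> w /=; first by move=> /(_ i); rewrite /= inE eqxx; exact.
  by move=> Bw j /=; rewrite inE => /eqP ->.
rewrite -eE psum_indep// => j js; rewrite inE.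
by apply/eqP => ji; rewrite -ji js in is'.
Qed.

End partial_sums.

(** * Log-convex functions *)

Section log_convex.
Context {R : realType}.
Variable h : R -> R.
Hypotheses (h_lc : log_convex h) (h_ge0 : forall r, 0 <= h r) (h0 : h 0 = 1).

Lemma log_convex_scale (r lam : R) : 0 <= r -> 0 <= lam <= 1 ->
  h (lam * r) <= h r `^ lam.
Proof.
move=> r0 /andP[]; rewrite le_eqVlt => /predU1P[<- _|l0].
  by rewrite mul0r h0 powRr0.
rewrite le_eqVlt => /predU1P[->|l1]; first by rewrite mul1r powRr1.
have := h_lc r0 (lexx 0) (introT andP (conj l0 l1)).
by rewrite mulr0 addr0 h0 powR1 mulr1.
Qed.

Variable M : R.
Hypothesis hM : forall s, 0 <= s -> 1 - s * M <= h s.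

(** a first-order lower bound at 0 becomes a global exponential lower bound *)
Lemma log_convex_ge_exp (r : R) : 0 <= M -> 0 <= r -> expR (- (r * M)) <= h r.
Proof.
move=> M0 r0; set c := r * M.
have c0 : 0 <= c by rewrite mulr_ge0.
(* h r >= h (r / n) ^ n >= (1 - c / n) ^ n >= exp (- c n / (n - c)) *)
have key (n : nat) : (0 < n)%N -> c < n%:R -> expR (- (c * n%:R / (n%:R - c))) <= h r.
  move=> n0 cn; have n0' : 0 < n%:R :> R by rewrite ltr0n.
  have nc : 0 < n%:R - c by rewrite subr_gt0.
  have H1 : 1 - c / n%:R <= h (r / n%:R).
    have := @hM (r / n%:R); rewrite /c mulrAC; apply; exact: divr_ge0.
  have H2 : h (r / n%:R) ^+ n <= h r.
    have l01 : 0 <= (n%:R : R)^-1 <= 1.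
      by rewrite invr_ge0 ltW//= invf_le1// ler1n.
    have := log_convex_scale r0 l01; rewrite mulrC => /(lerXn2r n).
    rewrite !nnegrE h_ge0 powR_ge0 => /(_ isT isT) /le_trans; apply.
    by rewrite -powR_mulrn ?powR_ge0// -powRrM mulVf ?gt_eqF// powRr1.
  have q0 : 0 < 1 - c / n%:R by rewrite subr_gt0 ltr_pdivrMr// mul1r.
  apply: le_trans H2; apply: (@le_trans _ _ ((1 - c / n%:R) ^+ n)); last first.
    by apply: lerXn2r => //; rewrite nnegrE// ltW.
  have -> : - (c * n%:R / (n%:R - c)) = - (c / (n%:R - c)) * n%:R by field; rewrite gt_eqF.
  rewrite expRM_natr; apply: lerXn2r; rewrite ?nnegrE ?expR_ge0//; first exact: ltW.
  rewrite expRN -[leRHS]invrK lef_pV2 ?posrE ?invr_gt0 ?expR_gt0//.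
  apply: le_trans (expR_ge1Dx _).
  by rewrite le_eqVlt; apply/orP; left; apply/eqP; field; rewrite !gt_eqF.
have [n0 Hn0] : exists n : nat, c < n%:R.
  by exists (Num.truncn c).+1; exact: truncnS_gt.
(* positivity of h r allows taking its logarithm *)
have hr : 0 < h r.
  have := key n0.+1 isT (lt_trans Hn0 _); rewrite ltr_nat ltnSn => /(_ isT).
  exact/lt_le_trans/expR_gt0.
rewrite leNgt; apply/negP => hlt.
(* otherwise, for n large, c n / (n - c) falls below L > c *)
pose L := - ln (h r).
have cL : c < L by rewrite /L ltrNr -[ltRHS]expRK ltr_ln ?posrE ?expR_gt0.
pose n := (n0 + (Num.truncn (L * c / (L - c))).+1)%N.
have nL : L * c / (L - c) < n%:R.
  apply: (lt_le_trans (truncnS_gt _)); by rewrite ler_nat leq_addl.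
have cn : c < n%:R by apply: (lt_le_trans Hn0); rewrite ler_nat leq_addr.
have := key n _ cn; rewrite {1}/n addnS => /(_ isT).
rewrite -[h r]lnK ?posrE// ler_expR -[ln _]opprK -/L lerN2.
apply/negP; rewrite -ltNge ltr_pdivrMr ?subr_gt0//.
by move: nL; rewrite ltr_pdivrMr ?subr_gt0//; lra.
Qed.

Lemma log_convex_prod_le n (a : 'I_n -> R) : simplex a -> 0 < h 1 ->
  \prod_(i < n) h (a i) <= h 1.
Proof.
move=> [a01 a1] h1.
apply: (@le_trans _ _ (\prod_(i < n) h 1 `^ a i)).
  apply: ler_prod => i _; rewrite h_ge0/=.
  by rewrite -[a i in leLHS]mulr1; apply: log_convex_scale.
have -> : \prod_(i < n) h 1 `^ a i = h 1 `^ (\sum_(i < n) a i).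
  elim/big_rec2: _ => [|i y x _ ->]; first by rewrite powRr0.
  by rewrite powRD// (gt_eqF h1) implybT.
by rewrite a1 powRr1//; exact: ltW.
Qed.

Lemma log_convex_prod_ge n (a : 'I_n -> R) : simplex a -> 0 <= M ->
  expR (- M) <= \prod_(i < n) h (a i).
Proof.
move=> [a01 a1] M0.
have -> : expR (- M) = \prod_(i < n) expR (- (a i * M)).
  by rewrite -expR_sum -[M in LHS]mul1r -a1 mulr_suml sumrN.
apply: ler_prod => i _; rewrite expR_ge0/=; apply: log_convex_ge_exp => //.
by case/andP: (a01 i).
Qed.

End log_convex.

(** * Characteristic functions *)

Section dotv_theory.
Context {R : realType} {d : nat}.
Implicit Types x y z : 'rV[R]_d.

Lemma dotvC x y : dotv x y = dotv y x.
Proof. by apply: eq_bigr => i _; rewrite mulrC. Qed.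

Lemma dotvDr x y z : dotv x (y + z) = dotv x y + dotv x z.
Proof.
by rewrite -big_split/=; apply: eq_bigr => i _; rewrite mxE mulrDr.
Qed.

Lemma dotvZr c x y : dotv x (c *: y) = c * dotv x y.
Proof. by rewrite mulr_sumr; apply: eq_bigr => i _; rewrite mxE mulrCA. Qed.

Lemma dotvZl c x y : dotv (c *: x) y = c * dotv x y.
Proof. by rewrite dotvC dotvZr dotvC. Qed.

Lemma dotv0l x : dotv 0 x = 0.
Proof. by apply: big1 => i _; rewrite mxE mul0r. Qed.

Lemma dotv_delta (i : 'I_d) x : dotv (delta_mx 0 i) x = x 0 i.
Proof.
rewrite /dotv (bigD1 i)//= big1 ?addr0 ?mxE ?eqxx ?mul1r// => j ji.
by rewrite mxE (negbTE ji) andbF mul0r.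
Qed.

Lemma dotvv_ge0 x : 0 <= dotv x x.
Proof. by apply: sumr_ge0 => i _; rewrite -expr2 sqr_ge0. Qed.

Lemma measurable_fun_dotv d' (T : measurableType d') (U W : T -> 'rV[R]_d) :
  measurable_fun setT U -> measurable_fun setT W ->
  measurable_fun setT (fun w => dotv (U w) (W w)).
Proof.
move=> /measurable_fun_rVP mU /measurable_fun_rVP mW.
by apply: measurable_sum => i; exact: measurable_funM.
Qed.

Lemma measurable_dotv y d' (T : measurableType d') (W : T -> 'rV[R]_d) :
  measurable_fun setT W -> measurable_fun setT (fun w => dotv y (W w)).
Proof. by move=> mW; apply: measurable_fun_dotv. Qed.

End dotv_theory.

Section charf.
Context dT (T : measurableType dT) (R : realType).
Implicit Types P : {finite_measure set T -> \bar R}.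

Lemma integrable_le1 P (f : T -> R) : measurable_fun setT f ->
  (forall x, `|f x| <= 1) -> P.-integrable setT (EFin \o f).
Proof.
move=> mf f1; apply: (le_integrable _ _ _ (finite_measure_integrable_cst P 1 _)) => //.
  exact/measurable_EFinP.
by move=> x _; rewrite lee_fin normr1.
Qed.

Lemma EFin_Rintegral P (f : T -> R) : P.-integrable setT (EFin \o f) ->
  ((\int[P]_x f x)%R)%:E = (\int[P]_x (f x)%:E)%E.
Proof. by move=> If; rewrite /Rintegral fineK//; exact: integrable_fin_num. Qed.

Lemma integrable_cos P (f : T -> R) : measurable_fun setT f ->
  P.-integrable setT (EFin \o (fun x => cos (f x))).
Proof.
by move=> mf; apply: integrable_le1 => [|x]; [exact: measurable_fun_cos|exact: cos_max].
Qed.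

Lemma integrable_sin P (f : T -> R) : measurable_fun setT f ->
  P.-integrable setT (EFin \o (fun x => sin (f x))).
Proof.
by move=> mf; apply: integrable_le1 => [|x]; [exact: measurable_fun_sin|exact: sin_max].
Qed.

End charf.

(** real and imaginary parts of the characteristic function of a random vector *)
Definition charf dT (T : measurableType dT) (R : realType)
    (P : {measure set T -> \bar R}) d (W : T -> 'rV[R]_d) (y : 'rV[R]_d) : R :=
  (\int[P]_w cos (dotv y (W w)))%R.

Definition charfi dT (T : measurableType dT) (R : realType)
    (P : {measure set T -> \bar R}) d (W : T -> 'rV[R]_d) (y : 'rV[R]_d) : R :=
  (\int[P]_w sin (dotv y (W w)))%R.

Section charf_theory.
Context dT (T : measurableType dT) (R : realType) (P : probability T R) (d : nat).
Variable W : T -> 'rV[R]_d.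
Hypothesis mW : measurable_fun setT W.

Let mdot y : measurable_fun setT (fun w => dotv y (W w)).
Proof. exact: measurable_dotv. Qed.

Lemma integral_one_sub_cos y :
  (\int[P]_w (1 - cos (dotv y (W w)))%:E = (1 - charf P W y)%:E)%E.
Proof.
under eq_integral do rewrite EFinB.
rewrite integralB_EFin//; last 2 first.
- exact: finite_measure_integrable_cst.
- exact: integrable_cos.
rewrite EFinB EFin_Rintegral//; last exact: integrable_cos.
congr (_ - _)%E; rewrite integral_cst// mul1e.
exact: (@probability_setT _ _ _ P).
Qed.

Lemma charf_le1 y : charf P W y <= 1.
Proof.
rewrite -subr_ge0 -lee_fin -integral_one_sub_cos.
by apply: integral_ge0 => w _; rewrite lee_fin one_sub_cos_ge0.
Qed.

Lemma charf0 : charf P W 0 = 1.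
Proof.
apply/eqP; rewrite eq_sym -subr_eq0 -eqe -integral_one_sub_cos.
by rewrite integral0_eq// => w _; rewrite dotv0l cos0 subrr.
Qed.

Let mdot2 y : measurable_fun setT (fun w => (dotv y (W w) ^+ 2)%:E).
Proof. by apply/measurable_EFinP; exact: measurable_funX. Qed.

Lemma one_sub_charf_le y :
  ((1 - charf P W y)%:E <= (2^-1)%:E * \int[P]_w (dotv y (W w) ^+ 2)%:E)%E.
Proof.
rewrite -integral_one_sub_cos -ge0_integralZl_EFin//; last first.
  by move=> w _; rewrite lee_fin sqr_ge0.
apply: ge0_le_integral => //.
- by apply/measurable_EFinP; apply: measurable_funB => //; exact: measurable_fun_cos.
- exact: measurable_funeM.
- by move=> w _; rewrite -EFinM lee_fin mulrC one_sub_cos_le.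
Qed.

(** second difference quotients of the characteristic function at the origin *)
Definition charf_diff2 y (n : nat) : R :=
  2 * (1 - charf P W (n.+1%:R^-1 *: y)) * n.+1%:R ^+ 2.

(** The second moment may be infinite: the quotients are bounded above by
1 - cos t <= t^2 / 2, and below in the limit by the lemma of Fatou. *)
Lemma cvg_charf_diff2 y :
  (charf_diff2 y n)%:E @[n --> \oo] --> (\int[P]_w (dotv y (W w) ^+ 2)%:E)%E.
Proof.
pose f n w := 2 * (1 - cos (dotv (n.+1%:R^-1 *: y) (W w))) * n.+1%:R ^+ 2.
have f0 n w : 0 <= f n w by rewrite !mulr_ge0// ?one_sub_cos_ge0.
have mf n : measurable_fun setT (f n).
  apply: measurable_funM => //; apply: measurable_funM => //.
  by apply: measurable_funB => //; exact: measurable_fun_cos.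
have fE n : (\int[P]_w (f n w)%:E)%E = (charf_diff2 y n)%:E.
  rewrite (_ : (fun w => _) = (fun w => (2 * n.+1%:R ^+ 2)%:E *
     (1 - cos (dotv (n.+1%:R^-1 *: y) (W w)))%:E)%E); last first.
    by apply/funext => w; rewrite -EFinM /f; congr EFin; ring.
  rewrite ge0_integralZl_EFin//.
  - by rewrite integral_one_sub_cos -EFinM /charf_diff2; congr EFin; ring.
  - by apply/measurable_EFinP; apply: measurable_funB => //; exact: measurable_fun_cos.
have cvf w : (f n w)%:E @[n --> \oo] --> (dotv y (W w) ^+ 2)%:E.
  apply/fine_cvgP; split; first exact: nearW.
  have := @cvg_one_sub_cos R (dotv y (W w)); apply: cvg_trans.
  by apply: near_eq_cvg; apply: nearW => n /=; rewrite /f dotvZl.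
have fle n : ((charf_diff2 y n)%:E <= \int[P]_w (dotv y (W w) ^+ 2)%:E)%E.
  rewrite -fE; apply: ge0_le_integral => //.
  - by move=> w _; rewrite lee_fin.
  - exact/measurable_EFinP.
  - move=> w _; rewrite lee_fin /f dotvZl.
    set t := _ * dotv y (W w).
    have -> : dotv y (W w) ^+ 2 = 2 * (t ^+ 2 / 2) * n.+1%:R ^+ 2.
      have n0 : n.+1%:R != 0 :> R by [].
      by rewrite /t; move: n0; set m := n.+1%:R => n0; field.
    rewrite ler_wpM2r ?exprn_ge0// ler_wpM2l//.
    exact: one_sub_cos_le.
have : (- (charf_diff2 y n)%:E)%E @[n --> \oo] --> (- \int[P]_w (dotv y (W w) ^+ 2)%:E)%E.
  apply: limn_esup_le_cvg; last by move=> n; rewrite leeN2.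
  rewrite (limn_esupN (fun n => (charf_diff2 y n)%:E)) leeN2.
  have F := @fatou _ _ _ P setT measurableT (fun n w => (f n w)%:E)
    (fun n => iffRL (measurable_EFinP _ _) (mf n)) (fun n w _ => f0 n w).
  rewrite (_ : (fun n => (charf_diff2 y n)%:E) = (fun n => \int[P]_w (f n w)%:E)%E); last first.
    by apply/funext => n; rewrite fE.
  apply: le_trans F; rewrite le_eqVlt; apply/orP; left; apply/eqP.
  by apply: eq_integral => w _; rewrite (cvg_limn_einf_sup (cvf w)).1.
move=> /cvgeN; rewrite oppeK => H.
rewrite (_ : (fun n => _) = (fun n => - - (charf_diff2 y n)%:E)%E); first exact: H.
by apply/funext => n; congr EFin; rewrite opprK.
Qed.

(** an integrable linear form of a random vector whose characteristic function
is real has mean zero *)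
Lemma charfi0_centered y : P.-integrable setT (EFin \o (fun w => dotv y (W w))) ->
  (forall n : nat, charfi P W (n.+1%:R^-1 *: y) = 0) ->
  (\int[P]_w (dotv y (W w))%:E = 0)%E.
Proof.
move=> Iy s0.
pose f n w := sin (dotv (n.+1%:R^-1 *: y) (W w)) * n.+1%:R.
have mf n : measurable_fun setT (f n).
  by apply: measurable_funM => //; exact: measurable_fun_sin.
have cvf w : f n w @[n --> \oo] --> dotv y (W w).
  have := @cvg_sin_div R (dotv y (W w)); apply: cvg_trans.
  by apply: near_eq_cvg; apply: nearW => n /=; rewrite /f dotvZl.
have fle n w : `|f n w| <= `|dotv y (W w)|.
  rewrite /f dotvZl normrM [X in _ * X]ger0_norm// -ler_pdivlMr//.
  by rewrite (le_trans (norm_sin_le _))// normrM gtr0_norm// mulrC.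
have H := cvg_integral_dominated mf cvf (integrable_norm Iy) fle.
have E : (fun n => (\int[P]_x (f n x)%:E)%E) = (fun=> 0%E).
  apply/funext => n; rewrite /f.
  under eq_integral do rewrite EFinM.
  rewrite integralZr//; last exact: integrable_sin.
  have := s0 n; rewrite /charfi => E0.
  by rewrite -EFin_Rintegral ?E0 ?mul0e//; exact: integrable_sin.
rewrite E in H.
by have /cvg_unique := H; move/(_ (@ereal_hausdorff R) _ (cvg_cst _)).
Qed.

End charf_theory.

Section covariance.
Context dT (T : measurableType dT) (R : realType) (P : probability T R) (d : nat).
Variable W : T -> 'rV[R]_d.
Hypothesis mW : measurable_fun setT W.
Hypothesis W2 : forall y, (\int[P]_w (dotv y (W w) ^+ 2)%:E < +oo)%E.
Hypothesis W0 : forall y, charfi P W y = 0.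

Let mcoord i : measurable_fun setT (fun w => W w 0 i).
Proof. by have /measurable_fun_rVP := mW; exact. Qed.

Let coord2 i : P.-integrable setT (EFin \o (fun w => W w 0 i ^+ 2)).
Proof.
apply/integrableP; split; first by apply/measurable_EFinP; exact: measurable_funX.
have := W2 (delta_mx 0 i); apply: le_lt_trans.
by under eq_integral do rewrite /= ger0_norm ?sqr_ge0// -dotv_delta.
Qed.

Let coordM i j : P.-integrable setT (EFin \o (fun w => W w 0 i * W w 0 j)).
Proof.
have := integrableD measurableT (coord2 i) (coord2 j).
apply: le_integrable => //; first by apply/measurable_EFinP; exact: measurable_funM.
move=> w _; rewrite /= !lee_fin [leRHS]ger0_norm ?addr_ge0 ?sqr_ge0//.
rewrite ler_norml; have := sqr_ge0 (W w 0 i - W w 0 j).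
by have := sqr_ge0 (W w 0 i + W w 0 j); nra.
Qed.

Let coord1 i : P.-integrable setT (EFin \o (fun w => W w 0 i)).
Proof.
have := integrableD measurableT (coord2 i) (finite_measure_integrable_cst P 1 measurableT).
apply: le_integrable => //; first exact/measurable_EFinP.
move=> w _; rewrite /= !lee_fin [leRHS]ger0_norm ?addr_ge0 ?sqr_ge0//.
rewrite ler_norml; have := sqr_ge0 (W w 0 i - 1).
by have := sqr_ge0 (W w 0 i + 1); nra.
Qed.

Lemma covariance_centered i j : cov P W i j = (\int[P]_w (W w 0 i * W w 0 j)%:E)%E.
Proof.
have E0 (k : 'I_d) : ('E_P[(fun w => (W w 0 k)%R)] = 0)%E.
  rewrite unlock.
  under eq_integral do rewrite -dotv_delta.
  apply: charfi0_centered => //.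
  by apply: eq_integrable (coord1 k) => // w _ /=; rewrite dotv_delta.
rewrite /cov unlock !E0/= unlock.
by apply: eq_integral => w _; rewrite !fctE /= !subr0.
Qed.

Lemma second_moment_cov y :
  (\int[P]_w (dotv y (W w) ^+ 2)%:E =
   \sum_(i < d) \sum_(j < d) (y 0 i * y 0 j)%:E * cov P W i j)%E.
Proof.
have E i j : ((y 0 i * y 0 j)%:E * cov P W i j =
    \int[P]_w ((y 0 i * y 0 j)%:E * (W w 0 i * W w 0 j)%:E))%E.
  by rewrite covariance_centered -(integralZl measurableT (coordM i j)).
under eq_bigr do under eq_bigr do rewrite E.
have I2 i j : P.-integrable setT (fun w => (y 0 i * y 0 j)%:E * (W w 0 i * W w 0 j)%:E)%E.
  exact: (integrableZl measurableT _ (coordM i j)).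
under eq_bigr do rewrite -integral_sum//.
rewrite -integral_sum//; last by move=> i; exact: integrable_sum.
apply: eq_integral => w _.
rewrite /dotv expr2 mulr_suml -sumEFin; apply: eq_bigr => i _.
rewrite mulr_sumr -sumEFin; apply: eq_bigr => j _.
by rewrite -EFinM; congr EFin; ring.
Qed.

End covariance.

(** * Characteristic functions of sums, of densities and of Gaussian vectors *)

Local Open Scope complex_scope.

Section charf_psum.
Context dT (T : measurableType dT) (R : realType) (P : probability T R).
Context (d : nat) (I : finType) (Y : I -> {RV P >-> 'rV[R]_d}) (c : I -> R).
Hypothesis indep : mutually_independent Y.
Hypothesis Y0 : forall i y, charfi P (Y i) y = 0.

Let mY i : measurable_fun setT (Y i).
Proof. exact: measurable_funPT. Qed.

(** the terms with sines vanish because the Y i have real characteristic functions *)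
Lemma charf_psum_cons i s y : uniq (i :: s) ->
  charf P (psum Y c (i :: s)) y =
  charf P (psum Y c s) y * charf P (Y i) (c i *: y).
Proof.
move=> us; set C := charf P (Y i) (c i *: y).
have ms := measurable_psum Y c s.
have mis := measurable_psum Y c (i :: s).
suff : 1 - charf P (psum Y c (i :: s)) y = 1 - charf P (psum Y c s) y * C by lra.
apply: EFin_inj; rewrite -integral_one_sub_cos//.
pose m2 : {finite_measure set 'rV[R]_d -> \bar R} := distribution P (Y i).
pose f (z : 'rV[R]_d * 'rV[R]_d) := (1 - cos (dotv y z.1 + dotv (c i *: y) z.2))%:E.
have mf : measurable_fun setT f.
  apply/measurable_EFinP; apply: measurable_funB => //; apply: measurable_fun_cos.
  by apply: measurable_funD; apply: measurable_dotv; [exact: measurable_fst|exact: measurable_snd].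
have f0 z : (0 <= f z)%E by rewrite lee_fin one_sub_cos_ge0.
have E1 : (\int[P]_w (1 - cos (dotv y (psum Y c (i :: s) w)))%:E =
   \int[P]_w f (psum Y c s w, Y i w))%E.
  apply: eq_integral => w _; rewrite /f /psum big_cons /= dotvDr dotvZr dotvZl.
  by rewrite (addrC (c i * _)).
rewrite E1 (@ge0_integral_pair _ _ _ _ _ _ _ P m2 _ _ ms (mY i) _ f mf f0); last first.
  by move=> A B mA mB; exact: psum_indep_cons.
have mi : measurable_fun setT (fun w => dotv (c i *: y) (Y i w)) by exact: measurable_dotv.
have E2 v : (\int[m2]_u f (v, u) = (1 - cos (dotv y v) * C)%:E)%E.
  rewrite ge0_integral_distribution//; last first.
    apply: (measurableT_comp mf); exact: measurable_pair1.
  pose b w := dotv (c i *: y) (Y i w); pose a := dotv y v.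
  have -> : (\int[P]_x ((fun u => f (v, u)) \o Y i) x =
    \int[P]_x ((1 - cos a * cos (b x))%:E + (sin a * sin (b x))%:E))%E.
    apply: eq_integral => w _; rewrite /f/= cosD -EFinD; congr EFin.
    by rewrite /a /b; ring.
  have ic := integrable_cos P mi; have isn := integrable_sin P mi.
  have i1 := integrableZl measurableT (cos a) ic.
  have i2 := integrableZl measurableT (sin a) isn.
  rewrite integralD//; last first.
    exact: (integrableB measurableT (finite_measure_integrable_cst P 1 measurableT) i1).
  under eq_integral do rewrite EFinB.
  rewrite integralB_EFin//; last exact: finite_measure_integrable_cst.
  have -> : (\int[P]_x (cos a * cos (b x))%:E = (cos a * C)%:E)%E.
    under eq_integral do rewrite EFinM.
    by rewrite integralZl// EFinM -EFin_Rintegral.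
  have -> : (\int[P]_x (sin a * sin (b x))%:E = 0)%E.
    under eq_integral do rewrite EFinM.
    rewrite integralZl// -EFin_Rintegral//.
    by have := Y0 i (c i *: y); rewrite /charfi => ->; rewrite mule0.
  rewrite adde0 EFinB; congr (_ - _)%E; rewrite integral_cst// mul1e.
  exact: (@probability_setT _ _ _ P).
under eq_integral do rewrite E2 EFinB.
have mv : measurable_fun setT (fun w => dotv y (psum Y c s w)) by exact: measurable_dotv.
have ic := integrable_cos P mv.
rewrite integralB_EFin//; first last.
- exact: (integrableZr measurableT C ic).
- exact: finite_measure_integrable_cst.
rewrite EFinB; congr (_ - _)%E.
  rewrite integral_cst// mul1e; exact: (@probability_setT _ _ _ P).
under eq_integral do rewrite EFinM.
by rewrite integralZr// EFinM -EFin_Rintegral.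
Qed.

Lemma charf_psum s y : uniq s ->
  charf P (psum Y c s) y = \prod_(i <- s) charf P (Y i) (c i *: y).
Proof.
elim: s => [_|i s IH us].
  rewrite big_nil /charf /psum.
  transitivity (\int[P]_w (cst 1 w))%R.
    by apply: eq_Rintegral => w _; rewrite big_nil -(scale0r 0) dotvZr mul0r cos0.
  rewrite Rintegral_cst// mul1r -[RHS]/(fine 1%E); congr fine.
  exact: (@probability_setT _ _ _ P).
by rewrite charf_psum_cons// big_cons IH 1?mulrC//; case/andP: us.
Qed.

End charf_psum.

Section charf_density.
Context dT (T : measurableType dT) (R : realType) (P : probability T R).
Context (d : nat) (X : {RV P >-> 'rV[R]_d}) (phi : 'rV[R]_d -> R).
Hypotheses (mphi : measurable_fun setT phi) (phi0 : forall x, 0 <= phi x).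
Hypothesis X_law : has_density X phi.

Let integral_law (f : 'rV[R]_d -> R) : measurable_fun setT f ->
    (forall x, `|f x| <= 1) ->
  (\int[P]_w (f (X w))%:E = \int[lebesgue_rV d]_x (f x * phi x)%:E)%E.
Proof.
move=> mf f1.
have mX : measurable_fun setT X by exact: measurable_funPT.
rewrite -(@integral_density _ _ _ (lebesgue_rV d) (distribution P X))//.
rewrite integral_distribution//; first exact/measurable_EFinP.
by apply: integrable_le1 => //; exact: measurableT_comp.
Qed.

Lemma Re_fourier_density x :
  complex.Re (fourier (fun y => (phi y)%:C) x) = charf P X ((2 * pi) *: x).
Proof.
rewrite /fourier /= /charf /Rintegral; congr fine.
rewrite (@integral_law (fun u => cos (dotv ((2 * pi) *: x) u))).
- apply: eq_integral => u _ /=.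
  by rewrite mul0r subr0 cosN dotvZl mulrC.
- by apply: measurable_fun_cos; exact: measurable_dotv.
- by move=> u; exact: cos_max.
Qed.

Lemma Im_fourier_density x :
  complex.Im (fourier (fun y => (phi y)%:C) x) = - charfi P X ((2 * pi) *: x).
Proof.
have mX : measurable_fun setT X by exact: measurable_funPT.
have md : measurable_fun setT (fun w => dotv ((2 * pi) *: x) (X w)) by exact: measurable_dotv.
rewrite /charfi -mulN1r -(RintegralZl _ measurableT (integrable_sin P md)).
rewrite /fourier /= /Rintegral; congr fine.
rewrite (@integral_law (fun u => -1 * sin (dotv ((2 * pi) *: x) u))).
- apply: eq_integral => u _ /=.
  by rewrite mul0r addr0 sinN dotvZl mulrN mulN1r mulNr mulrC.
- apply: measurable_funM => //; apply: measurable_fun_sin; exact: measurable_dotv.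
- by move=> u; rewrite mulN1r normrN; exact: sin_max.
Qed.

End charf_density.

Section charf_gaussian.
Context (R : realType).

Lemma integral_normal_prob_cos (s t c : R) : 0 < s ->
  (\int[normal_prob 0 s]_x (cos (t * x + c))%:E =
   (cos c * expR (- (s * t) ^+ 2 / 2))%:E)%E.
Proof.
move=> s0.
have mt : measurable_fun setT (fun x : R => t * x + c).
  by apply: measurable_funD => //; exact: measurable_funM.
have E : (\int[normal_prob 0 s]_x (cos (t * x + c))%:E =
    \int[lebesgue_measure]_x (cos (t * x + c) * normal_pdf 0 s x)%:E)%E.
  apply: (@integral_density _ _ _ lebesgue_measure (normal_prob 0 s) (normal_pdf 0 s)) => //.
  - exact: measurable_normal_pdf.
  - by move=> x; exact: normal_pdf_ge0.
  - by have X := measurable_fun_cos mt; exact: X.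
have := integrable_fin_num measurableT (@integrable_cos _ _ R (normal_prob 0 s) _ mt).
move=> /fineK <-; rewrite E; congr EFin.
have := @Rintegral_normal_cos R 0 s t c (lt0r_neq0 s0).
rewrite mulr0 add0r => <-.
by rewrite /Rintegral; congr fine; apply: eq_integral => x _; rewrite mulrC.
Qed.

Context dT (T : measurableType dT) (P : probability T R).
Context (d : nat) (Z : {RV P >-> 'rV[R]_d}).
Hypothesis Z_gauss : centered_gaussian Z.

Lemma centered_gaussian_cos y : exists2 s : R, 0 <= s & forall t c,
  (\int[P]_w cos (t * dotv y (Z w) + c) = cos c * expR (- (s * t) ^+ 2 / 2))%R.
Proof.
have mZ : measurable_fun setT Z by exact: measurable_funPT.
have my : measurable_fun setT (fun w => dotv y (Z w)) by exact: measurable_dotv.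
pose yZ : T -> measurableTypeR R := fun w => dotv y (Z w).
have {}my : measurable_fun setT yZ by exact: my.
have mg (t c : R) : measurable_fun setT (fun x : measurableTypeR R => t * x + c).
  by apply: measurable_funD => //; exact: measurable_funM.
have E t c : (\int[P]_w (cos (t * dotv y (Z w) + c))%:E =
    \int[law P my]_x (cos (t * x + c))%:E)%E.
  rewrite /law integral_pushforward//.
  - by apply/measurable_EFinP; have X := measurable_fun_cos (mg t c); exact: X.
  - have X := measurableT_comp (mg t c) my.
    exact: (integrable_cos P X).
have [H|[s s0 H]] := Z_gauss y.
  exists 0 => // t c; rewrite /Rintegral E.
  rewrite (@eq_measure_integral _ _ _ _ (\d_(0 : measurableTypeR R))); last by move=> B mB _; exact: H.
  rewrite integral_dirac//.
    by rewrite diracT mul1e/= mulr0 add0r mul0r expr0n/= oppr0 mul0r expR0 mulr1.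
  by apply/measurable_EFinP; have X := measurable_fun_cos (mg t c); exact: X.
exists s; first exact: ltW.
move=> t c; rewrite /Rintegral E.
have -> : (\int[law P my]_x (cos (t * x + c))%:E =
    \int[normal_prob 0 s]_x (cos (t * x + c))%:E)%E.
  by apply: eq_measure_integral => B mB _; exact: H.
by rewrite integral_normal_prob_cos.
Qed.

Lemma centered_gaussian_charfi y : charfi P Z y = 0.
Proof.
(* the phase -pi/2 turns the cosine into a sine *)
have [s s0 /(_ 1 (- (pi / 2)))] := centered_gaussian_cos y.
rewrite cosN cos_pihalf mul0r => <-.
by apply: eq_Rintegral => w _; rewrite mul1r cosBpihalf.
Qed.

(** a centered Gaussian vector has finite second moments, and they bound its
characteristic function; equality holds but is not needed *)
Lemma centered_gaussian_charf y :
  (\int[P]_w (dotv y (Z w) ^+ 2)%:E < +oo)%E /\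
  charf P Z y <= expR (- (fine (\int[P]_w (dotv y (Z w) ^+ 2)%:E)%E / 2)).
Proof.
have mZ : measurable_fun setT Z by exact: measurable_funPT.
have [s s0 Hs] := centered_gaussian_cos y.
have cE t : charf P Z (t *: y) = expR (- (s * t) ^+ 2 / 2).
  have := Hs t 0; rewrite cos0 mul1r => <-.
  by apply: eq_Rintegral => w _; rewrite addr0 dotvZl.
have mle : (\int[P]_w (dotv y (Z w) ^+ 2)%:E <= (s ^+ 2)%:E)%E.
  have H : (charf_diff2 P Z y n)%:E @[n --> \oo] --> (\int[P]_w (dotv y (Z w) ^+ 2)%:E)%E.
    exact: cvg_charf_diff2.
  rewrite -(cvg_lim _ H)//; apply: lime_le; first by apply/cvg_ex; eexists; exact: H.
  apply: nearW => n; rewrite lee_fin /charf_diff2 cE.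
  have n0 : 0 < n.+1%:R :> R by [].
  move: n0; set m := n.+1%:R => n0.
  have := expR_ge1Dx (- (s * m^-1) ^+ 2 / 2) => H1.
  have -> : s ^+ 2 = 2 * ((s * m^-1) ^+ 2 / 2) * m ^+ 2 by field; rewrite gt_eqF.
  apply: ler_wpM2r; first by rewrite exprn_ge0 ?ltW.
  by move: H1; rewrite !mulNr; set u := _ / 2; set e := expR _; lra.
split; first exact: le_lt_trans mle (ltry _).
rewrite -[y in charf P Z y]scale1r cE mulr1 mulNr ler_expR lerN2 ler_pM2r//.
rewrite -lee_fin fineK// ge0_fin_numE; first exact: le_lt_trans mle (ltry _).
by apply: integral_ge0 => w _; rewrite lee_fin sqr_ge0.
Qed.

End charf_gaussian.

(** * Comparison of the characteristic functions of Z, S and X *)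

Lemma measurable_fun_enorm (R : realType) d d' (T : measurableType d')
    (W : T -> 'rV[R]_d) :
  measurable_fun setT W -> measurable_fun setT (fun w => enorm (W w)).
Proof.
move=> mW; have mD : measurable_fun setT (fun w => dotv (W w) (W w)).
  exact: measurable_fun_dotv.
apply: measurableT_comp mD.
by apply: continuous_measurable_fun => x; exact: sqrt_continuous.
Qed.

Section second_moment_psum.
Context dT (T : measurableType dT) (R : realType) (P : probability T R).
Context (d : nat) (I : finType) (Y : I -> {RV P >-> 'rV[R]_d}) (c : I -> R).
Hypothesis indep : mutually_independent Y.
Hypothesis Y0 : forall i y, charfi P (Y i) y = 0.
Hypothesis Y2 : forall i y, (\int[P]_w (dotv y (Y i w) ^+ 2)%:E < +oo)%E.

Let mY i : measurable_fun setT (Y i).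
Proof. exact: measurable_funPT. Qed.

Let m y i : R := fine (\int[P]_w (dotv y (Y i w) ^+ 2)%:E)%E.

Let mE y i : (\int[P]_w (dotv y (Y i w) ^+ 2)%:E = (m y i)%:E)%E.
Proof.
rewrite /m fineK// ge0_fin_numE//.
by apply: integral_ge0 => w _; rewrite lee_fin sqr_ge0.
Qed.

(** obtained from the product formula for the characteristic function by taking
second difference quotients at the origin; no covariance has to be computed *)
Lemma second_moment_psum s y : uniq s ->
  (\int[P]_w (dotv y (psum Y c s w) ^+ 2)%:E =
   \sum_(i <- s) (c i ^+ 2)%:E * \int[P]_w (dotv y (Y i w) ^+ 2)%:E)%E.
Proof.
move=> us.
have key : charf_diff2 P (psum Y c s) y n @[n --> \oo] -->
    (\sum_(i <- s) c i ^+ 2 * m y i : R).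
  elim: s us => [_|i s IH us].
    rewrite big_nil; apply: cvg_near_cst; apply: nearW => n.
    by rewrite /charf_diff2 charf_psum// big_nil subrr mulr0 mul0r.
  have us' : uniq s by case/andP: us.
  have {}IH := IH us'.
  have Hi : charf_diff2 P (Y i) (c i *: y) n @[n --> \oo] --> c i ^+ 2 * m y i.
    have H := @cvg_charf_diff2 _ _ _ P _ _ (mY i) (c i *: y).
    have E : (\int[P]_w (dotv (c i *: y) (Y i w) ^+ 2)%:E = (c i ^+ 2 * m y i)%:E)%E.
      under eq_integral do rewrite dotvZl exprMn EFinM.
      rewrite ge0_integralZl_EFin ?sqr_ge0//.
      - by rewrite mE EFinM.
      - by move=> w _; rewrite lee_fin sqr_ge0.
      - by apply/measurable_EFinP; apply: measurable_funX; exact: measurable_dotv.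
    rewrite E in H.
    exact: (fine_cvg H).
  have c1 : charf P (psum Y c s) (n.+1%:R^-1 *: y) @[n --> \oo] --> (1 : R).
    have H0 : (n.+1%:R : R)^-1 @[n --> \oo] --> (0 : R) by exact: cvg_harmonic.
    have H : 1 - charf_diff2 P (psum Y c s) y n * (n.+1%:R^-1 * n.+1%:R^-1 * 2^-1)
        @[n --> \oo] --> 1 - (\sum_(i <- s) c i ^+ 2 * m y i) * (0 * 0 * 2^-1 : R).
      apply: cvgB; first exact: cvg_cst.
      apply: cvgM; first exact: IH.
      by apply: cvgM; [exact: cvgM|exact: cvg_cst].
    rewrite mulr0 mul0r mulr0 subr0 in H.
    apply: cvg_trans H; apply: near_eq_cvg; apply: nearW => n /=.
    rewrite /charf_diff2.
    have : n.+1%:R != 0 :> R by [].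
    by move: (charf _ _ _) => C; move: (n.+1%:R) => q q0; field.
  have H : charf_diff2 P (psum Y c s) y n + charf P (psum Y c s) (n.+1%:R^-1 *: y) *
      charf_diff2 P (Y i) (c i *: y) n @[n --> \oo] -->
      \sum_(i <- s) c i ^+ 2 * m y i + 1 * (c i ^+ 2 * m y i).
    by apply: cvgD => //; exact: cvgM.
  rewrite big_cons addrC -[X in _ + X]mul1r.
  apply: cvg_trans H; apply: near_eq_cvg; apply: nearW => n /=.
  rewrite /charf_diff2 charf_psum_cons//.
  have -> : c i *: (n.+1%:R^-1 *: y) = n.+1%:R^-1 *: (c i *: y).
    by rewrite !scalerA mulrC.
  by ring.
have H := @cvg_charf_diff2 _ _ _ P _ _ (measurable_psum Y c s) y.
have key' : (charf_diff2 P (psum Y c s) y n)%:E @[n --> \oo] -->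
    ((\sum_(i <- s) c i ^+ 2 * m y i : R)%:E).
  by apply/fine_cvgP; split; [exact: nearW|exact: key].
have /cvg_unique := key'; move/(_ (@ereal_hausdorff R) _ H) => <-.
rewrite -sumEFin; apply: eq_bigr => i _.
by rewrite mE EFinM.
Qed.

End second_moment_psum.

Section comparison.
Context (R : realType) (d n : nat) (dT : measure_display) (T : measurableType dT).
Context (P : probability T R) (phi : 'rV[R]_d -> R).
Context (X : {RV P >-> 'rV[R]_d}) (Xs : 'I_n -> {RV P >-> 'rV[R]_d}).
Context (a : 'I_n -> R).
Hypotheses (phi_meas : measurable_fun setT phi) (phi_ge0 : forall x, 0 <= phi x).
Hypotheses (X_law : has_density X phi) (Xs_law : forall i, has_density (Xs i) phi).
Hypothesis indep : mutually_independent Xs.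
Hypothesis phihat_ge0 : forall x, 0 <= fourier (fun y => (phi y)%:C) x.
Hypothesis phihat_logconvex : forall t : 'rV[R]_d,
  log_convex (fun r =>
    complex.Re (fourier (fun y => (phi y)%:C) (Num.sqrt r *: t))).
Hypothesis a_simplex : simplex a.
Hypothesis X2 : (\int[P]_w (enorm (X w) `^ 2)%:E < +oo)%E.

(** the normalized sum with weights sqrt (a i) *)
Let S := psum Xs (fun i => Num.sqrt (a i)) (index_enum 'I_n).

Let pi2 : 2 * pi != 0 :> R.
Proof. by rewrite mulf_neq0// gt_eqF// pi_gt0. Qed.

Let mX : measurable_fun setT X. Proof. exact: measurable_funPT. Qed.
Let mXs i : measurable_fun setT (Xs i). Proof. exact: measurable_funPT. Qed.

Let ch y : charf P X y =
  complex.Re (fourier (fun y => (phi y)%:C) ((2 * pi)^-1 *: y)).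
Proof.
by rewrite (Re_fourier_density phi_meas phi_ge0 X_law) scalerA divff// scale1r.
Qed.

Let ch_Xs i y : charf P (Xs i) y = charf P X y.
Proof.
rewrite ch (Re_fourier_density phi_meas phi_ge0 (Xs_law i)).
by rewrite scalerA divff// scale1r.
Qed.

(** nonnegativity in the complex order includes the vanishing of the imaginary
part *)
Lemma charfi_density_eq0 (V : {RV P >-> 'rV[R]_d}) y : has_density V phi ->
  charfi P V y = 0.
Proof.
move=> V_law; have := phihat_ge0 ((2 * pi)^-1 *: y).
rewrite lecE => /andP[Im0 _]; move: Im0.
rewrite (Im_fourier_density phi_meas phi_ge0 V_law) scalerA divff// scale1r.
by rewrite -[X in _ == X]/(0 : R) oppr_eq0 => /eqP.
Qed.

Let ch_ge0 y : 0 <= charf P X y.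
Proof.
have := phihat_ge0 ((2 * pi)^-1 *: y).
by rewrite ch lecE => /andP[_].
Qed.

Let ch_logconvex y : log_convex (fun r => charf P X (Num.sqrt r *: y)).
Proof.
move=> r s lam r0 s0 lam01.
have := @phihat_logconvex ((2 * pi)^-1 *: y) r s lam r0 s0 lam01.
by rewrite !ch !scalerA ![_ / _ in X in X -> _]mulrC.
Qed.

Lemma norm_dotv_le (y x : 'rV[R]_d) : `|dotv y x| <= (\sum_i `|y 0 i|) * enorm x.
Proof.
rewrite mulr_suml (le_trans (ler_norm_sum _ _ _))//; apply: ler_sum => i _.
rewrite normrM ler_wpM2l// /enorm -sqrtr_sqr ler_wsqrtr//.
rewrite /dotv (bigD1 i)//= -expr2 lerDl.
by apply: sumr_ge0 => j _; rewrite -expr2 sqr_ge0.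
Qed.

Lemma second_moment_lty y : (\int[P]_w (dotv y (X w) ^+ 2)%:E < +oo)%E.
Proof.
pose C := (\sum_i `|y 0 i|) ^+ 2.
apply: (@le_lt_trans _ _ (\int[P]_w (C%:E * (enorm (X w) `^ 2)%:E))%E).
  apply: ge0_le_integral => //.
  - by move=> w _; rewrite lee_fin sqr_ge0.
  - by apply/measurable_EFinP; apply: measurable_funX; exact: measurable_dotv.
  - apply: measurable_funeM; apply/measurable_EFinP.
    apply: (measurableT_comp (measurable_powR 2)).
    exact: measurable_fun_enorm.
  - move=> w _; rewrite -EFinM lee_fin powR_mulrn ?sqrtr_ge0// -exprMn.
    rewrite -[leLHS]real_normK ?num_real// lerXn2r ?nnegrE//.
      by rewrite mulr_ge0 ?sqrtr_ge0// sumr_ge0.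
    exact: norm_dotv_le.
rewrite ge0_integralZl_EFin ?sqr_ge0//.
- by apply: lte_mul_pinfty => //; rewrite lee_fin sqr_ge0.
- by move=> w _; rewrite lee_fin powR_ge0.
- apply/measurable_EFinP; apply: (measurableT_comp (measurable_powR 2)).
  exact: measurable_fun_enorm.
Qed.

Let second_moment_X := second_moment_lty.

Let integral_density_law (V : {RV P >-> 'rV[R]_d}) (f : 'rV[R]_d -> \bar R) :
  has_density V phi -> measurable_fun setT f -> (forall x, 0 <= f x)%E ->
  (\int[P]_w f (V w) = \int[lebesgue_rV d]_x (f x * (phi x)%:E))%E.
Proof.
move=> V_law mf f0.
rewrite -(@ge0_integral_density _ _ _ (lebesgue_rV d) (distribution P V))//.
by rewrite ge0_integral_distribution.
Qed.

(** the summands have the second moments of X *)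
Lemma second_moment_Xs i y :
  (\int[P]_w (dotv y (Xs i w) ^+ 2)%:E = \int[P]_w (dotv y (X w) ^+ 2)%:E)%E.
Proof.
pose f (x : 'rV[R]_d) := (dotv y x ^+ 2)%:E.
have mf : measurable_fun setT f.
  by apply/measurable_EFinP; apply: measurable_funX; exact: measurable_dotv.
have f0 x : (0 <= f x)%E by rewrite lee_fin sqr_ge0.
transitivity (\int[P]_w f (Xs i w))%E => //.
by rewrite (integral_density_law (Xs_law i))// -(integral_density_law X_law).
Qed.

Let sqrt_a i : Num.sqrt (a i) ^+ 2 = a i.
Proof. by rewrite sqr_sqrtr//; case/andP: (a_simplex.1 i). Qed.

Let charf_S y : charf P S y = \prod_(i < n) charf P X (Num.sqrt (a i) *: y).
Proof.
rewrite /S charf_psum//; last exact: index_enum_uniq.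
  by apply: eq_bigr => i _; rewrite ch_Xs.
by move=> i z; exact: charfi_density_eq0.
Qed.

(** S and X have the same second moments because the a i sum to 1 *)
Lemma second_moment_S y :
  (\int[P]_w (dotv y (S w) ^+ 2)%:E = \int[P]_w (dotv y (X w) ^+ 2)%:E)%E.
Proof.
rewrite /S second_moment_psum//.
- under eq_bigr do rewrite second_moment_Xs sqrt_a.
  rewrite -ge0_sume_distrl; last by move=> i _; rewrite lee_fin; case/andP: (a_simplex.1 i).
  by rewrite sumEFin a_simplex.2 mul1e.
- by move=> i z; exact: charfi_density_eq0.
- by move=> i z; rewrite second_moment_Xs.
- exact: index_enum_uniq.
Qed.

Let M y : R := fine (\int[P]_w (dotv y (X w) ^+ 2)%:E)%E / 2.

Let M_ge0 y : 0 <= M y.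
Proof.
rewrite divr_ge0// fine_ge0//; apply: integral_ge0 => w _.
by rewrite lee_fin sqr_ge0.
Qed.

Let MX y : (\int[P]_w (dotv y (X w) ^+ 2)%:E = (2 * M y)%:E)%E.
Proof.
rewrite /M mulrC divfK// fineK// ge0_fin_numE//.
by apply: integral_ge0 => w _; rewrite lee_fin sqr_ge0.
Qed.

Let charf_X_ge y r : 0 <= r -> 1 - r * M y <= charf P X (Num.sqrt r *: y).
Proof.
move=> r0; have := @one_sub_charf_le _ _ _ P _ _ mX (Num.sqrt r *: y).
under eq_integral do rewrite dotvZl exprMn sqr_sqrtr// EFinM.
rewrite ge0_integralZl_EFin//.
- rewrite MX -!EFinM lee_fin; lra.
- by move=> w _; rewrite lee_fin sqr_ge0.
- by apply/measurable_EFinP; apply: measurable_funX; exact: measurable_dotv.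
Qed.

Let h y r := charf P X (Num.sqrt r *: y).

Let h0 y : h y 0 = 1.
Proof. by rewrite /h sqrtr0 scale0r charf0. Qed.

Lemma charf_S_ge y : expR (- M y) <= charf P S y.
Proof.
rewrite charf_S; apply: (@log_convex_prod_ge _ (h y)) => //.
- exact: ch_logconvex.
- by move=> r; exact: ch_ge0.
- by move=> r; exact: charf_X_ge.
Qed.

Lemma charf_S_le y : charf P S y <= charf P X y.
Proof.
have h1 : charf P X y = h y 1 by rewrite /h sqrtr1 scale1r.
rewrite charf_S h1.
apply: (@log_convex_prod_le _ (h y)) => //.
  exact: ch_logconvex.
  by move=> r; exact: ch_ge0.
apply: (@lt_le_trans _ _ (expR (- (1 * M y)))); first exact: expR_gt0.
apply: (@log_convex_ge_exp _ (h y)) => //.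
  exact: ch_logconvex.
  by move=> r; exact: ch_ge0.
by move=> r; exact: charf_X_ge.
Qed.

(** Z and X have the same covariance and are centered, so E <y, Z>^2 = E <y, X>^2 *)
Lemma charf_gaussian_le_S (dT' : measure_display) (T' : measurableType dT')
    (P' : probability T' R) (Z : {RV P' >-> 'rV[R]_d}) y :
  centered_gaussian Z -> (forall i j, cov P' Z i j = cov P X i j) ->
  charf P' Z y <= charf P S y.
Proof.
move=> gZ covE; apply: le_trans (charf_S_ge y).
have mZ : measurable_fun setT Z by exact: measurable_funPT.
have [_ /le_trans] := centered_gaussian_charf gZ y; apply.
rewrite second_moment_cov//; last 2 first.
- by move=> z; have [] := centered_gaussian_charf gZ z.
- by move=> z; exact: centered_gaussian_charfi.
under eq_bigr do under eq_bigr do rewrite covE.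
by rewrite -second_moment_cov// => z; exact: charfi_density_eq0.
Qed.

End comparison.

(** * Moments of order between 0 and 2 *)

Section tonelli_dom.
Context d1 d2 (T1 : measurableType d1) (T2 : measurableType d2) (R : realType).
Variables (m1 : {sigma_finite_measure set T1 -> \bar R})
  (m2 : {sigma_finite_measure set T2 -> \bar R}).
Variables (D : set T2) (f : T1 * T2 -> \bar R).
Hypotheses (mD : measurable D) (mf : measurable_fun setT f)
  (f0 : forall z, (0 <= f z)%E).
Local Open Scope ereal_scope.

Let g (z : T1 * T2) := f z * (\1_D z.2)%:E.

Let g0 z : 0 <= g z.
Proof. by rewrite mule_ge0// lee_fin. Qed.

Let mg : measurable_fun setT g.
Proof.
apply: emeasurable_funM => //; apply/measurable_EFinP.
by apply: (measurableT_comp (measurable_indic mD)); exact: measurable_snd.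
Qed.

Let gE x : \int[m2]_(y in D) f (x, y) = \int[m2]_y g (x, y).
Proof.
by rewrite [LHS]integral_mkcond; apply: eq_integral => y _; rewrite /g epatch_indic.
Qed.

Lemma measurable_fun_integral_dom :
  measurable_fun setT (fun x => \int[m2]_(y in D) f (x, y)).
Proof. by under eq_fun do rewrite gE; exact: measurable_fun_fubini_tonelli_F. Qed.

Lemma tonelli_dom :
  \int[m1]_x \int[m2]_(y in D) f (x, y) = \int[m2]_(y in D) \int[m1]_x f (x, y).
Proof.
under eq_integral do rewrite gE.
rewrite (@fubini_tonelli _ _ _ _ _ m1 m2 g mg g0) [RHS]integral_mkcond.
apply: eq_integral => y _.
rewrite epatch_indic /g /= -ge0_integralZr//.
exact: measurableT_comp.
Qed.

End tonelli_dom.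

Section charf_moment.
Context (R : realType) (d : nat) (p : R).
Hypothesis p02 : 0 < p < 2.

Let kernel_meas dT (T : measurableType dT) (W : T -> 'rV[R]_d) (y : 'rV[R]_d) :
  measurable_fun setT W ->
  measurable_fun setT (fun z : T * measurableTypeR R =>
    ((1 - cos (dotv y (W z.1) * z.2)) * z.2 `^ (- p - 1))%:E).
Proof.
move=> mW; apply/measurable_EFinP; apply: measurable_funM; last first.
  by apply: (measurableT_comp (measurable_powR _)); exact: measurable_snd.
apply: measurable_funB => //; apply: measurable_fun_cos; apply: measurable_funM.
  by apply: (measurableT_comp (measurable_dotv y mW)); exact: measurable_fst.
exact: measurable_snd.
Qed.

Let kernel_ge0 (r s : R) : (0 <= ((1 - cos r) * s `^ (- p - 1))%:E)%E.
Proof. by rewrite lee_fin mulr_ge0 ?powR_ge0 ?one_sub_cos_ge0. Qed.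

Let kernel_charf dT (T : measurableType dT) (P : probability T R)
    (W : T -> 'rV[R]_d) y s : measurable_fun setT W ->
  (\int[P]_w ((1 - cos (dotv y (W w) * s)) * s `^ (- p - 1))%:E =
   ((1 - charf P W (s *: y)) * s `^ (- p - 1))%:E)%E.
Proof.
move=> mW; under eq_integral do rewrite EFinM.
rewrite ge0_integralZr//.
- rewrite EFinM -integral_one_sub_cos//; congr (_ * _)%E.
  by apply: eq_integral => w _; rewrite dotvZl mulrC.
- apply/measurable_EFinP; apply: measurable_funB => //.
  by apply: measurable_fun_cos; apply: measurable_funM => //; exact: measurable_dotv.
- by rewrite lee_fin powR_ge0.
Qed.

Lemma moment_charf dT (T : measurableType dT) (P : probability T R)
    (W : T -> 'rV[R]_d) y : measurable_fun setT W ->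
  (\int[P]_w (\int[lebesgue_measure]_(s in `]0%R, +oo[)
     ((1 - cos (dotv y (W w) * s)) * s `^ (- p - 1))%:E) =
  \int[lebesgue_measure]_(s in `]0%R, +oo[)
     ((1 - charf P W (s *: y)) * s `^ (- p - 1))%:E)%E.
Proof.
move=> mW.
rewrite (@tonelli_dom _ _ T (measurableTypeR R) R P lebesgue_measure `]0%R, +oo[
  (fun z => ((1 - cos (dotv y (W z.1) * z.2)) * z.2 `^ (- p - 1))%:E))//.
- by apply: eq_integral => s _ /=; exact: kernel_charf.
- exact: kernel_meas.
Qed.

(** moments of order p in (0,2) decrease when the characteristic function
increases *)
Lemma le_moment_charf dT1 (T1 : measurableType dT1) (P1 : probability T1 R)
    dT2 (T2 : measurableType dT2) (P2 : probability T2 R)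
    (U : T1 -> 'rV[R]_d) (V : T2 -> 'rV[R]_d) :
  measurable_fun setT U -> measurable_fun setT V ->
  (forall y, charf P1 U y <= charf P2 V y) -> forall y,
  (\int[P2]_w (`|dotv y (V w)| `^ p)%:E <= \int[P1]_w (`|dotv y (U w)| `^ p)%:E)%E.
Proof.
move=> mU mV UV y; have [C C0 HC] := powR_integral_cos p02.
have mpow dT (T : measurableType dT) (W : T -> 'rV[R]_d) : measurable_fun setT W ->
    measurable_fun setT (fun w => (`|dotv y (W w)| `^ p)%:E).
  move=> mW; apply/measurable_EFinP; apply: (measurableT_comp (measurable_powR p)).
  by apply: measurableT_comp => //; exact: measurable_dotv.
have E dT (T : measurableType dT) (P : probability T R) (W : T -> 'rV[R]_d) :
    measurable_fun setT W ->
    (\int[P]_w (`|dotv y (W w)| `^ p)%:E = (C^-1)%:E *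
     \int[lebesgue_measure]_(s in `]0%R, +oo[)
       ((1 - charf P W (s *: y)) * s `^ (- p - 1))%:E)%E.
  move=> mW; rewrite -moment_charf//.
  under [in RHS]eq_integral do rewrite HC EFinM.
  rewrite ge0_integralZl_EFin ?(ltW C0)//.
  - by rewrite muleA -EFinM mulVf ?mul1e// gt_eqF.
  - exact: mpow.
rewrite !E//; apply: lee_wpmul2l; first by rewrite lee_fin invr_ge0 ltW.
have mch dT (T : measurableType dT) (P : probability T R) (W : T -> 'rV[R]_d) :
    measurable_fun setT W -> measurable_fun setT
    (fun s : measurableTypeR R => ((1 - charf P W (s *: y)) * s `^ (- p - 1))%:E).
  move=> mW; under eq_fun do rewrite -kernel_charf//.
  apply: (@measurable_fun_fubini_tonelli_G _ _ T (measurableTypeR R) R P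
    (fun z => ((1 - cos (dotv y (W z.1) * z.2)) * z.2 `^ (- p - 1))%:E)).
    exact: kernel_meas.
  by move=> z; exact: kernel_ge0.
apply: ge0_le_integral => //.
- by move=> s _; rewrite lee_fin mulr_ge0 ?powR_ge0 ?subr_ge0 ?charf_le1.
- by apply: measurable_funTS; exact: mch.
- by apply: measurable_funTS; exact: mch.
- by move=> s _; rewrite lee_fin ler_wpM2r ?powR_ge0// lerD2l lerN2.
Qed.

End charf_moment.

Section embeds_Lp.
Context (R : realType) (d : nat) (p : R) (N : 'rV[R]_d -> R).
Hypotheses (p02 : 0 < p < 2) (N_ge0 : forall x, 0 <= N x).
Notation mu := (@lebesgue_measure R).

(** a norm embedded in L_p is given by the p-th absolute moments of the linear
forms of a random vector on the unit interval *)
Lemma embeds_Lp_dotv : embeds_Lp p N ->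
  exists2 Y : measurableTypeR R -> 'rV[R]_d, measurable_fun setT Y &
  forall x, (\int[mu]_(t in `[0%R, 1%R]) (`|dotv x (Y t)| `^ p)%:E = (N x `^ p)%:E)%E.
Proof.
move=> [S [S_lin S_norm]].
(* the coordinates of Y are the images of the basis vectors *)
pose Y (t : measurableTypeR R) : 'rV[R]_d := \row_i S (delta_mx 0 i) t.
have mS x : measurable_fun setT (S x : measurableTypeR R -> R).
  by have H := @measurable_funPT _ _ _ _ (S x); exact: H.
have mY : measurable_fun setT Y.
  apply/measurable_fun_rVP => i.
  by under eq_fun do rewrite mxE; exact: mS.
exists Y => // x.
have S0 : {ae mu, forall t : R, 0 <= t <= 1 -> S 0 t = 0}.
  have := S_lin 1 0 0; apply: (@filterS _ _ (ae_filter_ringOfSetsType mu)) => t /[apply].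
  by rewrite scale1r addr0 mul1r => E; lra.
have SE (s : seq 'I_d) : {ae mu, forall t : R, 0 <= t <= 1 ->
    S (\sum_(i <- s) x 0 i *: delta_mx 0 i) t = \sum_(i <- s) x 0 i * Y t 0 i}.
  elim: s => [|i s IH].
    by move: S0; apply: (@filterS _ _ (ae_filter_ringOfSetsType mu)) => t /[apply]; rewrite !big_nil.
  have := S_lin (x 0 i) (delta_mx 0 i) (\sum_(j <- s) x 0 j *: delta_mx 0 j).
  move: IH; apply: (@filterS2 _ _ (ae_filter_ringOfSetsType mu)) => t IH Hl t01.
  by rewrite !big_cons Hl// IH// mxE.
have Sx : {ae mu, forall t : R, 0 <= t <= 1 -> S x t = dotv x (Y t)}.
  by have := SE (index_enum 'I_d); rewrite -row_sum_delta.
have -> : (\int[mu]_(t in `[0%R, 1%R]) (`|dotv x (Y t)| `^ p)%:E =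
    \int[mu]_(t in `[0%R, 1%R]) (`|S x t| `^ p)%:E)%E.
  apply: ge0_ae_eq_integral => //.
  - apply/measurable_EFinP; apply: measurable_funTS.
    apply: (measurableT_comp (measurable_powR p)).
    by apply: measurableT_comp => //; exact: measurable_dotv.
  - apply/measurable_EFinP; apply: measurable_funTS.
    apply: (measurableT_comp (measurable_powR p)).
    by apply: measurableT_comp => //; exact: mS.
  - by move: Sx; apply: (@filterS _ _ (ae_filter_ringOfSetsType mu)) => t H /=; rewrite in_itv/= => /H ->.
set I := (\int[mu]_(t in `[0%R, 1%R]) _)%E.
have I0 : (0 <= I)%E by apply: integral_ge0 => t _; rewrite lee_fin powR_ge0.
have := S_norm x; rewrite -/I => H.
have p0 : p != 0 by case/andP: p02 => p0 _; rewrite gt_eqF.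
have : ((I `^ p^-1) `^ p = (N x)%:E `^ p)%E by rewrite H.
by rewrite -poweRrM mulVf// poweRe1.
Qed.

(** averaging le_moment_charf over the embedding *)
Lemma le_norm_moment_charf dT1 (T1 : measurableType dT1) (P1 : probability T1 R)
    dT2 (T2 : measurableType dT2) (P2 : probability T2 R)
    (U : T1 -> 'rV[R]_d) (V : T2 -> 'rV[R]_d) :
  embeds_Lp p N -> measurable_fun setT U -> measurable_fun setT V ->
  (forall y, charf P1 U y <= charf P2 V y) ->
  (\int[P2]_w (N (V w) `^ p)%:E <= \int[P1]_w (N (U w) `^ p)%:E)%E.
Proof.
move=> /embeds_Lp_dotv[Y mY HY] mU mV UV.
have mker dT (T : measurableType dT) (W : T -> 'rV[R]_d) : measurable_fun setT W ->
    measurable_fun setT (fun z : T * measurableTypeR R =>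
      (`|dotv (W z.1) (Y z.2)| `^ p)%:E).
  move=> mW; apply/measurable_EFinP; apply: (measurableT_comp (measurable_powR p)).
  apply: measurableT_comp => //; apply: measurable_fun_dotv.
    by apply: (measurableT_comp mW); exact: measurable_fst.
  by apply: (measurableT_comp mY); exact: measurable_snd.
have ker0 dT (T : measurableType dT) (W : T -> 'rV[R]_d) (z : T * measurableTypeR R) :
    (0 <= (`|dotv (W z.1) (Y z.2)| `^ p)%:E)%E by rewrite lee_fin powR_ge0.
have E dT (T : measurableType dT) (P : probability T R) (W : T -> 'rV[R]_d) :
    measurable_fun setT W ->
    (\int[P]_w (N (W w) `^ p)%:E = \int[mu]_(t in `[0%R, 1%R])
       \int[P]_w (`|dotv (Y t) (W w)| `^ p)%:E)%E.
  move=> mW; under eq_integral do rewrite -HY.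
  have K := @tonelli_dom _ _ T (measurableTypeR R) R P mu `[0%R, 1%R]
    (fun z => (`|dotv (W z.1) (Y z.2)| `^ p)%:E) (measurable_itv _) (mker _ _ _ mW)
    (@ker0 _ _ W).
  rewrite {}K; apply: eq_integral => t _; apply: eq_integral => w _.
  by rewrite dotvC.
rewrite !E//.
have mint dT (T : measurableType dT) (P : probability T R) (W : T -> 'rV[R]_d) :
    measurable_fun setT W -> measurable_fun setT (fun t : measurableTypeR R =>
       \int[P]_w (`|dotv (Y t) (W w)| `^ p)%:E)%E.
  move=> mW; under eq_fun do under eq_integral do rewrite dotvC.
  apply: (@measurable_fun_fubini_tonelli_G _ _ T (measurableTypeR R) R P
    (fun z => (`|dotv (W z.1) (Y z.2)| `^ p)%:E)).
    exact: mker.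
  by move=> z; exact: ker0.
apply: ge0_le_integral => //.
- by move=> t _; apply: integral_ge0 => w _; rewrite lee_fin powR_ge0.
- by apply: measurable_funTS; exact: mint.
- by apply: measurable_funTS; exact: mint.
- by move=> t _; exact: le_moment_charf.
Qed.

End embeds_Lp.

(** * Ellipsoids and norms of random vectors *)

Section ellipsoid.
Context {R : realType} {d : nat}.
Implicit Types x y : 'rV[R]_d.

Lemma enorm_ge0 x : 0 <= enorm x. Proof. exact: sqrtr_ge0. Qed.

Lemma enormZ (c : R) x : enorm (c *: x) = `|c| * enorm x.
Proof.
rewrite /enorm dotvZl dotvZr mulrA -expr2 sqrtrM ?sqr_ge0//.
by rewrite sqrtr_sqr.
Qed.

Lemma sqr_enorm x : enorm x ^+ 2 = dotv x x.
Proof. by rewrite sqr_sqrtr// dotvv_ge0. Qed.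

Lemma coord_le_enorm x i : `|x 0 i| <= enorm x.
Proof.
rewrite /enorm -sqrtr_sqr ler_sqrt; last by rewrite -sqr_enorm sqr_ge0.
rewrite /dotv (bigD1 i)//= expr2 lerDl; apply: sumr_ge0 => j _.
by rewrite -expr2 sqr_ge0.
Qed.

Lemma enorm_eq0 x : enorm x = 0 -> x = 0.
Proof.
move=> x0; have := sqr_enorm x; rewrite x0 expr0n/= => /esym/eqP.
rewrite psumr_eq0 => [/allP H|i _]; last by rewrite -expr2 sqr_ge0.
apply/rowP => i; rewrite mxE; have := H i (mem_index_enum _).
by rewrite mulf_eq0 orbb => /eqP.
Qed.

Lemma gauge_ellipsoid (A : 'M[R]_d) x : A \in unitmx ->
  gauge ((fun x => x *m A) @` [set x | enorm x <= 1]) x = enorm (x *m invmx A).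
Proof.
move=> uA; rewrite /gauge; set e := enorm _.
set L := [set lam | _].
have LE lam : L lam <-> 0 < lam /\ e <= lam.
  split=> -[l0].
    move=> [y [u /= u1 <-] xE]; split=> //.
    rewrite /e xE -scalemxAl mulmxK// enormZ gtr0_norm// ler_piMr// ltW//.
  move=> el; split=> //; exists ((lam^-1 *: (x *m invmx A)) *m A).
    exists (lam^-1 *: (x *m invmx A)) => //=.
    by rewrite enormZ gtr0_norm ?invr_gt0// mulrC ler_pdivrMr// mul1r.
  by rewrite -scalemxAl mulmxKV// scalerA divff ?scale1r// gt_eqF.
apply/eqP; rewrite eq_le; apply/andP; split.
  apply/ler_addgt0Pr => eps eps0; apply: ge_inf.
    by exists 0 => lam /LE[/ltW].
  by apply/LE; split; [rewrite ltr_wpDl// enorm_ge0|rewrite lerDl ltW].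
apply: lb_le_inf; first by exists (e + 1); apply/LE; split; [rewrite ltr_wpDl// enorm_ge0|rewrite lerDl].
by move=> lam /LE[].
Qed.

End ellipsoid.

Section knorm.
Context {R : realType} {d : nat}.
Local Open Scope ereal_scope.

Lemma epow_pos (x : \bar R) (p : R) : (0 <= p)%R -> epow x p = x `^ p.
Proof. by move=> p0; rewrite /epow ltNge p0. Qed.

Lemma epow_neg (x : \bar R) (p : R) : (0 < p)%R -> epow x (- p)%R = (x `^ p)^-1.
Proof. by move=> p0; rewrite /epow oppr_lt0 p0 opprK. Qed.

Lemma epow_ge0 (x : \bar R) (p : R) : 0 <= epow x p.
Proof. by rewrite /epow; case: ifP => _; rewrite ?inve_ge0 poweR_ge0. Qed.

Context dT1 (T1 : measurableType dT1) (P1 : probability T1 R).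
Context dT2 (T2 : measurableType dT2) (P2 : probability T2 R).
Variables (K : set 'rV[R]_d) (U : T1 -> 'rV[R]_d) (V : T2 -> 'rV[R]_d).

Let moment_ge0 dT (T : measurableType dT) (P : probability T R) (W : T -> 'rV[R]_d) p :
  0 <= moment P K p W.
Proof. by apply: integral_ge0 => w _; exact: epow_ge0. Qed.

Lemma le_knorm_pos p : (0 < p)%R -> moment P1 K p U <= moment P2 K p V ->
  knorm P1 K p U <= knorm P2 K p V.
Proof.
move=> p0 H; rewrite /knorm !epow_pos ?invr_ge0 ?(ltW p0)//.
apply: gt0_ler_poweR => //; first by rewrite invr_ge0 ltW.
  by rewrite in_itv/= leey moment_ge0.
by rewrite in_itv/= leey moment_ge0.
Qed.

(** the exponent -1/l reverses the order *)
Lemma le_knorm_neg l : (0 < l)%R -> moment P1 K (- l) U <= moment P2 K (- l) V ->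
  knorm P2 K (- l) V <= knorm P1 K (- l) U.
Proof.
move=> l0 H; rewrite /knorm invrN !epow_neg ?invr_gt0//.
rewrite lee_pV2 ?inE ?poweR_ge0//.
apply: gt0_ler_poweR => //; first by rewrite invr_ge0 ltW.
  by rewrite in_itv/= leey moment_ge0.
by rewrite in_itv/= leey moment_ge0.
Qed.

End knorm.

Section ellipsoid_moment.
Context {R : realType} {d : nat}.
Context dT (T : measurableType dT) (P : probability T R) (W : T -> 'rV[R]_d).
Hypothesis mW : measurable_fun setT W.

(** the squared ellipsoid norm is a sum of squares of linear forms *)
Lemma moment_ellipsoid (E : set 'rV[R]_d) (A : 'M[R]_d) : A \in unitmx ->
  E = (fun x => x *m A) @` [set x | enorm x <= 1] ->
  moment P E 2 W =
  (\sum_(j < d) \int[P]_w (dotv (\row_k invmx A k j) (W w) ^+ 2)%:E)%E.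
Proof.
move=> uA ->; rewrite /moment -ge0_integral_sum//.
- apply: eq_integral => w _.
  rewrite epow_pos// gauge_ellipsoid// poweR_EFin.
  rewrite powR_mulrn ?enorm_ge0// sqr_enorm sumEFin; congr EFin.
  apply: eq_bigr => j _; rewrite -expr2; congr (_ ^+ 2).
  by rewrite mxE; apply: eq_bigr => k _; rewrite mxE mulrC.
- by move=> j; apply/measurable_EFinP; apply: measurable_funX; exact: measurable_dotv.
- by move=> j w _; rewrite lee_fin sqr_ge0.
Qed.

End ellipsoid_moment.

Section knorm_ellipsoid.
Context {R : realType} {d : nat}.

Lemma measurable_rV_set1 (x : 'rV[R]_d) : measurable [set x].
Proof.
rewrite (_ : [set x] = \bigcap_(i in [set: 'I_d])
    ((fun y : 'rV[R]_d => y 0 i) @^-1` [set x 0 i])); last first.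
  apply/seteqP; split=> [y -> //|y H].
  by apply/rowP => i; exact: (H i I).
apply: fin_bigcap_measurable => // i _.
by rewrite -[X in measurable X]setTI; apply: measurable_rV_coord => //; exact: measurable_set1.
Qed.

Lemma lebesgue_rV_set1 (x : 'rV[R]_d) : (0 < d)%N -> lebesgue_rV d [set x] = 0%E.
Proof.
move=> d0.
rewrite (_ : [set x] = [set y | forall i, [set x 0 i] (y 0 i)]); last first.
  by apply/seteqP; split=> [y -> //|y H]; apply/rowP => i; exact: H.
rewrite (@lebesgue_rV_rectangle R d (fun i => [set x 0 i])).
  by case: d d0 x => // d' _ x; rewrite big_ord_recl lebesgue_measure_set1 mul0e.
by move=> i; exact: measurable_set1.
Qed.

Context dT (T : measurableType dT) (P : probability T R).
Context (X : {RV P >-> 'rV[R]_d}) (phi : 'rV[R]_d -> R).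
Hypotheses (mphi : measurable_fun setT phi) (X_law : has_density X phi).

Lemma density_set1 (x : 'rV[R]_d) : (0 < d)%N -> P (X @^-1` [set x]) = 0%E.
Proof.
move=> d0; rewrite -[LHS]/(distribution P X [set x]) X_law; last exact: measurable_rV_set1.
apply: null_set_integral; first exact: measurable_rV_set1.
  by apply/measurable_EFinP; exact: measurable_funTS.
exact: lebesgue_rV_set1.
Qed.

Variable E : set 'rV[R]_d.
Hypotheses (E_ellipsoid : ellipsoid E).
Hypothesis X2 : forall y, (\int[P]_w (dotv y (X w) ^+ 2)%:E < +oo)%E.

Lemma knorm_ellipsoid_gt0_fin : (0 < d)%N ->
  (0 < knorm P E 2 X)%E /\ knorm P E 2 X \is a fin_num.
Proof.
move=> d0; have [A uA EE] := E_ellipsoid.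
have mX : measurable_fun setT X by exact: measurable_funPT.
have mfin : moment P E 2 X \is a fin_num.
  rewrite (moment_ellipsoid P mX uA EE); apply/sum_fin_numP => j _ _.
  rewrite ge0_fin_numE//; apply: integral_ge0 => w _.
  by rewrite lee_fin sqr_ge0.
have mgt0 : (0 < moment P E 2 X)%E.
  rewrite lt_neqAle; apply/andP; split; last first.
    by apply: integral_ge0 => w _; exact: epow_ge0.
  apply/eqP => m0.
  have mE : moment P E 2 X = (\int[P]_w (enorm (X w *m invmx A) ^+ 2)%:E)%E.
    apply: eq_integral => w _.
    by rewrite epow_pos// EE gauge_ellipsoid// poweR_EFin powR_mulrn ?enorm_ge0.
  have mXA : measurable_fun setT (fun w => X w *m invmx A).
    apply/measurable_fun_rVP => i.
    under eq_fun do rewrite mxE.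
    apply: measurable_sum => j; apply: measurable_funM => //.
    by have /measurable_fun_rVP := mX; exact.
  have mf : measurable_fun setT (fun w => (enorm (X w *m invmx A) ^+ 2)%:E).
    by apply/measurable_EFinP; apply: measurable_funX; exact: measurable_fun_enorm.
  have : (\int[P]_w `|(enorm (X w *m invmx A) ^+ 2)%:E| = 0)%E.
    by rewrite m0 mE; apply: eq_integral => w _; rewrite gee0_abs// lee_fin sqr_ge0.
  move=> /(ae_eq_integral_abs P measurableT mf).1 [N [mN N0 NS]].
  have : (P setT <= P (X @^-1` [set 0%R]) + P N)%E.
    apply: (@le_trans _ _ (P (X @^-1` [set 0%R] `|` N))); last first.
      apply: measureU2 => //.
      by rewrite -[X in measurable X]setTI; apply: mX => //; exact: measurable_rV_set1.
    apply: le_measure; rewrite ?inE//.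
      apply: measurableU => //.
      by rewrite -[X in measurable X]setTI; apply: mX => //; exact: measurable_rV_set1.
    move=> w _; case: (pselect (X w = 0)) => X0; [by left|right].
    apply: NS => /= H; apply: X0; have := H I => -[] /eqP.
    rewrite sqrf_eq0 => /eqP /enorm_eq0 XA0.
    by rewrite -[LHS](mulmxKV uA) XA0 mul0mx.
  have e1 : P (X @^-1` [set 0%R]) = 0%E by exact: density_set1.
  have e2 : P setT = 1%E by exact: probability_setT.
  by rewrite [X in (X <= _)%E]e2 e1 N0 adde0 lee_fin ler10.
rewrite /knorm epow_pos ?invr_ge0//; split.
  by rewrite poweR_gt0.
by rewrite fin_num_poweR.
Qed.

End knorm_ellipsoid.

Lemma divVeK {R : realType} (x y : \bar R) : (0 < y)%E -> y \is a fin_num ->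
  (x / y * y)%E = x.
Proof. by move=> y0 yf; rewrite -muleA mulVe ?mule1// gt_eqF. Qed.

(** * Gaussian test functions are Schwartz functions *)

Section polynomial_functions.
Context {R : realType} {d : nat}.
Implicit Types (p q : 'rV[R]_d -> R) (x w : 'rV[R]_d).

(** polynomial functions of the coordinates *)
Inductive polyfun : ('rV[R]_d -> R) -> Prop :=
| polyfun_cst c : polyfun (fun=> c)
| polyfun_coord i : polyfun (fun x => x 0 i)
| polyfunD p q : polyfun p -> polyfun q -> polyfun (fun x => p x + q x)
| polyfunM p q : polyfun p -> polyfun q -> polyfun (fun x => p x * q x).

Lemma derive_coord i (v x : 'rV[R]_d) : 'D_v (fun y : 'rV[R]_d => y 0 i) x = v 0 i.
Proof.
rewrite /derive; apply: cvg_lim => //; apply: cvg_near_cst; near=> h.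
rewrite /= !mxE addrK /GRing.scale/= mulrA mulVf ?mul1r//.
by near: h; exact: nbhs_dnbhs_neq.
Unshelve. all: by end_near. Qed.

Lemma polyfun_diff p : polyfun p -> forall x, differentiable p x.
Proof.
elim=> [c|i|p1 q1 _ IHp _ IHq|p1 q1 _ IHp _ IHq] x.
- exact: differentiable_cst.
- exact: differentiable_coord.
- exact: differentiableD.
- exact: differentiableM.
Qed.

Lemma polyfun_derive p v : polyfun p ->
  exists2 q, polyfun q & forall x, 'D_v p x = q x.
Proof.
elim=> [c|i|p1 q1 Pp [p1' Pp' Ep] Pq [q1' Pq' Eq]|p1 q1 Pp [p1' Pp' Ep] Pq [q1' Pq' Eq]].
- exists (fun=> 0); first exact: polyfun_cst.
  by move=> x; rewrite derive_cst.
- exists (fun=> v 0 i); first exact: polyfun_cst.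
  by move=> x; rewrite derive_coord.
- exists (fun x => p1' x + q1' x); first exact: polyfunD.
  move=> x; rewrite -Ep -Eq; apply: deriveD.
    exact/diff_derivable/polyfun_diff.
  exact/diff_derivable/polyfun_diff.
- exists (fun x => p1 x * q1' x + q1 x * p1' x).
    by apply: polyfunD; apply: polyfunM.
  move=> x; rewrite -Ep -Eq; apply: deriveM.
    exact/diff_derivable/polyfun_diff.
  exact/diff_derivable/polyfun_diff.
Qed.

Let l1 x : R := 1 + \sum_i `|x 0 i|.

Let l1_ge1 x : 1 <= l1 x.
Proof. by rewrite lerDl sumr_ge0. Qed.

(** polynomials are bounded by powers of 1 + the l1 norm *)
Lemma polyfun_growth p : polyfun p ->
  exists C, exists m, forall x, `|p x| <= C * l1 x ^+ m.
Proof.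
have E (C : R) k k' x : 0 <= C -> (k <= k')%N -> C * l1 x ^+ k <= C * l1 x ^+ k'.
  by move=> C0 kk; rewrite ler_wpM2l// ler_weXn2l.
elim=> [c|i|p1 q1 _ [C [m Hp]] _ [C' [m' Hq]]|p1 q1 _ [C [m Hp]] _ [C' [m' Hq]]].
- by exists `|c|, 0%N => x; rewrite expr0 mulr1.
- exists 1, 1%N => x; rewrite mul1r expr1 /l1.
  rewrite (bigD1 i)//= addrCA lerDl addr_ge0// sumr_ge0//.
- exists (`|C| + `|C'|), (m + m')%N => x; rewrite mulrDl (le_trans (ler_normD _ _))// lerD//.
    rewrite (le_trans (Hp x))// (le_trans _ (E _ m _ x _ _)) ?leq_addr//.
    by rewrite ler_wpM2r ?ler_norm// exprn_ge0// (le_trans ler01).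
  rewrite (le_trans (Hq x))// (le_trans _ (E _ m' _ x _ _)) ?leq_addl//.
  by rewrite ler_wpM2r ?ler_norm// exprn_ge0// (le_trans ler01).
- exists (`|C| * `|C'|), (m + m')%N => x; rewrite normrM exprD mulrACA.
  apply: ler_pM => //.
    rewrite (le_trans (Hp x))// ler_wpM2r ?ler_norm//.
    by rewrite exprn_ge0// (le_trans ler01).
  rewrite (le_trans (Hq x))// ler_wpM2r ?ler_norm//.
  by rewrite exprn_ge0// (le_trans ler01).
Qed.

Variable b : R.
Hypothesis b0 : 0 < b.

(** the unnormalized Gaussian x |-> exp (- b |x - w|^2) *)
Definition gaussf w x : R := expR (- b * dotv (x - w) (x - w)).

Lemma polyfun_sum (I : Type) (s : seq I) (f : I -> 'rV[R]_d -> R) :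
  (forall i, polyfun (f i)) -> polyfun (fun x => \sum_(i <- s) f i x).
Proof.
move=> H; elim: s => [|i s IH].
  by under eq_fun do rewrite big_nil; exact: polyfun_cst.
by under eq_fun do rewrite big_cons; exact: polyfunD.
Qed.

Let polyfun_exponent w : polyfun (fun x => - b * dotv (x - w) (x - w)).
Proof.
apply: polyfunM; first exact: polyfun_cst.
apply: polyfun_sum => i.
have H : polyfun (fun x => (x - w) 0 i).
  under eq_fun do rewrite !mxE.
  by apply: polyfunD; [exact: polyfun_coord|exact: polyfun_cst].
exact: polyfunM.
Qed.

Lemma gaussf_diff w x : differentiable (gaussf w) x.
Proof.
apply: (@differentiable_comp _ _ _ _ (fun x => - b * dotv (x - w) (x - w)) expR).
  exact: polyfun_diff.
by apply/derivable1_diffP; exact: derivable_expR.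
Qed.

Lemma gaussf_derive w v : exists2 q, polyfun q &
  forall x, 'D_v (gaussf w) x = q x * gaussf w x.
Proof.
have [q Pq Eq] := polyfun_derive v (polyfun_exponent w).
exists q => // x.
have dp := polyfun_diff (polyfun_exponent w) x.
set p := (fun x : 'rV[R]_d => _) in dp Eq.
have de : differentiable (@expR R) (p x).
  by apply/derivable1_diffP; exact: derivable_expR.
rewrite deriveE; last exact: gaussf_diff.
have -> : gaussf w = expR \o p by [].
rewrite diff_comp//= diff1E//= -deriveE// Eq.
by rewrite derive1E derive_val.
Qed.

Let enorm_l1 x : enorm x <= l1 x.
Proof.
have S0 : 0 <= \sum_i `|x 0 i| by exact: sumr_ge0.
have -> : l1 x = Num.sqrt (l1 x ^+ 2) by rewrite sqrtr_sqr ger0_norm// (le_trans ler01).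
rewrite /enorm ler_sqrt ?sqr_ge0//.
apply: (@le_trans _ _ ((\sum_i `|x 0 i|) ^+ 2)); last first.
  by rewrite ler_sqr ?nnegrE// ?(le_trans ler01)// lerDr.
rewrite expr2 mulr_sumr; apply: ler_sum => i _.
rewrite (le_trans (ler_norm _))// normrM ler_wpM2r//.
by rewrite (bigD1 i)//= lerDl sumr_ge0.
Qed.

(** from r^2 >= 2 r - 1 and y^n <= n! exp y *)
Lemma pow_gauss (n : nat) (r : R) : 0 <= r ->
  (1 + r) ^+ n * expR (- b * r ^+ 2) <= expR (3 * b) * (n`!%:R / (2 * b) ^+ n).
Proof.
move=> r0.
have e1 : expR (- b * r ^+ 2) <= expR (3 * b) * expR (- (2 * b * (1 + r))).
  rewrite -expRD ler_expR.
  have : 0 <= b * (r - 1) ^+ 2 by rewrite mulr_ge0 ?sqr_ge0 ?(ltW b0).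
  have -> : b * (r - 1) ^+ 2 = b * r ^+ 2 - 2 * b * r + b by ring.
  lra.
have c0 : 0 < 2 * b by rewrite mulr_gt0.
have e2 : (2 * b * (1 + r)) ^+ n <= n`!%:R * expR (2 * b * (1 + r)).
  have : 0 <= 2 * b * (1 + r) by rewrite mulr_ge0 ?(ltW c0)// addr_ge0.
  move: (2 * b * (1 + r)) => y y0.
  case: n => [|n]; first by rewrite expr0 fact0 mul1r -expR0 ler_expR.
  have := expR_ge1Dxn n y0.
  move=> h; rewrite -ler_pdivrMl ?ltr0n ?fact_gt0// mulrC (le_trans _ h)//.
  by rewrite lerDr.
have e3 : (1 + r) ^+ n * expR (- (2 * b * (1 + r))) <= n`!%:R / (2 * b) ^+ n.
  rewrite expRN ler_pdivrMr ?expR_gt0// mulrAC ler_pdivlMr ?exprn_gt0//.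
  by rewrite mulrC -exprMn.
rewrite (le_trans (ler_wpM2l _ e1)) ?exprn_ge0 ?addr_ge0//.
by rewrite mulrCA ler_wpM2l// expR_ge0.
Qed.

Lemma gaussf_decay w p : polyfun p ->
  forall k : nat, exists C, forall x, enorm x ^+ k * `|p x * gaussf w x| <= C.
Proof.
move=> Pp k; have [C [m Hp]] := polyfun_growth Pp.
pose A := 1 + \sum_i `|w 0 i| + d%:R.
have A0 : 0 <= A by rewrite !addr_ge0// sumr_ge0.
have l1A x : l1 x <= A * (1 + enorm (x - w)).
  have e0 := enorm_ge0 (x - w).
  have : \sum_i `|x 0 i| <= \sum_i (`|w 0 i| + enorm (x - w)).
    apply: ler_sum => i _.
    rewrite addrC -lerBlDr (le_trans _ (coord_le_enorm _ i))// !mxE.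
    exact: lerB_dist.
  rewrite big_split/= sumr_const card_ord -mulr_natl => h.
  have s0 : 0 <= \sum_i `|w 0 i| by exact: sumr_ge0.
  have d0 : 0 <= d%:R :> R by [].
  rewrite /l1 /A; nra.
exists (`|C| * A ^+ (k + m) * (expR (3 * b) * ((k + m)`!%:R / (2 * b) ^+ (k + m)))) => x.
have g0 : 0 <= gaussf w x by exact: expR_ge0.
rewrite normrM (ger0_norm g0).
have p1 : `|p x| <= `|C| * l1 x ^+ m.
  rewrite (le_trans (Hp x))// ler_wpM2r ?ler_norm//.
  by rewrite exprn_ge0// (le_trans ler01).
have l0 : 0 <= l1 x by rewrite (le_trans ler01).
apply: (@le_trans _ _ (`|C| * l1 x ^+ (k + m) * gaussf w x)).
  rewrite mulrA ler_wpM2r// exprD mulrCA ler_pM ?exprn_ge0 ?enorm_ge0//.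
  by rewrite lerXn2r ?nnegrE ?enorm_ge0.
rewrite -!mulrA ler_wpM2l//.
apply: le_trans (_ : A ^+ (k + m) * ((1 + enorm (x - w)) ^+ (k + m) * gaussf w x) <= _).
  rewrite mulrA ler_wpM2r// -exprMn lerXn2r ?nnegrE// mulr_ge0// addr_ge0//.
  exact: enorm_ge0.
rewrite ler_wpM2l ?exprn_ge0// /gaussf -sqr_enorm !mulrA.
by have := pow_gauss (k + m) (enorm_ge0 (x - w)); rewrite !mulrA.
Qed.

(** combinations of two Gaussians with polynomial coefficients: a class of rapidly
decreasing functions that is closed under partial derivatives *)
Let gauss_combi (w : 'rV[R]_d) (f : 'rV[R]_d -> R) :=
  exists p q, [/\ polyfun p, polyfun q &
    f = fun x => p x * gaussf w x + q x * gaussf (- w) x].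

Let gauss_combi_diff w f : gauss_combi w f -> forall x, differentiable f x.
Proof.
move=> [p [q [Pp Pq ->]]] x; apply: differentiableD.
  by apply: differentiableM; [exact: polyfun_diff|exact: gaussf_diff].
by apply: differentiableM; [exact: polyfun_diff|exact: gaussf_diff].
Qed.

Let gauss_combi_derive w f v : gauss_combi w f -> gauss_combi w ('D_v f).
Proof.
move=> [p [q [Pp Pq ->]]].
have M (p0 : 'rV[R]_d -> R) w0 : polyfun p0 ->
    forall x, differentiable (fun x => p0 x * gaussf w0 x) x.
  by move=> Pp0 x; apply: differentiableM; [exact: polyfun_diff|exact: gaussf_diff].
have D (p0 : 'rV[R]_d -> R) w0 : polyfun p0 -> exists2 p1, polyfun p1 &
    forall x, 'D_v (fun x => p0 x * gaussf w0 x) x = p1 x * gaussf w0 x.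
  move=> Pp0; have [p' Pp' Ep] := polyfun_derive v Pp0.
  have [q' Pq' Eq] := gaussf_derive w0 v.
  exists (fun x => p0 x * q' x + p' x).
    by apply: polyfunD => //; exact: polyfunM.
  move=> x; rewrite (@deriveM _ _ p0 (gaussf w0)).
  - by rewrite Ep Eq; rewrite /GRing.scale/=; ring.
  - exact/diff_derivable/polyfun_diff.
  - exact/diff_derivable/gaussf_diff.
have [p' Pp' Ep] := D p w Pp; have [q' Pq' Eq] := D q (- w) Pq.
exists p', q'; split => //; apply/funext => x.
rewrite -Ep -Eq; apply: deriveD; apply: diff_derivable; exact: M.
Qed.

Lemma schwartz_real0 : schwartz_real ((fun=> 0) : 'rV[R]_d -> R).
Proof.
move=> s; have -> : partials s ((fun=> 0) : 'rV[R]_d -> R) = (fun=> 0).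
  elim: s => [//|i s IH] /=; rewrite IH.
  by apply/funext => x; rewrite derive_cst.
split=> [x|k]; first exact: differentiable_cst.
by exists 0 => x; rewrite normr0 mulr0.
Qed.

Lemma schwartz_gauss_pair w (c : R) :
  schwartz (fun x => real_complex R (c * gaussf w x + c * gaussf (- w) x)).
Proof.
split; last exact: schwartz_real0.
move=> s; rewrite /=.
have H : gauss_combi w (partials s (fun x => c * gaussf w x + c * gaussf (- w) x)).
  elim: s => [|i s IH] /=; last exact: gauss_combi_derive.
  exists (fun=> c), (fun=> c); split => //; exact: polyfun_cst.
split; first exact: gauss_combi_diff H.
move: H => [p [q [Pp Pq ->]]] k.
have [C HC] := gaussf_decay w Pp k; have [C' HC'] := gaussf_decay (- w) Pq k.
exists (C + C') => x; rewrite (le_trans _ (lerD (HC x) (HC' x)))//.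
by rewrite -mulrDr ler_wpM2l ?ler_normD// exprn_ge0// enorm_ge0.
Qed.

Lemma gaussf_opp w x : gaussf w (- x) = gaussf (- w) x.
Proof.
rewrite /gaussf; congr (expR (_ * _)); rewrite /dotv; apply: eq_bigr => i _.
by rewrite !mxE; ring.
Qed.

End polynomial_functions.

(** * Integration over R^d and Gaussian kernels *)

Section lebesgue_rV_integral.
Context {R : realType}.
Local Open Scope ereal_scope.

Lemma ge0_integral_lebesgue_rVS n (f : 'rV[R]_n.+1 -> \bar R) :
  measurable_fun setT f -> (forall x, 0 <= f x) ->
  \int[lebesgue_rV n.+1]_x f x =
  \int[lebesgue_measure]_t \int[lebesgue_rV n]_v f (cons_rV (t, v)).
Proof.
move=> mf f0.
have mfc : measurable_fun setT (f \o @cons_rV R n).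
  by apply: measurableT_comp => //; exact: measurable_cons_rV.
have K := @ge0_integral_pushforward _ _ (measurableTypeR R * 'rV[R]_n)%type _ R _ (@measurable_cons_rV R n)
  (lebesgue_measure \x lebesgue_rV n) setT f measurableT mf (fun y _ => f0 y).
apply: eq_trans K _.
have K2 := @fubini_tonelli1 _ _ (measurableTypeR R) _ R lebesgue_measure (lebesgue_rV n)
  (f \o @cons_rV R n) mfc (fun z => f0 _).
exact: K2.
Qed.

Lemma integral_lebesgue_rVS n (f : 'rV[R]_n.+1 -> \bar R) :
  (lebesgue_rV n.+1).-integrable setT f ->
  \int[lebesgue_rV n.+1]_x f x =
  \int[lebesgue_measure]_t \int[lebesgue_rV n]_v f (cons_rV (t, v)).
Proof.
move=> fi; have mf := measurable_int _ fi.
have mfc : measurable_fun setT (f \o @cons_rV R n).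
  by apply: measurableT_comp => //; exact: measurable_cons_rV.
have fci : (@lebesgue_measure R \x lebesgue_rV n)%E.-integrable setT (f \o @cons_rV R n).
  apply/integrableP; split=> //.
  move/integrableP : fi => [_].
  have mf' : measurable_fun setT (fun x => `|f x|) by exact: measurableT_comp.
  have K := @ge0_integral_pushforward _ _ (measurableTypeR R * 'rV[R]_n)%type _ R _ (@measurable_cons_rV R n)
    (lebesgue_measure \x lebesgue_rV n) setT _ measurableT mf' (fun y _ => abse_ge0 _).
  by apply: le_lt_trans; rewrite le_eqVlt; apply/orP; left; apply/eqP; exact: esym K.
have K := @integral_pushforward _ _ (measurableTypeR R * 'rV[R]_n)%type _ R _ (@measurable_cons_rV R n)
  (lebesgue_measure \x lebesgue_rV n) setT f mf fci measurableT.
apply: eq_trans K _; apply: esym.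
exact: (@integral12_prod_meas1 _ _ (measurableTypeR R) _ R lebesgue_measure (lebesgue_rV n)).
Qed.

Lemma ge0_integral_lebesgue_rV_prod n (f : 'I_n -> R -> R) :
  (forall i, measurable_fun setT (f i)) -> (forall i t, (0 <= f i t)%R) ->
  \int[lebesgue_rV n]_x (\prod_(i < n) f i (x 0%R i))%:E =
  \prod_(i < n) \int[lebesgue_measure]_t (f i t)%:E.
Proof.
elim: n f => [|n IH] f mf f0.
  rewrite big_ord0 /=; under eq_integral do rewrite big_ord0.
  by rewrite integral_dirac// diracT mule1.
rewrite ge0_integral_lebesgue_rVS; last 2 first.
- apply/measurable_EFinP; apply: measurable_prod => i _.
  by apply: measurableT_comp; [exact: mf|exact: measurable_rV_coord].
- by move=> x; rewrite lee_fin prodr_ge0.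
rewrite big_ord_recl -IH//.
have mp : measurable_fun setT (fun v : 'rV[R]_n =>
    (\prod_(i < n) f (lift ord0 i) (v 0%R i))%:E).
  apply/measurable_EFinP; apply: measurable_prod => i _.
  by apply: measurableT_comp; [exact: mf|exact: measurable_rV_coord].
rewrite -ge0_integralZr//.
- apply: eq_integral => t _.
  rewrite -ge0_integralZl//.
  + apply: eq_integral => v _; rewrite -EFinM; congr EFin.
    rewrite big_ord_recl cons_rV0; congr (_ * _)%R.
    by apply: eq_bigr => i _; rewrite cons_rVS.
  + by move=> v _; rewrite lee_fin prodr_ge0.
  + by rewrite lee_fin.
- apply/measurable_EFinP; exact: mf.
- by move=> t _; rewrite lee_fin.
- by apply: integral_ge0 => v _; rewrite lee_fin prodr_ge0.
Qed.

Lemma lebesgue_rV_hyperplane n (i : 'I_n) (c : R) :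
  lebesgue_rV n [set x : 'rV[R]_n | x 0%R i = c] = 0.
Proof.
pose A (j : 'I_n) : set R := if j == i then [set c] else setT.
have mA j : measurable (A j).
  by rewrite /A; case: ifP => _ //; exact: measurable_set1.
have -> : [set x : 'rV[R]_n | x 0%R i = c] = [set x | forall j, A j (x 0%R j)].
  apply/seteqP; split=> x /=.
    by move=> xi j; rewrite /A; case: eqP => // ->.
  by move=> /(_ i); rewrite /A eqxx.
rewrite lebesgue_rV_rectangle// (bigD1 i)//= {1}/A eqxx.
by rewrite lebesgue_measure_set1 mul0e.
Qed.

End lebesgue_rV_integral.

Section gauss_kernel.
Context {R : realType}.
Local Open Scope ring_scope.

(** the density of independent Gaussian coordinates of mean w and standard
    deviation e *)
Definition gauss_kernel n (e : R) (w x : 'rV[R]_n) : R :=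
  \prod_(i < n) normal_pdf (w 0 i) e (x 0 i).

Lemma gauss_kernel_ge0 n e (w x : 'rV[R]_n) : 0 <= gauss_kernel e w x.
Proof. by apply: prodr_ge0 => i _; exact: normal_pdf_ge0. Qed.

Lemma measurable_gauss_kernel n e (w : 'rV[R]_n) :
  measurable_fun setT (gauss_kernel e w).
Proof.
apply: measurable_prod => i _.
by apply: measurableT_comp; [exact: measurable_normal_pdf|exact: measurable_rV_coord].
Qed.

Lemma gauss_kernelE n e (w x : 'rV[R]_n) : e != 0 ->
  gauss_kernel e w x = normal_peak e ^+ n * gaussf (e ^+ 2 *+ 2)^-1 w x.
Proof.
move=> e0; rewrite /gauss_kernel /gaussf.
rewrite (eq_bigr (fun i => normal_peak e * normal_fun (w 0 i) e (x 0 i))); last first.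
  by move=> i _; rewrite normal_pdfE.
rewrite big_split/= prodr_const card_ord; congr (_ * _).
rewrite /normal_fun -expR_sum; congr expR.
rewrite /dotv mulr_sumr; apply: eq_bigr => i _.
by rewrite !mxE expr2; ring.
Qed.

Lemma integral_gauss_kernel n e (w : 'rV[R]_n) :
  (\int[lebesgue_rV n]_x (gauss_kernel e w x)%:E = 1)%E.
Proof.
rewrite (ge0_integral_lebesgue_rV_prod (f := fun i t => normal_pdf (w 0 i) e t)).
- by rewrite big1// => i _; exact: integral_normal_pdf.
- by move=> i; exact: measurable_normal_pdf.
- by move=> i t; exact: normal_pdf_ge0.
Qed.

Lemma integrable_gauss_kernel n e (w : 'rV[R]_n) :
  (lebesgue_rV n).-integrable setT (EFin \o gauss_kernel e w).
Proof.
apply/integrableP; split; first by apply/measurable_EFinP; exact: measurable_gauss_kernel.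
under eq_integral => x _ do rewrite /= ger0_norm ?gauss_kernel_ge0//.
by rewrite integral_gauss_kernel ltry.
Qed.

Lemma integrable_gauss_kernel_cos n e (w x : 'rV[R]_n) (c : R) :
  (lebesgue_rV n).-integrable setT
    (fun y => (gauss_kernel e w y * cos (dotv x y + c))%:E).
Proof.
apply: (@le_integrable _ _ _ _ _ _ _ (EFin \o gauss_kernel e w)) => //.
- apply/measurable_EFinP; apply: measurable_funM; first exact: measurable_gauss_kernel.
  apply: measurable_fun_cos; apply: measurable_funD => //.
  exact: measurable_fun_dotv.
- move=> y _; rewrite /= lee_fin normrM ler_piMr//.
  by rewrite ler_norml cos_geN1 cos_le1.
- exact: integrable_gauss_kernel.
Qed.

(** cosine transform of the kernel, one coordinate at a time; the phase c carries
the coordinates already treated *)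
Lemma integral_gauss_kernel_cos n e (w x : 'rV[R]_n) (c : R) : e != 0 ->
  (\int[lebesgue_rV n]_y (gauss_kernel e w y * cos (dotv x y + c))%:E =
   (cos (dotv x w + c) * expR (- e ^+ 2 * dotv x x / 2))%:E)%E.
Proof.
move=> e0; elim: n w x c => [|n IH] w x c.
  rewrite /= (eq_integral (fun=> (cos c)%:E)); last first.
    by move=> y _; rewrite /gauss_kernel /dotv !big_ord0 mul1r add0r.
  rewrite integral_dirac// diracT mul1e /dotv !big_ord0.
  by rewrite mulr0 mul0r expR0 mulr1 add0r.
rewrite integral_lebesgue_rVS; last exact: integrable_gauss_kernel_cos.
pose w' : 'rV[R]_n := \row_i w 0 (lift ord0 i).
pose x' : 'rV[R]_n := \row_i x 0 (lift ord0 i).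
have dS (y : 'rV[R]_n.+1) (y' : 'rV[R]_n) : (forall i, y' 0 i = y 0 (lift ord0 i)) ->
    dotv x y = x 0 0 * y 0 0 + dotv x' y'.
  move=> yE; rewrite /dotv big_ord_recl; congr (_ + _).
  by apply: eq_bigr => i _; rewrite yE mxE.
have xx : dotv x x = x 0 0 ^+ 2 + dotv x' x'.
  by rewrite (dS x x') ?expr2// => i; rewrite mxE.
have -> : dotv x w = x 0 0 * w 0 0 + dotv x' w'.
  by apply: dS => i; rewrite mxE.
transitivity (\int[lebesgue_measure]_t
    ((normal_pdf (w 0 0) e t * cos (x 0 0 * t + (dotv x' w' + c)))%:E *
     (expR (- e ^+ 2 * dotv x' x' / 2))%:E))%E.
  apply: eq_integral => t _.
  transitivity ((normal_pdf (w 0 0) e t)%:E *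
     \int[lebesgue_rV n]_v (gauss_kernel e w' v * cos (dotv x' v + (x 0 0 * t + c)))%:E)%E.
    rewrite -integralZl//; last exact: integrable_gauss_kernel_cos.
    apply: eq_integral => v _; rewrite -EFinM; congr EFin.
    rewrite /gauss_kernel big_ord_recl cons_rV0 -mulrA; congr (_ * (_ * _)).
      by apply: eq_bigr => i _; rewrite cons_rVS mxE.
    rewrite (dS _ v) ?cons_rV0; last by move=> i; rewrite cons_rVS.
    by congr cos; rewrite /=; ring.
  rewrite IH -!EFinM; congr EFin; rewrite mulrA.
  by have -> : dotv x' w' + (x 0 0 * t + c) = x 0 0 * t + (dotv x' w' + c) by ring.
have ii : (@lebesgue_measure R).-integrable setT (fun t : measurableTypeR R =>
    (normal_pdf (w 0 0) e t * cos (x 0 0 * t + (dotv x' w' + c)))%:E).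
  apply: (@le_integrable _ (measurableTypeR R) R lebesgue_measure _ measurableT _
    (EFin \o normal_pdf (w 0 0) e)).
  - apply/measurable_EFinP; apply: measurable_funM; first exact: measurable_normal_pdf.
    by apply: measurable_fun_cos; apply: measurable_funD.
  - move=> y _; rewrite /= lee_fin normrM ler_piMr//.
    by rewrite ler_norml cos_geN1 cos_le1.
  - exact: integrable_normal_pdf.
have K := integralZr measurableT ii (expR (- e ^+ 2 * dotv x' x' / 2)).
apply: eq_trans K _.
rewrite -(fineK (integrable_fin_num measurableT ii)).
rewrite [fine _](Rintegral_normal_cos (w 0 0) (x 0 0) _ e0) -EFinM; congr EFin.
rewrite -[LHS]mulrA -expRD xx; congr (cos _ * expR _); first by ring.
by ring.
Qed.

End gauss_kernel.

(** * Norms on R^d and local integrability *)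

Lemma measurable_rV_box {R : realType} d (A : 'I_d -> set R) :
  (forall i, measurable (A i)) ->
  measurable [set x : 'rV[R]_d | forall i, A i (x 0 i)].
Proof.
move=> mA; rewrite [X in measurable X](_ : _ = \bigcap_(i in [set: 'I_d])
    ((fun x : 'rV[R]_d => x 0 i) @^-1` A i)); last first.
  by apply/seteqP; split=> [x Ax i _|x Ax i]; [exact: Ax|exact: (Ax i)].
apply: fin_bigcap_measurable => // i _.
by rewrite -[X in measurable X]setTI; apply: measurable_rV_coord.
Qed.

Lemma measurable_normr_le {R : realType} (r : R) : measurable [set t : R | `|t| <= r].
Proof.
rewrite (_ : [set t | _] = `[- r, r]%classic)//.
by apply/seteqP; split=> t /=; rewrite in_itv/= ler_norml.
Qed.

Section local_integrability.
Context {R : realType}.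
Notation mu := (@lebesgue_measure R).
Local Open Scope ereal_scope.

Lemma ge0_integral_lebesgue_oppr (f : R -> \bar R) :
  measurable_fun setT f -> (forall x, 0 <= f x) ->
  \int[mu]_x f (- x)%R = \int[mu]_x f x.
Proof.
move=> mf f0.
pose h : R -> measurableTypeR R := fun x => (- x)%R.
have mh : measurable_fun setT h by exact: measurable_funN.
have -> : \int[mu]_x f (- x)%R = \int[pushforward mu h]_x f x.
  by rewrite ge0_integral_pushforward.
apply: eq_measure_integral => A mA _.
apply/esym; apply: (@lebesgue_measure_unique R (pushforward mu h)) => //.
move=> X [[a b]] _ <-.
change (mu `]a, b] = mu (h @^-1` `]a, b])).
have -> : h @^-1` `]a, b] = `[(- b)%R, (- a)%R[%classic.
  by apply/seteqP; split=> x /=; rewrite !in_itv/= /h ltrNr lerNl andbC.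
rewrite !lebesgue_measure_itv/= !lte_fin ltrN2.
by case: ifPn => // ab; rewrite -!EFinB opprK addrC.
Qed.

(** needed because 0 to a negative power is 0 in this encoding *)
Lemma ae_coord_neq0 n :
  {ae lebesgue_rV n, forall x : 'rV[R]_n, forall i, x 0%R i != 0%R}.
Proof.
have N i : {ae lebesgue_rV n, forall x : 'rV[R]_n, x 0%R i != 0%R}.
  exists [set x : 'rV[R]_n | x 0%R i = 0%R]; split.
  - have := @measurable_rV_coord R n i measurableT [set 0%R] (measurable_set1 _).
    by rewrite setTI.
  - exact: lebesgue_rV_hyperplane.
  - by move=> x /= /negP; rewrite negbK => /eqP.
exact: filter_forall.
Qed.

Section box.
Variables (q r : R).
Hypotheses (q0 : (0 < q)%R) (r0 : (0 < r)%R).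

Let g (t : R) : R := (t `^ (q - 1) * \1_(`]0, r]) t)%R.

(** |t|^(q-1) on the punctured interval 0 < |t| <= r, and 0 elsewhere *)
Let f (t : R) : R := (g t + g (- t))%R.

Let g0 t : (0 <= g t)%R. Proof. by rewrite mulr_ge0 ?powR_ge0. Qed.

Let mg : measurable_fun setT g.
Proof.
apply: measurable_funM; first exact: measurable_powR.
exact: measurable_indic.
Qed.

Let mf : measurable_fun setT f.
Proof. by apply: measurable_funD => //; apply: measurableT_comp. Qed.

Let int_f : \int[mu]_t (f t)%:E <= (2 * (r `^ q / q))%:E.
Proof.
rewrite /f; under eq_integral do rewrite EFinD.
rewrite ge0_integralD//; first last.
- by apply/measurable_EFinP; apply: measurableT_comp.
- by move=> t _; rewrite lee_fin.
- exact/measurable_EFinP.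
- by move=> t _; rewrite lee_fin.
have mEg : measurable_fun setT (fun t => (g t)%:E) by exact/measurable_EFinP.
have K := @ge0_integral_lebesgue_oppr (fun t => (g t)%:E) mEg (fun t => g0 t).
rewrite {}K.
have -> : \int[mu]_t (g t)%:E = \int[mu]_(t in `]0%R, r]) (t `^ (q - 1))%:E.
  by rewrite [RHS]integral_mkcond; apply: eq_integral => t _;
     rewrite epatch_indic /g EFinM.
by rewrite mulrDl mul1r EFinD leeD// integral_powR_0le.
Qed.

Lemma integral_box_prod_powR n :
  \int[lebesgue_rV n]_(x in [set x : 'rV[R]_n | forall i, (`|x 0%R i| <= r)%R])
     (\prod_(i < n) `|x 0%R i| `^ (q - 1))%:E <= ((2 * (r `^ q / q)) ^+ n)%:E.
Proof.
have C0 : (0 <= 2 * (r `^ q / q))%R by rewrite mulr_ge0// divr_ge0 ?powR_ge0 ?(ltW q0).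
have mB : measurable [set x : 'rV[R]_n | forall i, (`|x 0%R i| <= r)%R].
  by apply: (@measurable_rV_box _ _ (fun=> [set t | (`|t| <= r)%R])) => i; exact: measurable_normr_le.
have I0 : 0 <= \int[mu]_t (f t)%:E by apply: integral_ge0 => t _; rewrite lee_fin addr_ge0.
have f0 t : (0 <= f t)%R by rewrite addr_ge0.
apply: (@le_trans _ _ (\int[lebesgue_rV n]_x (\prod_(i < n) f (x 0%R i))%:E)); last first.
  rewrite (ge0_integral_lebesgue_rV_prod (f := fun=> f))//.
  have If : \int[mu]_t (f t)%:E \is a fin_num.
    by rewrite ge0_fin_numE// (le_lt_trans int_f) ?ltry.
  rewrite -(fineK If) prodEFin lee_fin prodr_const card_ord lerXn2r ?nnegrE ?fine_ge0//.
  by rewrite -lee_fin fineK.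
rewrite [leLHS]integral_mkcond; apply: ae_ge0_le_integral => //.
- by move=> x _; rewrite erestrict_ge0// => y _; rewrite lee_fin prodr_ge0// => i _; exact: powR_ge0.
- apply/(measurable_restrictT _ mB); apply: measurable_funTS.
  apply/measurable_EFinP; apply: measurable_prod => i _.
  apply: (measurableT_comp (measurable_powR _)).
  by apply: measurableT_comp => //; exact: measurable_rV_coord.
- by move=> x _; rewrite lee_fin prodr_ge0.
- apply/measurable_EFinP; apply: measurable_prod => i _.
  by apply: measurableT_comp => //; exact: measurable_rV_coord.
have := @ae_coord_neq0 n.
apply: filterS => x x0 _.
rewrite /patch; case: ifPn => [|_]; last by rewrite lee_fin prodr_ge0.
rewrite inE /= => xr; rewrite lee_fin le_eqVlt; apply/orP; left; apply/eqP.
apply: eq_bigr => i _; move: (x0 i) (xr i); move: (x 0%R i) => t t0 tr.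
rewrite /f /g !indicE !mem_setE !in_itv/=.
move: t0; rewrite neq_lt => /orP[t0|t0].
  rewrite ltr0_norm//; rewrite ltr0_norm// in tr.
  by rewrite ltNge (ltW t0)/= mulr0 add0r oppr_gt0 t0 tr mulr1.
rewrite gtr0_norm//; rewrite gtr0_norm// in tr.
by rewrite t0 tr mulr1 oppr_gt0 ltNge (ltW t0)/= mulr0 addr0.
Qed.

End box.
End local_integrability.

Section norms.
Context {R : realType} {d : nat}.
Variable N : 'rV[R]_d -> R.
Hypothesis hN : is_norm N.
Implicit Types x y : 'rV[R]_d.

Lemma is_norm0 : N 0 = 0.
Proof. by have [_ Nz _] := hN; rewrite -(scale0r 0) Nz normr0 mul0r. Qed.

Lemma is_normN x : N (- x) = N x.
Proof. by have [_ Nz _] := hN; rewrite -scaleN1r Nz normrN1 mul1r. Qed.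

Lemma is_norm_ge0 x : 0 <= N x.
Proof.
have [_ _ ND] := hN; have := ND x (- x).
rewrite subrr is_norm0 is_normN => h; lra.
Qed.

Lemma is_norm_gt0 x : x != 0 -> 0 < N x.
Proof.
have [N0 _ _] := hN => x0; rewrite lt_neqAle is_norm_ge0 andbT eq_sym.
by apply: contra_neq x0; exact: N0.
Qed.

(** the sum of the norms of the basis vectors, a Lipschitz constant of N *)
Definition norm_lip : R := \sum_(i < d) N (delta_mx 0 i).

Lemma norm_lip_ge0 : 0 <= norm_lip.
Proof. by apply: sumr_ge0 => i _; exact: is_norm_ge0. Qed.

Lemma is_norm_le_coord x r : (forall i, `|x 0 i| <= r) -> N x <= norm_lip * r.
Proof.
have [_ Nz ND] := hN => xr.
have NS (s : seq 'I_d) (f : 'I_d -> 'rV[R]_d) : N (\sum_(i <- s) f i) <= \sum_(i <- s) N (f i).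
  elim: s => [|i s IH]; first by rewrite !big_nil is_norm0.
  by rewrite !big_cons (le_trans (ND _ _))// lerD2l.
rewrite {1}(row_sum_delta x) (le_trans (NS _ _))// /norm_lip mulr_suml.
by apply: ler_sum => i _; rewrite Nz mulrC ler_wpM2l// is_norm_ge0.
Qed.

Lemma is_norm_sub_le x y : N x <= N y + N (x - y).
Proof. by have [_ _ ND] := hN; rewrite -{1}(subrKC y x). Qed.

Lemma coord_le_norm x i : `|x 0 i| <= `|x|.
Proof.
have -> : `|x| = mx_norm x by [].
rewrite mx_normrE.
exact: (@le_bigmax _ _ _ _ (fun ij : 'I_1 * 'I_d => `|x ij.1 ij.2|) (0, i)).
Qed.

Lemma is_norm_continuous : continuous N.
Proof.
move=> x; apply/(@cvgrPdist_lt R _ _ (nbhs x) _ N (N x)) => e e0.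
have C0 : 0 < norm_lip + 1 by rewrite ltr_pwDr// norm_lip_ge0.
near=> y.
have xy : `|x - y| < e / (norm_lip + 1).
  by near: y; apply: cvgr_dist_lt => //; rewrite divr_gt0.
have D : N (x - y) < e.
  apply: le_lt_trans (is_norm_le_coord (coord_le_norm (x - y))) _.
  rewrite ltr_pdivlMr// in xy; apply: le_lt_trans xy.
  by rewrite mulrC ler_wpM2l// lerDl.
rewrite ltr_norml; apply/andP; split.
  have := is_norm_sub_le y x; rewrite -(is_normN (y - x)) opprB; move: D; lra.
by have := is_norm_sub_le x y; move: D; lra.
Unshelve. all: by end_near. Qed.

(** N attains a positive minimum on the compact unit sphere of the sup norm *)
Lemma is_norm_lower_bound : (0 < d)%N ->
  exists2 c, 0 < c & forall x i, c * `|x 0 i| <= N x.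
Proof.
move=> d0; have [N0 Nz ND] := hN.
pose A := [set x : 'rV[R]_d | `|x| = 1].
have clA : closed A.
  apply: (@closed_comp _ _ (fun x : 'rV[R]_d => `|x|) [set 1]).
    by move=> x _; exact: norm_continuous.
  exact: closed_eq.
have cA : compact A.
  apply: bounded_closed_compact => //.
  by exists 1; split=> // M M1 x; rewrite /A /= => ->; exact: ltW.
have A0 : A !=set0.
  pose v : 'rV[R]_d := delta_mx 0 (Ordinal d0).
  have v0 : v != 0.
    by apply/eqP => /rowP/(_ (Ordinal d0))/eqP; rewrite !mxE !eqxx oner_eq0.
  exists (`|v|^-1 *: v); rewrite /A/= normrZ normfV normr_id mulVf//.
  by rewrite normr_eq0.
have [x0 x0A minN] := @EVT_min_rV R d N A A0 cA (continuous_subspaceT is_norm_continuous).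
exists (N x0).
  apply: is_norm_gt0; move: x0A; rewrite inE /A/=; apply: contraPneq => ->.
  by rewrite normr0 => /esym/eqP; rewrite oner_eq0.
move=> x i; have [->|x1] := eqVneq x 0.
  by rewrite mxE normr0 mulr0 is_norm0.
have n0 : 0 < `|x| by rewrite normr_gt0.
have : N x0 <= N (`|x|^-1 *: x).
  apply: minN; rewrite inE /A/= normrZ normfV normr_id mulVf//.
  by rewrite gt_eqF.
rewrite Nz normfV normr_id mulrC ler_pdivlMr// => h.
by rewrite (le_trans _ h)// ler_wpM2l ?is_norm_ge0// coord_le_norm.
Qed.

(** Measurability refers to the sigma-algebra generated by the coordinates:
{N < c} is a countable union of boxes with rational centres and radii. *)
Lemma measurable_is_norm : measurable_fun setT N.
Proof.
apply: (measurability _ (RGenInftyO.measurableE R)) => //.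
move=> _ [_ [c ->] <-]; rewrite setTI.
pose B (q : 'rV[rat]_d * rat) : set 'rV[R]_d :=
  if (0 < q.2) && (N (map_mx (@ratr R) q.1) + norm_lip * ratr q.2 < c) then
    [set x | forall i, `|x 0 i - ratr (q.1 0 i)| <= ratr q.2] else set0.
rewrite (_ : _ @^-1` _ = \bigcup_q B q).
  apply: countable_bigcupT_measurable => // q.
  rewrite /B; case: ifP => _; last exact: measurable0.
  apply: (@measurable_rV_box _ _ (fun i => [set t | `|t - ratr (q.1 0 i)| <= ratr q.2])) => i.
  rewrite (_ : [set t | _] = `[ratr (q.1 0 i) - ratr q.2, ratr (q.1 0 i) + ratr q.2]%classic)//.
  by apply/seteqP; split=> t /=; rewrite in_itv/= ler_distl.
apply/seteqP; split=> x /=; rewrite in_itv/=.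
  move=> Nxc.
  have C0 : 0 < 2 * norm_lip + 1.
    by rewrite ltr_pwDr// mulr_ge0// norm_lip_ge0.
  have /rat_in_itvoo[r] : 0 < (c - N x) / (2 * norm_lip + 1).
    by rewrite divr_gt0// subr_gt0.
  rewrite in_itv/= ltr0q ltr_pdivlMr// => /andP[r0 rc].
  have rR : 0 < ratr r :> R by rewrite ltr0q.
  have qx i : {q : rat | `|x 0 i - ratr q| <= ratr r}.
    apply: cid; have /rat_in_itvoo[q] : x 0 i - ratr r < x 0 i + ratr r by lra.
    rewrite in_itv/= => /andP[q1 q2]; exists q.
    by rewrite ler_norml; apply/andP; split; lra.
  exists (\row_i sval (qx i), r) => //; rewrite /B /=.
  have xq i : `|x 0 i - ratr ((\row_i sval (qx i)) 0 i)| <= ratr r.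
    by rewrite mxE; exact: (svalP (qx i)).
  rewrite r0 ifT//=.
  have := is_norm_sub_le (map_mx (@ratr R) (\row_i sval (qx i))) x.
  have := @is_norm_le_coord (map_mx (@ratr R) (\row_i sval (qx i)) - x) (ratr r).
  have H i : `|(map_mx (@ratr R) (\row_i sval (qx i)) - x) 0 i| <= ratr r.
    by have := xq i; rewrite distrC !mxE.
  move=> /(_ H) h1 h2.
  have := norm_lip_ge0; nra.
move=> [[q r] _]; rewrite /B/=; case: ifP => // /andP[r0 qr] xq.
have := is_norm_sub_le x (map_mx (@ratr R) q).
have : N (x - map_mx (@ratr R) q) <= norm_lip * ratr r.
  by apply: is_norm_le_coord => i; rewrite !mxE.
lra.
Qed.

Lemma measurable_is_norm_ball (s : R) : measurable [set x | N x <= s].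
Proof.
have := measurable_is_norm measurableT (measurable_itv `]-oo, s]).
by rewrite setTI; congr measurable; apply/seteqP; split=> x /=; rewrite in_itv.
Qed.

End norms.

(** * Gaussian averages of a negative power of a norm *)

Lemma normal_peak_scale {R : realType} (k e : R) : 0 < k ->
  normal_peak (k * e) = k^-1 * normal_peak e.
Proof.
move=> k0; rewrite /normal_peak exprMn -mulrA -mulrnAr sqrtrM ?sqr_ge0//.
by rewrite sqrtr_sqr gtr0_norm// invfM.
Qed.

Lemma le_powR_neg {R : realType} (l a b : R) : 0 <= l -> 0 < a -> a <= b ->
  b `^ (- l) <= a `^ (- l).
Proof.
move=> l0 a0 ab; rewrite !powRN lef_pV2 ?posrE ?powR_gt0//.
  by rewrite ge0_ler_powR// ?nnegrE// ltW// (lt_le_trans a0).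
exact: lt_le_trans ab.
Qed.

Section gauss_potential.
Context {R : realType} {d : nat}.
Variables (N : 'rV[R]_d -> R) (l : R).
Hypotheses (d0 : (0 < d)%N) (hN : is_norm N) (ld : 0 < l < d%:R).
Implicit Types (w x : 'rV[R]_d) (e s : R).
Local Notation L := (lebesgue_rV d).

Let q : R := 1 - l / d%:R.

Let q0 : 0 < q.
Proof.
case/andP: ld => _ h; rewrite /q subr_gt0 ltr_pdivrMr ?ltr0n// mul1r//.
Qed.

Let l0 : 0 < l. Proof. by case/andP: ld. Qed.

Lemma measurable_norm_powR : measurable_fun setT (fun x => N x `^ (- l)).
Proof. by apply: (measurableT_comp (measurable_powR _)); exact: measurable_is_norm. Qed.

(** Since N dominates every |x i|, N^-l is dominated by a multiple of the product of
the |x i|^(-l/d), and the exponents -l/d are larger than -1. *)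
Lemma norm_powR_locally_integrable : exists2 C, 0 <= C & forall s, 0 < s ->
  (\int[L]_(x in [set x | (N x <= s)%R]) (N x `^ (- l))%:E <= (C * s `^ (d%:R - l))%:E)%E.
Proof.
have [c c0 cN] := is_norm_lower_bound hN d0.
pose b := c `^ (- (l / d%:R)).
have dR0 : 0 < d%:R :> R by rewrite ltr0n.
have ld0 : 0 < l / d%:R by rewrite divr_gt0.
exists ((b * (2 * (c^-1 `^ q / q))) ^+ d).
  by rewrite exprn_ge0// !mulr_ge0 ?invr_ge0 ?powR_ge0// ltW.
move=> s s0.
pose B := [set x : 'rV[R]_d | forall i, `|x 0 i| <= s / c].
have mN : measurable [set x | (N x <= s)%R].
  exact: measurable_is_norm_ball.
have mB : measurable B.
  by apply: (@measurable_rV_box _ _ (fun=> [set t | `|t| <= s / c])) => i; exact: measurable_normr_le.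
have NB : [set x | (N x <= s)%R] `<=` B.
  by move=> x /= Nxs i; rewrite ler_pdivlMr// mulrC (le_trans (cN x i)).
pose h (x : 'rV[R]_d) := \prod_(i < d) `|x 0 i| `^ (q - 1).
have h0 x : 0 <= h x by apply: prodr_ge0 => i _; exact: powR_ge0.
have mh : measurable_fun setT h.
  apply: measurable_prod => i _; apply: (measurableT_comp (measurable_powR _)).
  by apply: measurableT_comp => //; exact: measurable_rV_coord.
have b0 : 0 <= b by exact: powR_ge0.
apply: (@le_trans _ _ (\int[L]_(x in [set x | (N x <= s)%R]) ((b ^+ d)%:E * (h x)%:E))%E).
  apply: ae_ge0_le_integral => //.
  - by move=> x _; rewrite lee_fin powR_ge0.
  - by apply/measurable_EFinP; apply: measurable_funTS; exact: measurable_norm_powR.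
  - by move=> x _; rewrite mule_ge0// lee_fin ?exprn_ge0.
  - by apply/measurable_EFinP/measurable_funM => //; exact: measurable_funTS.
  have := @ae_coord_neq0 R d; apply: filterS => x x0 _.
  rewrite -EFinM lee_fin.
  have Nx0 : 0 < N x.
    apply: lt_le_trans (cN x (Ordinal d0)).
    by rewrite mulr_gt0// normr_gt0 x0.
  have -> : N x `^ (- l) = \prod_(i < d) N x `^ (- (l / d%:R)).
    rewrite prodr_const card_ord -powR_mulrn ?powR_ge0// -powRrM.
    by congr (_ `^ _); field; rewrite gt_eqF.
  have -> : b ^+ d * h x = \prod_(i < d) (b * `|x 0 i| `^ (q - 1)).
    by rewrite big_split/= prodr_const card_ord.
  apply: ler_prod => i _; rewrite powR_ge0/=.
  have -> : q - 1 = - (l / d%:R) by rewrite /q; ring.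
  rewrite -powRM ?(ltW c0)//.
  have xi : 0 < c * `|x 0 i| by rewrite mulr_gt0// normr_gt0 x0.
  rewrite !powRN lef_pV2 ?posrE ?powR_gt0//.
  by rewrite ge0_ler_powR// ?nnegrE ?(ltW ld0)// ltW.
rewrite ge0_integralZl//; first last.
- by rewrite lee_fin exprn_ge0.
- by move=> x _; rewrite lee_fin.
- by apply/measurable_EFinP; exact: measurable_funTS.
have -> : ((b * (2 * (c^-1 `^ q / q))) ^+ d * s `^ (d%:R - l) =
    b ^+ d * (2 * ((s / c) `^ q / q)) ^+ d).
  rewrite !exprMn -!mulrA; congr (_ * (_ * _)).
  rewrite powRM ?invr_ge0 ?(ltW s0) ?(ltW c0)// exprMn.
  have -> : s `^ (d%:R - l) = (s `^ q) ^+ d.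
    rewrite -powR_mulrn ?powR_ge0// -powRrM; congr (_ `^ _).
    by rewrite /q; field; rewrite gt_eqF.
  by ring.
rewrite EFinM lee_wpmul2l ?lee_fin ?exprn_ge0//.
apply: (@le_trans _ _ (\int[L]_(x in B) (h x)%:E)%E).
  apply: ge0_subset_integral => //.
  - by apply/measurable_EFinP; exact: measurable_funTS.
  - by move=> x _; rewrite lee_fin.
by apply: integral_box_prod_powR => //; rewrite divr_gt0.
Qed.

(** the average of N^-l against the Gaussian kernel of width e centred at w; the
value 0 of the integrand at the origin is harmless, a point being null *)
Definition gauss_potential e w : \bar R :=
  (\int[L]_x (N x `^ (- l) * gauss_kernel e w x)%:E)%E.

Let meas_integrand e w :
  measurable_fun setT (fun x => (N x `^ (- l) * gauss_kernel e w x)%:E).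
Proof.
apply/measurable_EFinP; apply: measurable_funM; first exact: measurable_norm_powR.
exact: measurable_gauss_kernel.
Qed.

Let integrand_ge0 e w x : 0 <= N x `^ (- l) * gauss_kernel e w x.
Proof. by rewrite mulr_ge0 ?powR_ge0 ?gauss_kernel_ge0. Qed.

Lemma gauss_potential_ge0 e w : (0 <= gauss_potential e w)%E.
Proof. by apply: integral_ge0 => x _; rewrite lee_fin. Qed.

(** the contributions of the region where N is large and of the ball where N
    is singular are bounded separately *)
Lemma gauss_potential_split : exists2 C, 0 <= C & forall e w s B, 0 < s -> 0 <= B ->
  (forall x, N x <= s -> gauss_kernel e w x <= B) ->
  (gauss_potential e w <= (s `^ (- l) + B * (C * s `^ (d%:R - l)))%:E)%E.
Proof.
have [C C0 HC] := norm_powR_locally_integrable; exists C => // e w s B s0 B0 HB.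
have mN : measurable [set x | (N x <= s)%R].
  exact: measurable_is_norm_ball.
pose D := [set x | (N x <= s)%R].
have m1 : measurable_fun setT (fun x => (s `^ (- l))%:E * (gauss_kernel e w x)%:E)%E.
  by apply/measurable_EFinP/measurable_funM => //; exact: measurable_gauss_kernel.
have m2 : measurable_fun setT (fun x => B%:E * (N x `^ (- l) * \1_D x)%:E)%E.
  apply/measurable_EFinP/measurable_funM => //; apply: measurable_funM.
    exact: measurable_norm_powR.
  exact: measurable_indic.
apply: (@le_trans _ _ (\int[L]_x ((s `^ (- l))%:E * (gauss_kernel e w x)%:E
   + B%:E * (N x `^ (- l) * \1_D x)%:E))%E).
  apply: ge0_le_integral => //.
  - by move=> x _; rewrite lee_fin.
  - exact: emeasurable_funD.
  move=> x _; rewrite -!EFinM -EFinD lee_fin indicE.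
  have [xs|xs] := leP (N x) s.
    rewrite mem_set// mulr1 (mulrC B) (le_trans (ler_wpM2l _ (HB x xs))) ?powR_ge0//.
    by rewrite lerDr mulr_ge0 ?powR_ge0 ?gauss_kernel_ge0.
  rewrite memNset ?mulr0 ?addr0; last by rewrite /D/=; apply/negP; rewrite -ltNge.
  by rewrite ler_wpM2r ?gauss_kernel_ge0// (le_powR_neg (ltW l0))// ltW.
rewrite ge0_integralD//; last 2 first.
- by move=> x _; rewrite -EFinM lee_fin mulr_ge0 ?powR_ge0 ?gauss_kernel_ge0.
- by move=> x _; rewrite -EFinM lee_fin !mulr_ge0 ?powR_ge0.
rewrite EFinD leeD//.
  rewrite ge0_integralZl//; first last.
  - by rewrite lee_fin powR_ge0.
  - by move=> x _; rewrite lee_fin gauss_kernel_ge0.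
  - by apply/measurable_EFinP; exact: measurable_gauss_kernel.
  by rewrite integral_gauss_kernel mule1.
rewrite ge0_integralZl//; first last.
- by move=> x _; rewrite lee_fin mulr_ge0 ?powR_ge0.
- apply/measurable_EFinP/measurable_funM; first exact: measurable_norm_powR.
  exact: measurable_indic.
rewrite EFinM lee_wpmul2l ?lee_fin//.
apply: le_trans (HC s s0).
rewrite [leRHS]integral_mkcond.
rewrite le_eqVlt; apply/orP; left; apply/eqP; apply: eq_integral => x _.
by rewrite epatch_indic EFinM.
Qed.

Lemma gauss_kernel_le_peak e w x : 0 < e -> gauss_kernel e w x <= normal_peak e ^+ d.
Proof.
move=> e0; rewrite gauss_kernelE ?gt_eqF// ler_piMr ?exprn_ge0 ?normal_peak_ge0//.
rewrite /gaussf -expR0 ler_expR mulNr oppr_le0 mulr_ge0 ?dotvv_ge0//.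
by rewrite invr_ge0 mulrn_wge0// sqr_ge0.
Qed.

Lemma gauss_potential_fin e w : 0 < e -> gauss_potential e w \is a fin_num.
Proof.
move=> e0; have [C C0 H] := gauss_potential_split.
rewrite ge0_fin_numE ?gauss_potential_ge0//.
apply: le_lt_trans (H e w 1 (normal_peak e ^+ d) _ _ _) _ => //.
- by rewrite exprn_ge0// normal_peak_ge0.
- by move=> x _; exact: gauss_kernel_le_peak.
- exact: ltry.
Qed.

Let lip := norm_lip N + 1.

Let lip0 : 0 < lip. Proof. by rewrite ltr_pwDr// norm_lip_ge0. Qed.

Let norm_le_enorm x : N x <= lip * enorm x.
Proof.
apply: le_trans (is_norm_le_coord hN (coord_le_enorm x)) _.
by rewrite ler_wpM2r ?enorm_ge0// lerDl.
Qed.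

(** gauss_potential_split with s = (1 - eta) N w: on the ball N <= s the distance to w
is at least a multiple of eta N w *)
Lemma gauss_potential_le eta : 0 < eta < 1 -> exists2 C, 0 <= C & forall e w,
  0 < e -> 0 < N w ->
  (gauss_potential e w <=
   (N w `^ (- l) * ((1 - eta) `^ (- l) + C * (e / (e + N w))))%:E)%E.
Proof.
move=> /andP[eta0 eta1]; have [K K0 H] := gauss_potential_split.
have ome : 0 < 1 - eta by rewrite subr_gt0.
pose kap := (eta / lip) ^+ 2 / 2.
have kap0 : 0 < kap by rewrite divr_gt0// exprn_gt0// divr_gt0.
pose p1 : R := normal_peak 1.
have p10 : 0 <= p1 by exact: normal_peak_ge0.
have [Q Q0 HQ] : exists2 Q, 0 <= Q & forall r, 0 <= r ->
    (1 + r) ^+ d.+1 * expR (- kap * r ^+ 2) <= Q.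
  exists (expR (3 * kap) * (d.+1`!%:R / (2 * kap) ^+ d.+1)).
    by rewrite mulr_ge0 ?expR_ge0// divr_ge0// exprn_ge0// mulr_ge0// ltW.
  by move=> r; exact: pow_gauss.
exists (p1 ^+ d * K * (1 - eta) `^ (d%:R - l) * Q).
  by rewrite !mulr_ge0 ?powR_ge0// exprn_ge0.
move=> e w e0 Nw0.
pose M := N w; pose t := M / e.
have t0 : 0 < t by rewrite divr_gt0.
pose B := (e^-1 * p1) ^+ d * expR (- kap * t ^+ 2).
have B0 : 0 <= B by rewrite mulr_ge0 ?expR_ge0// exprn_ge0// mulr_ge0// invr_ge0 ltW.
apply: le_trans (H e w ((1 - eta) * M) B _ B0 _) _; first by rewrite mulr_gt0.
  move=> x Nx.
  have -> : B = normal_peak e ^+ d * expR (- kap * t ^+ 2).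
    by rewrite /B -(normal_peak_scale 1 e0) mulr1.
  rewrite gauss_kernelE ?gt_eqF// ler_wpM2l ?exprn_ge0 ?normal_peak_ge0//.
  rewrite /gaussf ler_expR !mulNr lerN2 -sqr_enorm.
  have D : eta * M / lip <= enorm (x - w).
    rewrite ler_pdivrMr//.
    have h1 := is_norm_sub_le hN w x; have h2 := norm_le_enorm (x - w).
    have h3 : N (w - x) = N (x - w) by rewrite -(is_normN hN (x - w)) opprB.
    rewrite [leRHS]mulrC; rewrite /M; rewrite /M in Nx; lra.
  have -> : kap * t ^+ 2 = (e ^+ 2 *+ 2)^-1 * (eta * M / lip) ^+ 2.
    rewrite /kap /t -mulr_natr; field.
    by rewrite !gt_eqF.
  rewrite ler_wpM2l ?invr_ge0 ?mulrn_wge0 ?sqr_ge0//.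
  rewrite lerXn2r ?nnegrE ?enorm_ge0//.
  by rewrite divr_ge0 ?(ltW lip0)// mulr_ge0 ?(ltW eta0)// ltW.
rewrite lee_fin powRM ?(ltW ome) ?(ltW Nw0)// mulrDr mulrC lerD2l.
rewrite powRM ?(ltW ome) ?(ltW Nw0)//.
have Md : M `^ (d%:R - l) = M `^ (- l) * M ^+ d.
  rewrite powRD; last by apply/implyP => _; rewrite gt_eqF.
  by rewrite powR_mulrn ?(ltW Nw0)// mulrC.
rewrite Md.
have -> : B * (K * ((1 - eta) `^ (d%:R - l) * (M `^ (- l) * M ^+ d))) =
   M `^ (- l) * (p1 ^+ d * K * (1 - eta) `^ (d%:R - l) * (t ^+ d * expR (- kap * t ^+ 2))).
  by rewrite /B /t !exprMn; ring.
rewrite ler_wpM2l ?powR_ge0// -!mulrA.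
rewrite !ler_wpM2l ?exprn_ge0 ?powR_ge0//.
have -> : e / (e + M) = (1 + t)^-1.
  by rewrite /t; field; rewrite !gt_eqF ?addr_gt0.
rewrite ler_pdivlMr ?addr_gt0//.
apply: le_trans (HQ t (ltW t0)).
rewrite mulrAC ler_wpM2r ?expR_ge0// exprSr ler_wpM2r ?addr_ge0 ?(ltW t0)//.
by rewrite lerXn2r ?nnegrE ?addr_ge0 ?(ltW t0)// lerDr.
Qed.

(** outside the ball of radius delta around w, the kernel of width e is
    a small multiple of the kernel of width sqrt 2 * e *)
Lemma le_gauss_potential e w delta : 0 < e -> 0 < delta ->
  (((N w + lip * delta) `^ (- l))%:E <= gauss_potential e w +
   ((N w + lip * delta) `^ (- l) *
     (Num.sqrt 2 ^+ d * expR (- (delta / e) ^+ 2 / 4)))%:E)%E.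
Proof.
move=> e0 de0; set a := _ `^ (- l); set tau := _ * expR _.
have tau0 : 0 <= tau by rewrite mulr_ge0 ?expR_ge0// exprn_ge0// sqrtr_ge0.
have s20 : 0 < Num.sqrt 2 :> R by rewrite sqrtr_gt0.
have a0 : 0 <= a by exact: powR_ge0.
have kernel_far x : delta < enorm (x - w) ->
    gauss_kernel e w x <= tau * gauss_kernel (Num.sqrt 2 * e) w x.
  move=> dx.
  rewrite !gauss_kernelE ?gt_eqF ?mulr_gt0// normal_peak_scale// exprMn.
  rewrite /tau /gaussf !exprMn sqr_sqrtr// -sqr_enorm.
  rewrite [leRHS](_ : _ = normal_peak e ^+ d *
    (expR (- (delta ^+ 2 * e^-1 ^+ 2) / 4) * expR (- (2 * e ^+ 2 *+ 2)^-1 * enorm (x - w) ^+ 2))); last first.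
    have r0 : Num.sqrt 2 ^+ d != 0 :> R by rewrite expf_neq0// gt_eqF.
    move: (expR _) (expR _) => E1 E2; rewrite (exprVn (Num.sqrt 2) d).
    move: (Num.sqrt 2 ^+ d) r0 => r r0.
    by field.
  rewrite ler_wpM2l ?exprn_ge0 ?normal_peak_ge0//.
  rewrite -expRD ler_expR.
  have dx2 : delta ^+ 2 <= enorm (x - w) ^+ 2.
    by rewrite lerXn2r ?nnegrE ?enorm_ge0// ltW.
  have -> : - (e ^+ 2 *+ 2)^-1 * enorm (x - w) ^+ 2 =
    - (e^-1 ^+ 2 * enorm (x - w) ^+ 2 / 2).
    by rewrite -mulr_natr; field; rewrite gt_eqF.
  have -> : - (2 * e ^+ 2 *+ 2)^-1 * enorm (x - w) ^+ 2 =
    - (e^-1 ^+ 2 * enorm (x - w) ^+ 2 / 4).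
    by rewrite -mulr_natr; field; rewrite gt_eqF.
  have : e^-1 ^+ 2 * delta ^+ 2 <= e^-1 ^+ 2 * enorm (x - w) ^+ 2.
    by rewrite ler_wpM2l// sqr_ge0.
  lra.
have mG e' := measurable_gauss_kernel e' w.
have -> : a%:E = (\int[L]_x (a * gauss_kernel e w x)%:E)%E.
  under eq_integral do rewrite EFinM.
  rewrite ge0_integralZl//; first by rewrite integral_gauss_kernel mule1.
  - exact/measurable_EFinP.
  - by move=> x _; rewrite lee_fin gauss_kernel_ge0.
have -> : (a * tau)%:E = (\int[L]_x ((a * tau) * gauss_kernel (Num.sqrt 2 * e) w x)%:E)%E.
  under eq_integral do rewrite EFinM.
  rewrite ge0_integralZl//; first by rewrite integral_gauss_kernel mule1.
  - exact/measurable_EFinP.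
  - by move=> x _; rewrite lee_fin gauss_kernel_ge0.
  - by rewrite lee_fin mulr_ge0.
rewrite -ge0_integralD//; first last.
- by apply/measurable_EFinP; apply: measurable_funM.
- by move=> x _; rewrite lee_fin !mulr_ge0// gauss_kernel_ge0.
- by move=> x _; rewrite lee_fin.
apply: ae_ge0_le_integral => //.
- by move=> x _; rewrite lee_fin mulr_ge0// gauss_kernel_ge0.
- by apply/measurable_EFinP; apply: measurable_funM.
- by move=> x _; rewrite -EFinD lee_fin addr_ge0// !mulr_ge0// gauss_kernel_ge0.
- apply: emeasurable_funD => //.
  by apply/measurable_EFinP; apply: measurable_funM.
have := @ae_coord_neq0 R d; apply: filterS => x x0 _.
rewrite -EFinD lee_fin.
have [dx|dx] := leP (enorm (x - w)) delta; last first.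
  rewrite -mulrA (le_trans (ler_wpM2l a0 (kernel_far x dx)))// lerDr.
  exact: integrand_ge0.
apply: (@le_trans _ _ (N x `^ (- l) * gauss_kernel e w x)); last first.
  by rewrite lerDl !mulr_ge0// gauss_kernel_ge0.
rewrite ler_wpM2r ?gauss_kernel_ge0// (le_powR_neg (ltW l0))//.
  apply: (is_norm_gt0 hN); apply/eqP => xE.
  by have := x0 (Ordinal d0); rewrite xE mxE eqxx.
rewrite (le_trans (is_norm_sub_le hN x w))// lerD2l (le_trans (norm_le_enorm _))//.
by rewrite ler_wpM2l// ltW.
Qed.

End gauss_potential.

(** * Averaged potentials and characteristic functions *)

Section smooth_potential.
Context {R : realType} {d : nat}.
Variables (N : 'rV[R]_d -> R) (l : R).
Hypotheses (d0 : (0 < d)%N) (hN : is_norm N) (ld : 0 < l < d%:R).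
Variable e : R.
Hypothesis e0 : 0 < e.
Implicit Types (w x y : 'rV[R]_d) (t : R).
Local Notation L := (lebesgue_rV d).

(** the even test function attached to w: the mean of the Gaussian kernels
    centred at w and at -w *)
Definition test_fun w : 'rV[R]_d -> R[i] :=
  let c := normal_peak e ^+ d / 2 in let b := (e ^+ 2 *+ 2)^-1 in
  fun x => (c * gaussf b w x + c * gaussf b (- w) x)%:C.

Lemma schwartz_test_fun w : schwartz (test_fun w).
Proof. by apply: schwartz_gauss_pair; rewrite invr_gt0 pmulrn_lgt0// exprn_gt0. Qed.

Lemma even_test_fun w : even_fun (test_fun w).
Proof. by move=> x; rewrite /test_fun !gaussf_opp opprK addrC. Qed.

Lemma Re_fourier_test_fun w y : complex.Re (fourier (test_fun w) y) =
  cos (dotv ((2 * pi) *: y) w) * expR (- (2 * (pi * e) ^+ 2) * dotv y y).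
Proof.
rewrite /fourier /cintegral /=.
have i1 := integrable_gauss_kernel_cos e w ((2 * pi) *: y) 0.
have i2 := integrable_gauss_kernel_cos e (- w) ((2 * pi) *: y) 0.
have i3 := integrableD measurableT i1 i2.
rewrite /Rintegral.
rewrite (eq_integral (fun x => (2^-1)%:E * ((gauss_kernel e w x * cos (dotv ((2 * pi) *: y) x + 0))%:E
   + (gauss_kernel e (- w) x * cos (dotv ((2 * pi) *: y) x + 0))%:E))%E); last first.
  move=> x _; rewrite !gauss_kernelE ?gt_eqF// mul0r subr0 cosN dotvZl addr0.
  by rewrite -EFinD -EFinM; congr EFin; field.
rewrite integralZl// integralD//.
rewrite !integral_gauss_kernel_cos ?gt_eqF//= !addr0.
have -> : dotv ((2 * pi) *: y) (- w) = - dotv ((2 * pi) *: y) w.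
  by rewrite -scaleN1r dotvZr mulN1r.
rewrite (cosN (dotv _ _)).
have H (a : R) : 2^-1 * (a + a) = a by field.
rewrite H; congr (_ * expR _).
by rewrite !dotvZl !dotvZr exprMn; field.
Qed.

(** the integral of N^-l against the test function of w; both averages are
finite, so that fine loses nothing *)
Definition smooth_potential w : R :=
  2^-1 * (fine (gauss_potential N l e w) + fine (gauss_potential N l e (- w))).

Lemma smooth_potential_ge0 w : 0 <= smooth_potential w.
Proof. by rewrite mulr_ge0// addr_ge0// fine_ge0// gauss_potential_ge0. Qed.

Lemma smooth_potentialE w : (smooth_potential w)%:E =
  ((2^-1)%:E * (gauss_potential N l e w + gauss_potential N l e (- w)))%E.
Proof.
rewrite /smooth_potential EFinM EFinD.
have F w' := fineK (gauss_potential_fin d0 hN ld w' e0).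
by move: (- w) => w'; rewrite (F w) (F w').
Qed.

Lemma Re_integral_test_fun w :
  complex.Re (cintegral L setT (fun x => (N x `^ (- l))%:C * test_fun w x)) =
  smooth_potential w.
Proof.
have mI w' : measurable_fun setT (fun x => (N x `^ (- l) * gauss_kernel e w' x)%:E).
  apply/measurable_EFinP; apply: measurable_funM; first exact: measurable_norm_powR.
  exact: measurable_gauss_kernel.
rewrite /cintegral /= /Rintegral -[RHS]/(fine (smooth_potential w)%:E); congr fine.
rewrite smooth_potentialE /gauss_potential -ge0_integralD//; last 2 first.
- by move=> x _; rewrite lee_fin mulr_ge0 ?powR_ge0 ?gauss_kernel_ge0.
- by move=> x _; rewrite lee_fin mulr_ge0 ?powR_ge0 ?gauss_kernel_ge0.
rewrite -ge0_integralZl//; first last.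
- by move=> x _; rewrite -EFinD lee_fin addr_ge0// mulr_ge0 ?powR_ge0 ?gauss_kernel_ge0.
- exact: emeasurable_funD.
apply: eq_integral => x _; rewrite !gauss_kernelE ?gt_eqF// mul0r subr0 -EFinD -EFinM.
by congr EFin; field.
Qed.

Let l0 : 0 < l. Proof. by case/andP: ld. Qed.

(** the radial density t^(l-1) exp (- 2 pi^2 e^2 t^2) *)
Let A t : R := t `^ (l - 1) * expR (- (2 * (pi * e) ^+ 2) * t ^+ 2).

Let A0 t : 0 <= A t. Proof. by rewrite mulr_ge0 ?powR_ge0 ?expR_ge0. Qed.

Let mA : measurable_fun setT A.
Proof.
apply: measurable_funM; first exact: measurable_powR.
by apply: measurableT_comp => //; apply: measurable_funM => //; exact: exprn_measurable.
Qed.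

Let Aint : (\int[lebesgue_measure]_(t in `]0%R, +oo[) (A t)%:E < +oo)%E.
Proof.
pose k : R := 2 * (pi * e) ^+ 2.
have k0 : 0 < k by rewrite mulr_gt0// exprn_gt0// mulr_gt0// pi_gt0.
pose Q := expR (3 * k) * (d.+1`!%:R / (2 * k) ^+ d.+1).
have mEA : measurable_fun setT (fun t => (A t)%:E) by exact/measurable_EFinP.
apply: (@le_lt_trans _ _ (\int[lebesgue_measure]_(t in `]0%R, 1%R]) (A t)%:E +
   \int[lebesgue_measure]_(t in `[1%R, +oo[) (A t)%:E)%E).
  apply: ge0_integral_subsetU => //.
  move=> t /=; rewrite !in_itv/= !andbT => t0; rewrite t0/=.
  by case: (leP t 1) => t1; [left|right => //; exact: ltW].
have I1 : (\int[lebesgue_measure]_(t in `]0%R, 1%R]) (A t)%:E <= (1 `^ l / l)%:E)%E.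
  apply: le_trans (integral_powR_0le l0 ltr01).
  apply: ge0_le_integral => //.
  - by move=> t _; rewrite lee_fin.
  - exact: measurable_funTS.
  - by apply/measurable_EFinP; apply: measurable_funTS; exact: measurable_powR.
  move=> t _; rewrite lee_fin ler_piMr ?powR_ge0// -[leRHS]expR0 ler_expR.
  by rewrite mulNr oppr_le0 mulr_ge0 ?sqr_ge0// ltW.
have I2 : (\int[lebesgue_measure]_(t in `[1%R, +oo[) (A t)%:E <= Q%:E)%E.
  have Q0 : 0 <= Q.
    by rewrite mulr_ge0 ?expR_ge0// divr_ge0// exprn_ge0// mulr_ge0// ltW.
  apply: (@le_trans _ _ (\int[lebesgue_measure]_(t in `[1%R, +oo[) (Q%:E * (t `^ (- 1 - 1))%:E))%E).
    apply: ge0_le_integral => //.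
    - by move=> t _; rewrite lee_fin.
    - exact: measurable_funTS.
    - apply/measurable_EFinP; apply: measurable_funM => //.
      by apply: measurable_funTS; exact: measurable_powR.
    move=> t /=; rewrite in_itv/= andbT => t1; rewrite -EFinM lee_fin.
    have t0 : 0 < t by rewrite (lt_le_trans ltr01).
    have -> : A t = t `^ (l + 1) * expR (- k * t ^+ 2) * t `^ (- 1 - 1).
      rewrite /A mulrAC -powRD; first by congr (_ `^ _ * _); ring.
      by apply/implyP => _; rewrite gt_eqF.
    rewrite ler_wpM2r ?powR_ge0//.
    apply: le_trans (pow_gauss k0 d.+1 (ltW t0)).
    rewrite ler_wpM2r ?expR_ge0//.
    apply: (@le_trans _ _ (t `^ d.+1%:R)).
      rewrite ler_powR// -natr1 lerD2r ltW//.
      by case/andP: ld.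
    by rewrite powR_mulrn ?(ltW t0)// lerXn2r ?nnegrE ?addr_ge0 ?(ltW t0)// lerDr.
  rewrite ge0_integralZl//; first last.
  - by move=> t _; rewrite lee_fin powR_ge0.
  - by apply/measurable_EFinP; apply: measurable_funTS; exact: measurable_powR.
  rewrite -[leRHS]mule1 lee_wpmul2l//.
  by have := @integral_powR_1y R 1 ltr01; rewrite invr1.
by rewrite (le_lt_trans (leeD I1 I2))// -EFinD ltry.
Qed.

Lemma measurable_sphere : measurable (@sphere R d).
Proof.
have mid : measurable_fun setT (id : 'rV[R]_d -> 'rV[R]_d) by exact: measurable_id.
have := measurable_fun_enorm mid measurableT (measurable_set1 1).
by rewrite setTI.
Qed.

Variable sigma : {finite_measure set 'rV[R]_d -> \bar R}.
Hypothesis sigmaE : forall psi : 'rV[R]_d -> R[i], schwartz psi -> even_fun psi ->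
  cintegral L setT (fun x => (N x `^ (- l))%:C * psi x) =
  cintegral lebesgue_measure `]0, +oo[%classic (fun t : R =>
    cintegral sigma (@sphere R d) (fun theta =>
      (t `^ (l - 1))%:C * fourier psi (t *: theta))).

Lemma smooth_potential_Rintegral w : smooth_potential w =
  \int[lebesgue_measure]_(t in `]0, +oo[)
    \int[sigma]_(theta in @sphere R d) (A t * cos (dotv ((2 * pi * t) *: theta) w)).
Proof.
rewrite -Re_integral_test_fun.
have := sigmaE (schwartz_test_fun w) (even_test_fun w) => /(congr1 (@complex.Re R)) ->.
rewrite /cintegral /=.
rewrite /Rintegral; congr fine; apply: eq_integral => t _; congr (fine _)%:E.
apply: eq_integral => th; rewrite inE => ths.
rewrite mul0r subr0.
have K := Re_fourier_test_fun w (t *: th).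
rewrite [X in _ * X]K.
have -> : dotv (t *: th) (t *: th) = t ^+ 2.
  by rewrite dotvZl dotvZr -sqr_enorm ths; ring.
by rewrite scalerA /A; congr EFin; ring.
Qed.

(** the deficit smooth_potential 0 - smooth_potential w, as an iterated
    integral of a nonnegative function *)
Definition potential_gap w : \bar R :=
  (\int[lebesgue_measure]_(t in `]0%R, +oo[) \int[sigma]_(theta in @sphere R d)
     (A t * (1 - cos (dotv ((2 * pi * t) *: theta) w)))%:E)%E.

Let S := @sphere R d.

Let gap_integrand_ge0 w t (th : 'rV[R]_d) :
  (0 <= (A t * (1 - cos (dotv ((2 * pi * t) *: th) w)))%:E)%E.
Proof. by rewrite lee_fin mulr_ge0// one_sub_cos_ge0. Qed.

(** the inner integral of potential_gap *)
Let gap_t w t : \bar R :=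
  (\int[sigma]_(th in S) (A t * (1 - cos (dotv ((2 * pi * t) *: th) w)))%:E)%E.

Let gap_t_ge0 w t : (0 <= gap_t w t)%E.
Proof. by apply: integral_ge0 => th _. Qed.

Let measurable_phase dT (T : measurableType dT) (W V : T -> 'rV[R]_d) (f : T -> R) :
  measurable_fun setT W -> measurable_fun setT V -> measurable_fun setT f ->
  measurable_fun setT (fun z => (A (f z) * (1 - cos (dotv ((2 * pi * f z) *: V z) (W z))))%:E).
Proof.
move=> mW mV mf; apply/measurable_EFinP; apply: measurable_funM.
  exact: measurableT_comp.
apply: measurable_funB => //; apply: measurable_fun_cos.
apply: measurable_fun_dotv => //; apply/measurable_fun_rVP => i.
rewrite (_ : (fun _ => _) = (fun z => (2 * pi * f z) * V z 0 i)); last first.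
  by apply/funext => z; rewrite mxE.
apply: measurable_funM; first exact: measurable_funM.
exact: (measurable_fun_rVP _).1 mV i.
Qed.

Let measurable_gap_t w : measurable_fun setT (gap_t w).
Proof.
apply: (@measurable_fun_integral_dom _ _ (measurableTypeR R) 'rV[R]_d R sigma S
  (fun z => (A z.1 * (1 - cos (dotv ((2 * pi * z.1) *: z.2) w)))%:E)) => //.
- exact: measurable_sphere.
- exact: measurable_phase.
Qed.

(** the integral over the sphere of the constant A t *)
Let mass t : R := A t * fine (sigma S).

Let sigmaS : sigma S = (fine (sigma S))%:E.
Proof.
by rewrite fineK// fin_num_measure//; exact: measurable_sphere.
Qed.

Let integrable_wave w t :
  sigma.-integrable S (fun th => (A t * cos (dotv ((2 * pi * t) *: th) w))%:E).
Proof.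
apply: (@le_integrable _ _ _ _ _ measurable_sphere _ (EFin \o cst (A t))) => //.
- apply/measurable_EFinP; apply: measurable_funTS; apply: measurable_funM => //.
  apply: measurable_fun_cos; under eq_fun do rewrite dotvZl dotvC.
  by apply: measurable_funM => //; apply: measurable_dotv.
- move=> th _; rewrite /= lee_fin normrM ler_piMr//.
  by rewrite ler_norml cos_geN1 cos_le1.
- apply: (integrableS measurableT measurable_sphere) => //.
  exact: finite_measure_integrable_cst.
Qed.

Let gap_tE w t : gap_t w t =
  ((mass t)%:E - (\int[sigma]_(th in S) (A t * cos (dotv ((2 * pi * t) *: th) w)))%:E)%E.
Proof.
rewrite /gap_t /Rintegral fineK; last first.
  by apply: integrable_fin_num => //; exact: measurable_sphere.
transitivity (\int[sigma]_(th in S) ((A t)%:E - (A t * cos (dotv ((2 * pi * t) *: th) w))%:E))%E.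
  by apply: eq_integral => th _; rewrite -EFinB mulrBr mulr1.
rewrite integralB//; last 2 first.
- exact: measurable_sphere.
- apply: (integrableS measurableT measurable_sphere) => //.
  exact: finite_measure_integrable_cst.
congr (_ - _)%E; rewrite (integral_cst sigma measurable_sphere (A t)%:E).
by rewrite [RHS]EFinM -sigmaS.
Qed.

Lemma potential_gapE w :
  ((smooth_potential w)%:E + potential_gap w = (smooth_potential 0)%:E)%E.
Proof.
pose g w' t := \int[sigma]_(th in S) (A t * cos (dotv ((2 * pi * t) *: th) w')).
have gE w' t : g w' t = mass t - fine (gap_t w' t).
  by rewrite gap_tE -EFinB /= opprB addrC subrK.
have gap0 t : gap_t 0 t = 0%E.
  rewrite /gap_t; apply: integral0_eq => th _.
  by rewrite dotvC dotv0l cos0 subrr mulr0.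
have mass0 t : 0 <= mass t by rewrite mulr_ge0// fine_ge0.
have mg w' : measurable_fun setT (g w').
  rewrite (_ : g w' = (fun t => mass t - fine (gap_t w' t))); last first.
    by apply/funext => t; exact: gE.
  apply: measurable_funB; first by apply: measurable_funM.
  exact: measurableT_comp.
have gap_le w' t : (gap_t w' t <= (2 * mass t)%:E)%E.
  apply: (@le_trans _ _ (\int[sigma]_(th in S) (cst (A t * 2)%:E) th)%E).
    apply: ge0_le_integral => //.
    - exact: measurable_sphere.
    - apply: measurable_funTS.
      by apply: (@measurable_phase _ _ (cst w') id (cst t)).
    - by move=> th _; rewrite lee_fin ler_wpM2l// one_sub_cos_le2.
  rewrite integral_cst; last exact: measurable_sphere.
  rewrite (_ : (_ * _)%E = ((A t * 2)%:E * (fine (sigma S))%:E)%E); last first.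
    by rewrite -sigmaS.
  by rewrite -EFinM lee_fin /mass mulrA (mulrC (A t)).
have mi : (@lebesgue_measure R).-integrable `]0, +oo[%classic (EFin \o mass).
  apply/integrableP; split.
    by apply/measurable_EFinP; apply: measurable_funTS; exact: measurable_funM.
  under eq_integral do rewrite /= ger0_norm//.
  rewrite /mass; under eq_integral do rewrite EFinM.
  rewrite ge0_integralZr//.
  - have Afin : (\int[lebesgue_measure]_(t in `]0%R, +oo[) (A t)%:E \is a fin_num)%E.
      by rewrite ge0_fin_numE//; apply: integral_ge0 => t _; rewrite lee_fin.
    have -> : (\int[lebesgue_measure]_(t in `]0%R, +oo[) (A t)%:E =
      (fine (\int[lebesgue_measure]_(t in `]0%R, +oo[) (A t)%:E))%:E)%E by rewrite fineK.
    by rewrite -EFinM ltry.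
  - by apply: measurable_funTS; exact/measurable_EFinP.
  - by move=> t _; rewrite lee_fin.
  - by rewrite lee_fin fine_ge0.
have gi w' : (@lebesgue_measure R).-integrable `]0, +oo[%classic (EFin \o g w').
  apply: (le_integrable _ _ _ mi) => //.
    apply/measurable_EFinP.
    have X := @measurable_funTS _ _ (measurableTypeR R) _ `]0, +oo[%classic _ (mg w').
    exact: X.
  move=> t _; rewrite /= lee_fin (ger0_norm (mass0 t))// gE ler_norml.
  have f0 : 0 <= fine (gap_t w' t) by rewrite fine_ge0.
  have f2 : fine (gap_t w' t) <= 2 * mass t.
    by rewrite -lee_fin fineK// ge0_fin_numE// (le_lt_trans (gap_le w' t))// ltry.
  by apply/andP; split; lra.
have gapE : potential_gap w = (\int[lebesgue_measure]_(t in `]0%R, +oo[) ((g 0 t)%:E - (g w t)%:E))%E.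
  apply: eq_integral => u _; rewrite -[LHS]/(gap_t w u) gap_tE.
  by rewrite (gE 0) gap0 subr0.
have mD : measurable (`]0, +oo[%classic : set (measurableTypeR R)) by exact: measurable_itv.
have F w' := integrable_fin_num mD (gi w').
have U w' : (smooth_potential w')%:E = (\int[lebesgue_measure]_(t in `]0%R, +oo[) (g w' t)%:E)%E.
  rewrite smooth_potential_Rintegral; exact: fineK (F w').
apply: (eq_trans (congr2 adde (U w) gapE)); apply: (eq_trans _ (esym (U 0))).
have K := integralB_EFin mD (gi 0) (gi w).
apply: eq_trans (congr1 (adde _) K) _.
have C (a b : \bar R) : a \is a fin_num -> (a + (b - a) = b)%E.
  by move=> fa; rewrite addeC subeK.
exact: C (F w).
Qed.

Section expectation.
Context dT (T : measurableType dT) (P : probability T R).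
Variable W : T -> 'rV[R]_d.
Hypothesis mW : measurable_fun setT W.

Let measurable_gap_pair :
  measurable_fun setT (fun z : T * measurableTypeR R => gap_t (W z.1) z.2).
Proof.
apply: (@measurable_fun_integral_dom _ _ (T * measurableTypeR R)%type 'rV[R]_d R sigma S
  (fun z => (A z.1.2 * (1 - cos (dotv ((2 * pi * z.1.2) *: z.2) (W z.1.1))))%:E)) => //.
- exact: measurable_sphere.
- apply: (@measurable_phase _ _ (fun z => W z.1.1) snd (fun z => z.1.2)) => //.
  + apply: measurableT_comp => //.
    by apply: measurableT_comp; [exact: measurable_fst|exact: measurable_fst].
  + have X := measurableT_comp (@measurable_snd _ _ T (measurableTypeR R))
      (@measurable_fst _ _ (T * measurableTypeR R)%type 'rV[R]_d).
    exact: X.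
Qed.

Lemma measurable_potential_gap : measurable_fun setT (fun om => potential_gap (W om)).
Proof.
exact: (@measurable_fun_integral_dom _ _ T (measurableTypeR R) R lebesgue_measure
  `]0%R, +oo[ (fun z => gap_t (W z.1) z.2)).
Qed.

(** by Tonelli the mean gap depends on the law only through its characteristic
function *)
Lemma integral_potential_gap :
  (\int[P]_om potential_gap (W om) =
   \int[lebesgue_measure]_(t in `]0%R, +oo[) \int[sigma]_(theta in @sphere R d)
     (A t * (1 - charf P W ((2 * pi * t) *: theta)))%:E)%E.
Proof.
have K := @tonelli_dom _ _ T (measurableTypeR R) R P lebesgue_measure `]0%R, +oo[
  (fun z => gap_t (W z.1) z.2) (measurable_itv _) measurable_gap_pair (fun z => gap_t_ge0 _ _).
rewrite [LHS]K; apply: eq_integral => t _.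
have mp : measurable_fun setT (fun z : T * 'rV[R]_d =>
    (A t * (1 - cos (dotv ((2 * pi * t) *: z.2) (W z.1))))%:E).
  apply: (@measurable_phase _ _ (fun z => W z.1) snd (cst t)) => //.
  exact: measurableT_comp.
have K2 := @tonelli_dom _ _ T 'rV[R]_d R P sigma S _ measurable_sphere mp
  (fun z => gap_integrand_ge0 _ _ _).
rewrite [LHS]K2; apply: eq_integral => th _ /=.
rewrite EFinM -integral_one_sub_cos// -ge0_integralZl//.
- apply/measurable_EFinP; apply: measurable_funB => //.
  by apply: measurable_fun_cos; exact: measurable_dotv.
- by rewrite lee_fin.
Qed.

Lemma measurable_smooth_potential :
  measurable_fun setT (fun om => smooth_potential (W om)).
Proof.
rewrite (_ : (fun _ => _) = (fun om => smooth_potential 0 - fine (potential_gap (W om)))).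
  apply: measurable_funB => //; apply: measurableT_comp => //.
  exact: measurable_potential_gap.
apply/funext => om; have := potential_gapE (W om).
case: (potential_gap _) => //= r [<-]; ring.
Qed.

Lemma integral_smooth_potential :
  (\int[P]_om (smooth_potential (W om))%:E + \int[P]_om potential_gap (W om) =
   (smooth_potential 0)%:E)%E.
Proof.
rewrite -ge0_integralD//.
- under eq_integral do rewrite potential_gapE.
  rewrite integral_cst// -[RHS]mule1; congr (_ * _)%E.
  exact: (@probability_setT _ _ _ P).
- by move=> om _; rewrite lee_fin smooth_potential_ge0.
- by apply/measurable_EFinP; exact: measurable_smooth_potential.
- by move=> om _; apply: integral_ge0 => t _; exact: gap_t_ge0.
- exact: measurable_potential_gap.
Qed.

End expectation.

Let measurable_charf_gap dT (T : measurableType dT) (P : probability T R)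
    (W : T -> 'rV[R]_d) : measurable_fun setT W ->
  measurable_fun setT (fun z : measurableTypeR R * 'rV[R]_d =>
    (A z.1 * (1 - charf P W ((2 * pi * z.1) *: z.2)))%:E).
Proof.
move=> mW.
have E (z : measurableTypeR R * 'rV[R]_d) :
    ((A z.1 * (1 - charf P W ((2 * pi * z.1) *: z.2)))%:E =
    \int[P]_(om in setT) (A z.1 * (1 - cos (dotv ((2 * pi * z.1) *: z.2) (W om))))%:E)%E.
  rewrite EFinM -integral_one_sub_cos// -ge0_integralZl//.
  - apply/measurable_EFinP; apply: measurable_funB => //.
    by apply: measurable_fun_cos; exact: measurable_dotv.
  - by rewrite lee_fin.
under eq_fun do rewrite E.
apply: (@measurable_fun_integral_dom _ _ (measurableTypeR R * 'rV[R]_d)%type T R P setT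
  (fun z => (A z.1.1 * (1 - cos (dotv ((2 * pi * z.1.1) *: z.1.2) (W z.2))))%:E)) => //.
apply: (@measurable_phase _ _ (fun z => W z.2) (fun z => z.1.2) (fun z => z.1.1)).
- by apply: measurableT_comp => //; exact: measurable_snd.
- by apply: measurableT_comp; [exact: measurable_snd|exact: measurable_fst].
- have X := measurableT_comp (@measurable_fst _ _ (measurableTypeR R) 'rV[R]_d)
    (@measurable_fst _ _ (measurableTypeR R * 'rV[R]_d)%type T).
  exact: X.
Qed.

(** a larger characteristic function gives a larger mean smoothed potential *)
Lemma le_integral_smooth_potential dT1 (T1 : measurableType dT1) (P1 : probability T1 R)
    dT2 (T2 : measurableType dT2) (P2 : probability T2 R)
    (W1 : T1 -> 'rV[R]_d) (W2 : T2 -> 'rV[R]_d) :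
  measurable_fun setT W1 -> measurable_fun setT W2 ->
  (forall y, charf P1 W1 y <= charf P2 W2 y) ->
  (\int[P1]_om (smooth_potential (W1 om))%:E <= \int[P2]_om (smooth_potential (W2 om))%:E)%E.
Proof.
move=> mW1 mW2 le12.
have gap_ge0 dT (T : measurableType dT) (P : probability T R) (W : T -> 'rV[R]_d) t th :
    measurable_fun setT W -> (0 <= (A t * (1 - charf P W ((2 * pi * t) *: th)))%:E)%E.
  by move=> mW; rewrite lee_fin mulr_ge0// subr_ge0 charf_le1.
have gap21 : (\int[P2]_om potential_gap (W2 om) <= \int[P1]_om potential_gap (W1 om))%E.
  rewrite (integral_potential_gap P2 mW2) (integral_potential_gap P1 mW1).
  have mth dT (T : measurableType dT) (P : probability T R) (W : T -> 'rV[R]_d) t :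
      measurable_fun setT W -> measurable_fun setT (fun th : 'rV[R]_d =>
        (A t * (1 - charf P W ((2 * pi * t) *: th)))%:E).
    move=> mW; exact: (measurableT_comp (measurable_charf_gap P mW) (measurable_pair1 (t : measurableTypeR R))).
  have mt dT (T : measurableType dT) (P : probability T R) (W : T -> 'rV[R]_d) :
      measurable_fun setT W -> measurable_fun setT (fun t : measurableTypeR R =>
        \int[sigma]_(th in S) (A t * (1 - charf P W ((2 * pi * t) *: th)))%:E)%E.
    move=> mW; apply: (@measurable_fun_integral_dom _ _ (measurableTypeR R) 'rV[R]_d R sigma S
      (fun z => (A z.1 * (1 - charf P W ((2 * pi * z.1) *: z.2)))%:E)).
    - exact: measurable_sphere.
    - exact: measurable_charf_gap.
    - by move=> z; exact: gap_ge0.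
  apply: ge0_le_integral => //.
  - by move=> t _; apply: integral_ge0 => th _; exact: gap_ge0.
  - by apply: measurable_funTS; exact: mt.
  - by apply: measurable_funTS; exact: mt.
  move=> t _; apply: ge0_le_integral.
  - exact: measurable_sphere.
  - by move=> th _; exact: gap_ge0.
  - by apply: measurable_funTS; exact: mth.
  - by apply: measurable_funTS; exact: mth.
  - by move=> th _; rewrite lee_fin ler_wpM2l// lerD2l lerN2.
have := integral_smooth_potential P1 mW1.
have := integral_smooth_potential P2 mW2.
have g1 : (0 <= \int[P1]_om potential_gap (W1 om))%E.
  by apply: integral_ge0 => om _; apply: integral_ge0 => t _; exact: gap_t_ge0.
have g2 : (0 <= \int[P2]_om potential_gap (W2 om))%E.
  by apply: integral_ge0 => om _; apply: integral_ge0 => t _; exact: gap_t_ge0.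
move: gap21 g1 g2; set a := integral P1 _ _; set b := integral P2 _ _.
set a' := integral P1 _ _; set b' := integral P2 _ _.
case: a => [a| |]; case: b => [b| |]; case: a' => [a'| |]; case: b' => [b'| |] //=.
rewrite -!EFinD !lee_fin => ba _ _ [E2] [E1].
lra.
Qed.

End smooth_potential.

(** * Negative moments *)

Lemma le_mean2 {R : realFieldType} (a v1 v2 b c : R) :
  a <= v1 + b -> a <= v2 + b -> b <= c -> a <= 2^-1 * (v1 + v2) + c.
Proof. lra. Qed.

Lemma mean2_le {R : realFieldType} (a v1 v2 : R) :
  v1 <= a -> v2 <= a -> 2^-1 * (v1 + v2) <= a.
Proof. lra. Qed.

Section negative_moments.
Context {R : realType} {d : nat}.
Variables (N : 'rV[R]_d -> R) (l : R).
Hypotheses (d0 : (0 < d)%N) (hN : is_norm N) (ld : 0 < l < d%:R).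

Let l0 : 0 < l. Proof. by case/andP: ld. Qed.

Lemma epow_negE (a : R) : 0 < a -> epow a%:E (- l) = (a `^ (- l))%:E.
Proof. by move=> a0; rewrite epow_neg// poweR_EFin inver gt_eqF ?powR_gt0// powRN. Qed.

Lemma epow_neg0 : epow (0%:E : \bar R) (- l) = +oo%E.
Proof. by rewrite epow_neg// poweR_EFin powR0 ?gt_eqF// inve0. Qed.

(** for a = 0 the limit is +oo, the value of epow at 0 for a negative exponent *)
Lemma cvg_powR_negl (a k : R) : 0 <= a -> 0 < k ->
  (((a + k / n.+1%:R) `^ (- l))%:E @[n --> \oo] --> epow a%:E (- l))%E.
Proof.
move=> a0 k0; have [aE|an0] := eqVneq a 0.
  rewrite aE epow_neg0; apply/cvgeryP/cvgryPge => B.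
  have /cvgryPge/(_ ((Num.max B 0 * k `^ l) `^ l^-1)) := @cvg_natSy R.
  apply: filterS => n; rewrite add0r => Bn.
  have n0 : 0 < n.+1%:R :> R by rewrite ltr0n.
  move: (n.+1%:R) n0 Bn => q q0 Bq.
  have M0 : 0 <= Num.max B 0 by rewrite le_max lexx orbT.
  rewrite powRN powRM ?(ltW k0) ?invr_ge0 ?(ltW q0)//.
  have -> : (k `^ l * q^-1 `^ l)^-1 = q `^ l / k `^ l.
    rewrite -(powR_inv1 (ltW q0)) -powRrM mulN1r powRN.
    by rewrite invfM invrK mulrC.
  apply: (@le_trans _ _ (Num.max B 0)); first by rewrite le_max lexx.
  rewrite ler_pdivlMr ?powR_gt0//.
  have -> : Num.max B 0 * k `^ l = ((Num.max B 0 * k `^ l) `^ l^-1) `^ l.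
    by rewrite -powRrM mulVf ?gt_eqF// powRr1// mulr_ge0// powR_ge0.
  by rewrite ge0_ler_powR ?nnegrE ?powR_ge0 ?(ltW l0) ?(ltW q0).
have ap : 0 < a by rewrite lt_neqAle eq_sym an0.
rewrite epow_negE//; apply: cvg_EFin; first exact: nearW.
have h : (a + k / n.+1%:R) @[n --> \oo] --> a.
  rewrite -[X in _ --> X]addr0 -[X in _ --> _ + X](mulr0 k).
  apply: cvgD; first exact: cvg_cst.
  apply: cvgM; first exact: cvg_cst.
  exact: cvg_harmonic.
have E n : 0 < a + k / n.+1%:R.
  by rewrite addr_gt0// divr_gt0.
rewrite (_ : fine \o _ = (fun n => expR (- l * ln (a + k / n.+1%:R)))); last first.
  by apply/funext => n; rewrite /= /powR gt_eqF.
have -> : a `^ (- l) = expR (- l * ln a) by rewrite /powR gt_eqF.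
apply: (@continuous_cvg _ _ _ _ _ (fun n => - l * ln (a + k / n.+1%:R)) expR).
  exact: continuous_expR.
apply: cvgM; first exact: cvg_cst.
apply: (@continuous_cvg _ _ _ _ _ (fun n => a + k / n.+1%:R) (@ln R)) => //.
exact: continuous_ln.
Qed.

Lemma measurable_epow_neg dT (T : measurableType dT) (W : T -> 'rV[R]_d) :
  measurable_fun setT W -> measurable_fun setT (fun om => epow (N (W om))%:E (- l)).
Proof.
move=> mW.
apply: (@emeasurable_fun_cvg _ _ _ setT
  (fun n om => ((N (W om) + 1 / n.+1%:R) `^ (- l))%:E)).
  move=> n; apply/measurable_EFinP; apply: (measurableT_comp (measurable_powR _)).
  by apply: measurable_funD => //; apply: measurableT_comp => //; exact: measurable_is_norm.
by move=> om _; apply: cvg_powR_negl => //; exact: is_norm_ge0.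
Qed.

Lemma le_smooth_potential e w delta : 0 < e -> 0 < delta ->
  (N w + (norm_lip N + 1) * delta) `^ (- l) <= smooth_potential N l e w +
  ((norm_lip N + 1) * delta) `^ (- l) *
    (Num.sqrt 2 ^+ d * expR (- (delta / e) ^+ 2 / 4)).
Proof.
move=> e0 de0.
have lip0 : 0 < norm_lip N + 1 by rewrite ltr_pwDr// norm_lip_ge0.
set tau := _ ^+ d * _.
have tau0 : 0 <= tau by rewrite mulr_ge0 ?expR_ge0// exprn_ge0// sqrtr_ge0.
have F w' := fineK (gauss_potential_fin d0 hN ld w' e0).
have h1 := le_gauss_potential d0 hN ld w e0 de0.
rewrite /smooth_potential; move: (is_normN hN w); move: (- w) => w' Nw'.
have h2 := le_gauss_potential d0 hN ld w' e0 de0.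
rewrite -(F w) -EFinD lee_fin -/tau in h1.
rewrite -(F w') -EFinD lee_fin Nw' -/tau in h2.
have h3 : (N w + (norm_lip N + 1) * delta) `^ (- l) * tau <=
    ((norm_lip N + 1) * delta) `^ (- l) * tau.
  rewrite ler_wpM2r// (le_powR_neg (ltW l0)) ?mulr_gt0//.
  by rewrite lerDr is_norm_ge0.
exact: le_mean2 h1 h2 h3.
Qed.

Lemma smooth_potential_le eta : 0 < eta < 1 -> exists2 C, 0 <= C & forall e w, 0 < e ->
  ((smooth_potential N l e w)%:E <= epow (N w)%:E (- l) *
   ((1 - eta) `^ (- l) + C * (e / (e + N w)))%:E)%E.
Proof.
move=> eta01; have [C C0 HC] := gauss_potential_le d0 hN ld eta01.
exists C => // e w e0.
have ome : 0 < 1 - eta by case/andP: eta01 => _ h; rewrite subr_gt0.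
have [Nw|Nw] := eqVneq (N w) 0.
  rewrite Nw epow_neg0 gt0_mulye ?leey// lte_fin.
  by rewrite addr0 ltr_pwDl ?powR_gt0// mulr_ge0// divr_ge0// ltW.
have Nw0 : 0 < N w by rewrite lt_neqAle eq_sym Nw is_norm_ge0.
rewrite epow_negE// -EFinM lee_fin.
have F w' := fineK (gauss_potential_fin d0 hN ld w' e0).
have h1 := HC e w e0 Nw0.
rewrite /smooth_potential; move: (is_normN hN w); move: (- w) => w' Nw'.
have h2 := HC e w' e0; rewrite Nw' in h2; move/(_ Nw0) : h2 => h2.
rewrite -(F w) lee_fin in h1; rewrite -(F w') lee_fin in h2.
exact: mean2_le h1 h2.
Qed.

Section comparison.
Context dT1 (T1 : measurableType dT1) (P1 : probability T1 R)
  dT2 (T2 : measurableType dT2) (P2 : probability T2 R).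
Variables (U : T1 -> 'rV[R]_d) (V : T2 -> 'rV[R]_d).
Hypotheses (mU : measurable_fun setT U) (mV : measurable_fun setT V).
Hypothesis charf_le : forall y, charf P1 U y <= charf P2 V y.
Hypothesis hL : embeds_negL l N.
Hypothesis Vfin : (\int[P2]_om epow (N (V om))%:E (- l) < +oo)%E.

Let lip := norm_lip N + 1.

Let lip0 : 0 < lip. Proof. by rewrite ltr_pwDr// norm_lip_ge0. Qed.

Let m2 := fine (\int[P2]_om epow (N (V om))%:E (- l)).

Let m2E : (\int[P2]_om epow (N (V om))%:E (- l) = m2%:E)%E.
Proof.
by rewrite fineK// ge0_fin_numE// integral_ge0// => om _; exact: epow_ge0.
Qed.

Let m2_ge0 : 0 <= m2.
Proof. by rewrite fine_ge0// integral_ge0// => om _; exact: epow_ge0. Qed.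

(** the weight e / (e + N), with e = 1 / (n + 1) *)
Let theta n (om : T2) : R := n.+1%:R^-1 / (n.+1%:R^-1 + N (V om)).

Let theta_ge0 n om : 0 <= theta n om.
Proof. by rewrite divr_ge0// addr_ge0// is_norm_ge0. Qed.

Let theta_le1 n om : theta n om <= 1.
Proof.
have N0 := is_norm_ge0 hN (V om).
by rewrite ler_pdivrMr ?ltr_pwDl// mul1r lerDl.
Qed.

Let measurable_theta n : measurable_fun setT (theta n).
Proof.
have mNV : measurable_fun setT (fun om => N (V om)).
  by apply: measurableT_comp => //; exact: measurable_is_norm.
rewrite (_ : theta n = (fun om => n.+1%:R^-1 * (n.+1%:R^-1 + N (V om)) `^ (- 1))).
  apply: measurable_funM => //; apply: (measurableT_comp (measurable_powR _)).
  exact: measurable_funD.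
by apply/funext => om; rewrite powR_inv1// addr_ge0// is_norm_ge0.
Qed.

(** The integral tends to 0 by dominated convergence: where the moment integrand
is finite, N does not vanish and the weight tends to 0. *)
Let residue_cvg0 :
  (\int[P2]_om (epow (N (V om))%:E (- l) * (theta n om)%:E) @[n --> \oo] --> 0)%E.
Proof.
have mE := measurable_epow_neg mV.
have iE : P2.-integrable setT (fun om => epow (N (V om))%:E (- l)).
  apply/integrableP; split=> //.
  by under eq_integral => om _ do rewrite gee0_abs ?epow_ge0//.
have aeF : {ae P2, forall om, epow (N (V om))%:E (- l) \is a fin_num}.
  by have := integrable_ae measurableT iE; apply: filterS => om; apply.
have [] := @dominated_convergence _ _ _ P2 setT measurableT
  (fun n om => epow (N (V om))%:E (- l) * (theta n om)%:E)%E (cst 0%E)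
  (fun om => epow (N (V om))%:E (- l)) _ _ _ iE _.
- by move=> n; apply: emeasurable_funM => //; apply/measurable_EFinP.
- exact: measurable_cst.
- apply: filterS aeF => om finE _.
  have Nne : N (V om) != 0.
    by apply/eqP => N0; move: finE; rewrite N0 epow_neg0.
  have N0 : 0 < N (V om) by rewrite lt_neqAle eq_sym Nne is_norm_ge0.
  rewrite epow_negE//; apply: cvg_EFin; first exact: nearW.
  rewrite [X in _ --> X](_ : 0 = N (V om) `^ (- l) * (0 * (0 + N (V om))^-1)); last first.
    by rewrite mul0r mulr0.
  apply: cvgM; first exact: cvg_cst.
  apply: cvgM; first exact: cvg_harmonic.
  apply: cvgV; first by rewrite add0r.
  by apply: cvgD; [exact: cvg_harmonic|exact: cvg_cst].
- apply: aeW => om n _; rewrite gee0_abs; last first.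
    by rewrite mule_ge0 ?epow_ge0// lee_fin.
  by rewrite -[leRHS]mule1 lee_wpmul2l ?epow_ge0// lee_fin.
move=> _ _; rewrite integral0; exact.
Qed.

(** the comparison of averaged potentials after letting e = 1 / (n + 1) tend to 0 *)
Let shifted_moment_le delta eta : 0 < delta -> 0 < eta < 1 ->
  (\int[P1]_om ((N (U om) + lip * delta) `^ (- l))%:E <=
   ((1 - eta) `^ (- l) * m2)%:E)%E.
Proof.
move=> de0 eta01; have [C C0 HC] := smooth_potential_le eta01.
have [sigma sigmaE] := hL.
pose k := (lip * delta) `^ (- l).
have k0 : 0 <= k by exact: powR_ge0.
pose r n := k * (Num.sqrt 2 ^+ d * expR (- (delta / n.+1%:R^-1) ^+ 2 / 4)).
pose D n := (\int[P2]_om (epow (N (V om))%:E (- l) * (theta n om)%:E))%E.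
have D0 n : (0 <= D n)%E.
  by apply: integral_ge0 => om _; rewrite mule_ge0 ?epow_ge0// lee_fin.
have bound n : (\int[P1]_om ((N (U om) + lip * delta) `^ (- l))%:E <=
    ((1 - eta) `^ (- l) * m2)%:E + C%:E * D n + (r n)%:E)%E.
  have e0 : 0 < n.+1%:R^-1 :> R by rewrite invr_gt0.
  have r0 : 0 <= r n by rewrite !mulr_ge0 ?exprn_ge0 ?sqrtr_ge0 ?expR_ge0.
  have mEs dT (T : measurableType dT) (W : T -> 'rV[R]_d) : measurable_fun setT W ->
      measurable_fun setT (fun om => (smooth_potential N l n.+1%:R^-1 (W om))%:E).
    by move=> mW; apply/measurable_EFinP; exact: measurable_smooth_potential sigmaE _ _ _ mW.
  have s0 w : (0 <= (smooth_potential N l n.+1%:R^-1 w)%:E)%E.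
    by rewrite lee_fin smooth_potential_ge0.
  have step1 : (\int[P1]_om ((N (U om) + lip * delta) `^ (- l))%:E <=
      \int[P1]_om (smooth_potential N l n.+1%:R^-1 (U om))%:E + (r n)%:E)%E.
    apply: (@le_trans _ _ (\int[P1]_om ((smooth_potential N l n.+1%:R^-1 (U om))%:E + (r n)%:E))%E).
      apply: ge0_le_integral => //.
      - by move=> om _; rewrite lee_fin powR_ge0.
      - apply/measurable_EFinP; apply: (measurableT_comp (measurable_powR _)).
        by apply: measurable_funD => //; apply: measurableT_comp => //; exact: measurable_is_norm.
      - by apply: emeasurable_funD => //; exact: mEs.
      - by move=> om _; rewrite -EFinD lee_fin; exact: le_smooth_potential.
    rewrite ge0_integralD//; last exact: mEs.
    rewrite leeD2l// integral_cst// -[leRHS]mule1 lee_wpmul2l// ?lee_fin//.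
    by rewrite le_eqVlt; apply/orP; left; apply/eqP; exact: (@probability_setT _ _ _ P1).
  have step2 := le_integral_smooth_potential d0 hN ld e0 sigmaE mU mV charf_le.
  have step3 : (\int[P2]_om (smooth_potential N l n.+1%:R^-1 (V om))%:E <=
      ((1 - eta) `^ (- l) * m2)%:E + C%:E * D n)%E.
    have mE := measurable_epow_neg mV.
    have mET : measurable_fun setT (fun om => epow (N (V om))%:E (- l) * (theta n om)%:E)%E.
      by apply: emeasurable_funM => //; apply/measurable_EFinP.
    apply: (@le_trans _ _ (\int[P2]_om (((1 - eta) `^ (- l))%:E * epow (N (V om))%:E (- l) +
        C%:E * (epow (N (V om))%:E (- l) * (theta n om)%:E)))%E).
      apply: ge0_le_integral => //.
      - exact: mEs.
      - by apply: emeasurable_funD; apply: emeasurable_funM.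
      move=> om _; apply: le_trans (HC _ (V om) e0) _.
      rewrite EFinD ge0_muleDr ?lee_fin ?powR_ge0 ?mulr_ge0//; last first.
        by rewrite invr_ge0 addr_ge0// is_norm_ge0.
      by rewrite muleC leeD2l// EFinM muleCA.
    rewrite ge0_integralD//; first last.
    - by apply: emeasurable_funM.
    - by move=> om _; rewrite !mule_ge0 ?epow_ge0 ?lee_fin.
    - by apply: emeasurable_funM.
    - by move=> om _; rewrite mule_ge0 ?epow_ge0// lee_fin powR_ge0.
    rewrite ge0_integralZl//; first last.
    - by rewrite lee_fin powR_ge0.
    - by move=> om _; rewrite epow_ge0.
    rewrite m2E -EFinM leeD2l// ge0_integralZl//; last first.
    by move=> om _; rewrite mule_ge0 ?epow_ge0 ?lee_fin.
  apply: le_trans step1 _; rewrite leeD2r//.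
  exact: le_trans step2 step3.
have /fine_cvgP[D_fin Dcvg] := residue_cvg0.
have rcvg : r n @[n --> \oo] --> 0.
  pose K := k * Num.sqrt 2 ^+ d * (delta ^+ 2 / 4)^-1.
  apply: (@squeeze_cvgr _ _ _ _ (fun=> 0) (fun n => K * n.+1%:R^-1)).
  - apply: nearW => n; apply/andP; split.
      by rewrite !mulr_ge0 ?exprn_ge0 ?sqrtr_ge0 ?expR_ge0.
    have -> : K * n.+1%:R^-1 = k * (Num.sqrt 2 ^+ d * ((delta ^+ 2 / 4)^-1 * n.+1%:R^-1)).
      by rewrite /K -(mulrA k) -(mulrA k) -(mulrA (_ ^+ d)).
    rewrite /r ler_wpM2l// ler_wpM2l ?exprn_ge0 ?sqrtr_ge0//.
    have q1 : 1 <= n.+1%:R :> R by rewrite ler1n.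
    move: (n.+1%:R) q1 => q q1; have q0 : 0 < q by rewrite (lt_le_trans ltr01).
    rewrite invrK -invfM mulNr expRN lef_pV2 ?posrE ?expR_gt0//; last first.
      by rewrite mulr_gt0// divr_gt0// exprn_gt0.
    apply: (@le_trans _ _ ((delta * q) ^+ 2 / 4)); last first.
      by rewrite (le_trans _ (expR_ge1Dx _))// lerDr.
    rewrite exprMn [leRHS]mulrAC ler_wpM2l ?divr_ge0 ?sqr_ge0//.
    by rewrite expr2 ler_peMr// ltW.
  - exact: cvg_cst.
  - rewrite [X in _ --> X](_ : 0 = K * 0); last by rewrite mulr0.
    by apply: cvgM; [exact: cvg_cst|exact: cvg_harmonic].
have tot : C * fine (D n) + r n @[n --> \oo] --> 0.
  rewrite [X in _ --> X](_ : 0 = C * 0 + 0); last by rewrite mulr0 addr0.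
  apply: cvgD => //; apply: cvgM => //; exact: cvg_cst.
apply/lee_addgt0Pr => eps eps0.
have : \forall n \near \oo, (\int[P1]_om ((N (U om) + lip * delta) `^ (- l))%:E <=
   ((1 - eta) `^ (- l) * m2)%:E + eps%:E)%E.
  near=> n.
  apply: le_trans (bound n) _.
  have Dn : D n \is a fin_num by near: n.
  rewrite -(fineK Dn) -EFinM -!EFinD lee_fin -addrA lerD2l ltW//.
  near: n; exact: cvgr_lt tot _ eps0.
by move=> [n0 _ /(_ n0)]; apply => /=.
Unshelve. all: by end_near. Qed.

(** letting eta tend to 0 *)
Let shifted_moment_le1 delta : 0 < delta ->
  (\int[P1]_om ((N (U om) + lip * delta) `^ (- l))%:E <= m2%:E)%E.
Proof.
move=> de0; apply/lee_addgt0Pr => eps eps0.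
pose b := 1 + eps / (m2 + 1).
have m21 : 0 < m2 + 1 by rewrite ltr_wpDl.
have b1 : 1 < b by rewrite ltrDl divr_gt0.
have b0 : 0 < b by rewrite (lt_trans ltr01).
(* this eta satisfies (1 - eta)^(-l) = b *)
pose eta := 1 - b `^ (- l^-1).
have bl : 0 < b `^ (- l^-1) < 1.
  rewrite powR_gt0//= powRN invf_lt1 ?powR_gt0//.
  have -> : 1 = 1 `^ l^-1 :> R by rewrite powR1.
  by rewrite gt0_ltr_powR ?invr_gt0 ?nnegrE ?ler01 ?(ltW b0).
have eta01 : 0 < eta < 1 by rewrite /eta; lra.
apply: le_trans (shifted_moment_le de0 eta01) _.
rewrite -EFinD lee_fin /eta opprB addrC subrK -powRrM mulrNN mulVf ?gt_eqF//.
rewrite powRr1 ?(ltW b0)// /b mulrDl mul1r lerD2l mulrAC ler_pdivrMr//.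
by rewrite ler_wpM2l ?(ltW eps0)// lerDl.
Qed.

(** a larger characteristic function gives a larger negative moment *)
Lemma le_negative_moment : (\int[P1]_om epow (N (U om))%:E (- l) <=
  \int[P2]_om epow (N (V om))%:E (- l))%E.
Proof.
rewrite m2E.
pose g n (om : T1) := ((N (U om) + lip / n.+1%:R) `^ (- l))%:E.
have g0 n om : (0 <= g n om)%E by rewrite lee_fin powR_ge0.
have mg n : measurable_fun setT (g n).
  apply/measurable_EFinP; apply: (measurableT_comp (measurable_powR _)).
  by apply: measurable_funD => //; apply: measurableT_comp => //; exact: measurable_is_norm.
have ndg om : {homo g^~ om : n k / (n <= k)%N >-> (n <= k)%E}.
  move=> n k nk; rewrite lee_fin.
  have k0 : 0 < N (U om) + lip / k.+1%:R by rewrite ltr_wpDl ?is_norm_ge0// divr_gt0.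
  rewrite (le_powR_neg (ltW l0))//.
  by rewrite lerD2l ler_wpM2l ?(ltW lip0)// lef_pV2 ?posrE// ler_nat.
have gcvg om : (g n om @[n --> \oo] --> epow (N (U om))%:E (- l))%E.
  by apply: cvg_powR_negl => //; exact: is_norm_ge0.
have h := cvg_monotone_convergence measurableT mg (fun n om _ => g0 n om) (fun om _ => ndg om).
have E : (\int[P1]_om limn (g^~ om) = \int[P1]_om epow (N (U om))%:E (- l))%E.
  by apply: eq_integral => om _; apply: cvg_lim => //; exact: gcvg.
have {}h := h P1.
rewrite -E -(cvg_lim _ h)//; apply: lime_le; first by apply/cvg_ex; eexists; exact: h.
by apply: nearW => n; apply: shifted_moment_le1.
Qed.

End comparison.

End negative_moments.

(** * Conclusion *)

(** independence of a family indexed by an option type passes to the members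
    with index Some i *)
Lemma mutually_independent_Some {R : realType} dT (T : measurableType dT)
    (P : probability T R) (d : nat) (I : finType)
    (X : {RV P >-> 'rV[R]_d}) (Xs : I -> {RV P >-> 'rV[R]_d}) :
  mutually_independent (fun o : option I => if o is Some i then Xs i else X) ->
  mutually_independent Xs.
Proof.
move=> indep J A mA.
pose B (o : option I) := if o is Some i then A i else setT.
have mB o : measurable (B o) by case: o => [i|]; [exact: mA|exact: measurableT].
have := indep (Some @: J) B mB.
rewrite big_imset/=; last by move=> i j _ _ [].
move=> <-; congr (P _); apply/seteqP; split=> w /= Hw.
  by move=> o /imsetP[i iJ ->] /=; exact: Hw.
by move=> i iJ; apply: (Hw (Some i)); apply/imsetP; exists i.
Qed.

Theorem corollary4p7 (R : realType) (d n : nat) (hd : (0 < d)%N)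
  (dT : measure_display) (T : measurableType dT) (P : probability T R)
  (phi : 'rV[R]_d -> R)
  (X : {RV P >-> 'rV[R]_d}) (Xs : 'I_n -> {RV P >-> 'rV[R]_d})
  (E K : set 'rV[R]_d) (a : 'I_n -> R)
  (phi_meas : measurable_fun setT phi)
  (phi_ge0 : forall x, 0 <= phi x)
  (X_law : has_density X phi)
  (Xs_law : forall i, has_density (Xs i) phi)
  (indep : mutually_independent
     (fun o : option 'I_n => if o is Some i then Xs i else X))
  (phi_even : even_fun phi)
  (phihat_ge0 : forall x, 0 <= fourier (fun y => (phi y)%:C) x)
  (phihat_int : cintegrable (fourier (fun y => (phi y)%:C)))
  (phihat_logconvex : forall t : 'rV[R]_d,
     log_convex (fun r =>
       complex.Re (fourier (fun y => (phi y)%:C) (Num.sqrt r *: t))))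
  (E_ellipsoid : ellipsoid E)
  (K_norm : is_norm (gauge K))
  (a_simplex : simplex a) :
  let S := fun w => \sum_(i < n) Num.sqrt (a i) *: Xs i w in
  (forall l : R, 0 < l < d%:R ->
     (forall N : R, 0 < N -> (\int[P]_w (enorm (X w) `^ N)%:E < +oo)%E) ->
     embeds_negL l (gauge K) ->
     (moment P K (- l) X < +oo)%E ->
     forall (dT' : measure_display) (T' : measurableType dT')
       (P' : probability T' R) (Z : {RV P' >-> 'rV[R]_d}),
     centered_gaussian Z ->
     (forall i j, cov P' Z i j = cov P X i j) ->
     (knorm P K (- l) X / knorm P E 2 X * knorm P E 2 S <= knorm P K (- l) S
       /\ knorm P K (- l) S <=
          knorm P' K (- l) Z / knorm P E 2 X * knorm P E 2 S)%E) /\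
  (forall p : R, 0 < p < 2 ->
     (\int[P]_w (enorm (X w) `^ 2)%:E < +oo)%E ->
     embeds_Lp p (gauge K) ->
     forall (dT' : measure_display) (T' : measurableType dT')
       (P' : probability T' R) (Z : {RV P' >-> 'rV[R]_d}),
     centered_gaussian Z ->
     (forall i j, cov P' Z i j = cov P X i j) ->
     (knorm P K p X / knorm P E 2 X * knorm P E 2 S <= knorm P K p S
       /\ knorm P K p S <=
          knorm P' K p Z / knorm P E 2 X * knorm P E 2 S)%E).
Proof.
move=> S.
have indepXs := mutually_independent_Some indep.
have mX : measurable_fun setT X by exact: measurable_funPT.
have mS : measurable_fun setT S.
  exact: (measurable_psum Xs (fun i => Num.sqrt (a i)) (index_enum 'I_n)).
have K_ge0 x : 0 <= gauge K x by exact: is_norm_ge0.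
(* the norms of S and X in the ellipsoid coincide, which removes the
   normalizing factors *)
have knormE : (\int[P]_w (enorm (X w) `^ 2)%:E < +oo)%E ->
    forall x : \bar R, (x / knorm P E 2 X * knorm P E 2 S)%E = x.
  move=> X2 x.
  have [E0 Efin] := knorm_ellipsoid_gt0_fin phi_meas X_law E_ellipsoid
    (second_moment_lty X2) hd.
  have [A uA EE] := E_ellipsoid.
  have -> : knorm P E 2 S = knorm P E 2 X.
    rewrite /knorm (moment_ellipsoid P mS uA EE) (moment_ellipsoid P mX uA EE).
    congr (epow _ _); apply: eq_bigr => j _.
    exact: (second_moment_S phi_meas phi_ge0 X_law Xs_law indepXs phihat_ge0 a_simplex X2).
  exact: divVeK.
split=> [l ld XN KL KX dT' T' P' Z gZ covZ|p p02 X2 KL dT' T' P' Z gZ covZ].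
  have X2 := XN 2 (ltr0Sn _ _).
  rewrite (knormE X2 (knorm P K (- l) X)) (knormE X2 (knorm P' K (- l) Z)).
  have mZ : measurable_fun setT Z by exact: measurable_funPT.
  have l0 : 0 < l by case/andP: ld.
  have SX := charf_S_le phi_meas phi_ge0 X_law Xs_law indepXs phihat_ge0
    phihat_logconvex a_simplex X2.
  have ZS y := charf_gaussian_le_S phi_meas phi_ge0 X_law Xs_law indepXs phihat_ge0
    phihat_logconvex a_simplex X2 y gZ covZ.
  have momS : (moment P K (- l) S <= moment P K (- l) X)%E.
    exact: (le_negative_moment hd K_norm ld mS mX SX KL KX).
  have Sfin : (moment P K (- l) S < +oo)%E by exact: le_lt_trans momS KX.
  have momZ : (moment P' K (- l) Z <= moment P K (- l) S)%E.
    exact: (le_negative_moment hd K_norm ld mZ mS ZS KL Sfin).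
  exact: (conj (le_knorm_neg l0 momS) (le_knorm_neg l0 momZ)).
rewrite (knormE X2 (knorm P K p X)) (knormE X2 (knorm P' K p Z)).
have mZ : measurable_fun setT Z by exact: measurable_funPT.
have p0 : 0 < p by case/andP: p02.
have SX := charf_S_le phi_meas phi_ge0 X_law Xs_law indepXs phihat_ge0
  phihat_logconvex a_simplex X2.
have ZS y := charf_gaussian_le_S phi_meas phi_ge0 X_law Xs_law indepXs phihat_ge0
  phihat_logconvex a_simplex X2 y gZ covZ.
have momE dT0 (T0 : measurableType dT0) (P0 : probability T0 R) (W : T0 -> 'rV[R]_d) :
    moment P0 K p W = (\int[P0]_w (gauge K (W w) `^ p)%:E)%E.
  by apply: eq_integral => w _; rewrite epow_pos ?(ltW p0)// poweR_EFin.
have momS : (moment P K p S <= moment P' K p Z)%E.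
  rewrite (momE _ _ P S) (momE _ _ P' Z).
  exact: (le_norm_moment_charf p02 KL mZ mS ZS).
have momX : (moment P K p X <= moment P K p S)%E.
  rewrite (momE _ _ P X) (momE _ _ P S).
  exact: (le_norm_moment_charf p02 KL mS mX SX).
exact: (conj (le_knorm_pos p0 momX) (le_knorm_pos p0 momS)).
Qed.
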